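(* Let $0<q<1$, let $a$ be a positive integer and let $G$ be a finite abelian group of exponent dividing $a$. For each $n$ let $\Gamma\in G(n,q)$ be an Erdős–Rényi random graph with sandpile group $S$, and let $H_n$ be a uniform random $n\times n$ symmetric matrix with entries in $\mathbb{Z}/a\mathbb{Z}$. Then $$\lim_{n\to\infty}\mathbb{P}(S\otimes\mathbb{Z}/a\mathbb{Z}\simeq G)=\lim_{n\to\infty}\mathbb{P}(\operatorname{cok}(H_n)\simeq G).$$
   Context: $G(n,q)$: random graph on the labeled vertex set $[n]=\{1,\dots,n\}$ in which each of the $\binom n2$ possible edges is present independently with probability $q$. Sandpile group: for a graph $\Gamma$ on $[n]$, the Laplacian $L_\Gamma$ is the $n\times n$ integer matrix with $(i,j)$ entry $1$ if $i\neq j$ and $\{i,j\}$ is an edge, $0$ if $i\ne j$ and $\{i,j\}$ is not an edge, and $-\deg(i)$ if $i=j$. Let $Z\subset\mathbb{Z}^n$ be the subgroup of vectors whose coordinates sum to $0$. The column space of $L_\Gamma$ is contained in $Z$, and the sandpile group of $\Gamma$ is $Z/L_\Gamma\mathbb{Z}^n$, a finitely generated abelian group. For an $n\times n$ matrix $M$ over a ring $R$, $\operatorname{cok}(M)=R^n/MR^n$. The tensor product is over $\mathbb{Z}$. *)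

(* Defs.v *)
From HB Require Import structures.
From mathcomp Require Import all_boot all_order all_algebra abelian.
From mathcomp Require Import all_classical all_reals all_analysis.
From mathcomp Require Import ring_quotient.
From mathcomp.multinomials Require Import freeg.

Set Implicit Arguments.
Unset Strict Implicit.
Unset Printing Implicit Defensive.

Import Order.TTheory GRing.Theory Num.Theory.
Import numFieldNormedType.Exports.

Local Open Scope classical_set_scope.
Local Open Scope ring_scope.

Definition isoZ (A B : zmodType) : Prop :=
  exists f : {additive A -> B}, bijective f.

(* The ring Z/aZ for a > 0.  The library's 'Z_a is Z/2Z when a = 1, hence the
   alias below; as Z/1Z is the zero ring, it is a pzRing and not an nzRing. *)
Definition Zmod (a : nat) : Type := 'I_a.-1.+1.
HB.instance Definition _ a := FinRing.Zmodule.on (Zmod a).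
HB.instance Definition _ a := GRing.Zmodule_isComPzRing.Build (Zmod a)
  (@Zp_mulA _) (@Zp_mulC _) (@Zp_mul1z _) (@Zp_mul_addl _).

Section Cokernel.
Variables (R : pzRingType) (m n : nat) (M : 'M[R]_(m, n)).

Definition colspace : pred 'cV[R]_m := fun x => `[< exists v, x = M *m v >].

Lemma colspace_zmod : zmod_closed colspace.
Proof.
split; first by apply/asboolP; exists 0; rewrite mulmx0.
move=> x y /asboolP[u ->] /asboolP[v ->]; apply/asboolP.
by exists (u - v); rewrite mulmxBr.
Qed.
HB.instance Definition _ := GRing.isZmodClosed.Build _ colspace colspace_zmod.

Definition cok : zmodType :=
  {ideal_quot (GRing.ZmodClosed.clone _ colspace _)}.

End Cokernel.

Section Generated.
Variables (V : zmodType) (X : set V).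

(* The subgroup of V generated by X, as the intersection of the subgroups
   containing X. *)
Definition span_sub : pred V :=
  fun x => `[< forall H : zmodClosed V, (forall y, X y -> y \in H) -> x \in H >].

Lemma span_sub_zmod : zmod_closed span_sub.
Proof.
split; first by apply/asboolP => H _; exact: rpred0.
move=> x y /asboolP hx /asboolP hy; apply/asboolP => H hH.
by apply: rpredB; [exact: hx | exact: hy].
Qed.
HB.instance Definition _ := GRing.isZmodClosed.Build _ span_sub span_sub_zmod.
End Generated.

Section Tensor.
Variables A B : zmodType.

Definition free_pair (a : A) (b : B) : {freeg (A * B)%type} :=
  Freeg [:: (1%Z, (a, b))].

Definition bilinear_rel : set {freeg (A * B)%type} :=
  [set z | (exists a a' b,
              z = free_pair (a + a') b - free_pair a b - free_pair a' b) \/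
           (exists a b b',
              z = free_pair a (b + b') - free_pair a b - free_pair a b')].

Definition tensor : zmodType :=
  {ideal_quot (GRing.ZmodClosed.clone _ (span_sub bilinear_rel) _)}.

End Tensor.

Section Graph.
Variable n : nat.

Definition pairs : {set {set 'I_n}} := [set e : {set 'I_n} | #|e| == 2]%SET.

Record graph := Graph { edges :> {set {set 'I_n}}; _ : edges \subset pairs }.
HB.instance Definition _ := [isSub for edges].
HB.instance Definition _ := [Finite of graph by <:].

Definition vdeg (g : graph) (i : 'I_n) : nat := #|[set e in edges g | i \in e]%SET|.

Definition laplacian (g : graph) : 'M[int]_n :=
  \matrix_(i, j) (if i == j then - (vdeg g i)%:Z
                  else if [set i; j]%SET \in edges g then 1 else 0).

Definition zero_sum : pred 'cV[int]_n := fun v => \sum_i v i 0 == 0.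

Lemma zero_sum_zmod : zmod_closed zero_sum.
Proof.
split; first by rewrite unfold_in big1 // => i _; rewrite mxE.
move=> x y /eqP hx /eqP hy; apply/eqP.
under eq_bigr do rewrite !mxE.
by rewrite sumrB hx hy subrr.
Qed.
HB.instance Definition _ := GRing.isZmodClosed.Build _ zero_sum zero_sum_zmod.

Record zero_sum_vec := ZeroSum { zs_val :> 'cV[int]_n; _ : zero_sum zs_val }.
HB.instance Definition _ := [isSub for zs_val].
HB.instance Definition _ := [Choice of zero_sum_vec by <:].
HB.instance Definition _ := [SubChoice_isSubZmodule of zero_sum_vec by <:].

Definition lap_image (g : graph) : pred zero_sum_vec :=
  fun z => zs_val z \in colspace (laplacian g).

Lemma lap_image_zmod g : zmod_closed (lap_image g).
Proof.
split; first exact: rpred0.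
move=> x y hx hy; rewrite unfold_in /lap_image.
have -> : zs_val (x - y) = zs_val x - zs_val y by exact: (raddfB val x y).
exact: rpredB.
Qed.
HB.instance Definition _ g :=
  GRing.isZmodClosed.Build _ (lap_image g) (lap_image_zmod g).

Definition sandpile (g : graph) : zmodType :=
  {ideal_quot (GRing.ZmodClosed.clone _ (lap_image g) _)}.

End Graph.

(* P(Gamma in E) for Gamma in G(n, q): the edge indicators are independent
   Bernoulli variables of parameter q. *)
Definition erdos_renyi (R : realType) (n : nat) (q : R) (E : set (graph n)) : R :=
  \sum_(g : graph n | `[< E g >])
    \prod_(e in pairs n) (if e \in edges g then q else 1 - q).

Definition unif_proba (R : realType) (T : finType) (E : set T) : R :=
  #|[set x : T | `[< E x >]]%SET|%:R / #|T|%:R.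

Definition symmx (a n : nat) : finType := {M : 'M[Zmod a]_n | M^T == M}.

(* Main.v *)
Require Import Defs.
From HB Require Import structures.
From mathcomp.multinomials Require Import freeg.
From mathcomp Require Import all_boot all_order all_algebra all_fingroup.
From mathcomp Require Import pgroup abelian cyclic separable cyclotomic complex.
From mathcomp Require Import all_classical all_reals all_analysis.
From mathcomp Require Import ring lra zify.
From mathcomp Require Import ring_quotient generic_quotient.

(* Idea.  Let K be the kernel over Z/a of a symmetric N x N matrix A; by Smith
   normal form cok(A) is isomorphic to K.  The law of K is read off the moments
   counting the k-tuples c in K^k with a prescribed group of relations.

   Fourier inversion writes such a moment as an average, over w in W^N with
   W = (Z/a)^k x (Z/a)^k, of the characteristic function of A at w.  Let Q be
   the quadratic form (x, y) |-> <x, y> on W.  For a uniform symmetric A the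
   characteristic function is the indicator of "Q vanishes on all differences of
   entries of w and on the entries of w"; for the reduced Laplacian of G(N+1, q)
   it is 1 on those w and is at most rho^b otherwise, where rho < 1 and b counts
   the pairs of vertices carrying a nonzero value of Q.  Since a set on which Q
   vanishes in this sense has at most a^k elements, the remaining w contribute
   o(a^(kN)), and the moments of the two models have the same limits.

   Moments grow too fast to determine the law of K by inclusion-exclusion on
   subgroups.  Instead, to force a tuple c to generate K one treats the primes p
   dividing a in turn: y = |K / (<c> + pK)| is a power of p, and y^i is again a
   moment, of (k+i)-tuples.  The indicator of y = 1 is approximated by a
   polynomial in y vanishing at p, ..., p^m, with an error of at most 4 times
   p^(-m(m+1)/2-m) times h(y), the product of the y - p^i for i <= m.  The sum of
   h(y) over c in K^k is at most |K|^k p^(-(m+1)k) times the number of independent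
   (m+1)-tuples of elements of order p in K; in the uniform model its expectation
   is O(p^(m(m+1)/2)) uniformly in N, so the error is O(p^-m).  Since h(y) is a
   polynomial in y, the same bound holds in the limit for Laplacians. *)

Set Implicit Arguments.
Unset Strict Implicit.
Unset Printing Implicit Defensive.

Import Order.TTheory GRing.Theory Num.Theory.
Import numFieldNormedType.Exports.

Local Open Scope ring_scope.

(** * Characters and isotropic sets *)

(** Kernels are convenient because membership of a tuple [c] in [K^k] is the linear equation
    [A *m c = 0], which characters detect. Neither limit of the theorem is computed: both models
    share the limits [limPhi] of their moments, and everything that follows sees a model only
    through these limits.

    The obstacle is that for Laplacians the error of the polynomial approximation is controlled only
    for large N at a fixed degree. Hence the order of the limits: N first with [m] fixed, then [m].
    The size of the limiting error is borrowed from the uniform model, where a change of basis and a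
    count give an estimate free of N.

    Treating one prime at a time works because adjoining [d] with [p d] in [<c>] enlarges [<c>] by
    an index that is a power of [p], so the conditions at the other primes do not change. As Z/a
    need not be a field, linear algebra over it goes through integer lifts and their Smith forms. *)

Section Character.
Variables (a : nat) (a_gt0 : (0 < a)%N) (C : numClosedFieldType).

Lemma prim_root_ex n : (0 < n)%N -> {z : C | n.-primitive_root z}.
Proof.
pose p : {poly C} := 'X^n - 1; have [r Dp] := closed_field_poly_normal p.
move=> n_gt0; apply/sigW; rewrite (monicP _) ?monicXnsubC // scale1r in Dp.
have rn1: all n.-unity_root r by apply/allP=> z; rewrite -root_prod_XsubC -Dp.
have sz_r: (n < (size r).+1)%N.
  by rewrite -(size_prod_XsubC r id) -Dp size_XnsubC.
have [|z] := hasP (has_prim_root n_gt0 rn1 _ sz_r); last by exists z.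
by rewrite -separable_prod_XsubC -Dp separable_Xn_sub_1 // pnatr_eq0 -lt0n.
Qed.

(** One faithful character is enough: composed with a bilinear pairing it gives every character
    needed below, and faithfulness makes that character nontrivial as soon as the pairing is
    nonzero. *)
Lemma faithful_char_ex : {e : Zmod a -> C |
  [/\ forall x y, e (x + y) = e x * e y, forall x, `|e x| = 1
    & forall x, e x = 1 -> x = 0]}.
Proof.
have [z prz] := prim_root_ex a_gt0.
have zpow (x : Zmod a) : (z ^+ (x : 'I_a.-1.+1)) ^+ a = 1.
  by rewrite exprAC (prim_expr_order prz) expr1n.
exists (fun x : 'I_a.-1.+1 => z ^+ x); split.
- move=> x y /=; rewrite -exprD -(prim_expr_mod prz (x + y)%N).
  congr (z ^+ _); transitivity ((x + y)%N %% a.-1.+1)%N => //.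
  by congr (_ %% _)%N; rewrite prednK.
- move=> x; apply/eqP; rewrite -(@pexpr_eq1 _ _ a) // -normrX zpow normr1 //.
- move=> x /eqP; rewrite -(prim_order_dvd prz) => ax; apply: (@ord_inj a.-1.+1).
  have: (nat_of_ord (x : 'I_a.-1.+1) < a)%N.
    by apply: leq_trans (ltn_ord (x : 'I_a.-1.+1)) _; rewrite prednK.
  case: (nat_of_ord x) ax => // k /dvdn_leq - /(_ isT).
  by rewrite leqNgt => /negPf ->.
Qed.
End Character.

(** Reindexing by [h] shows that the sum equals [c] times itself. The orthogonality relations below
    are instances in which [h] is a translation. *)
Lemma sum_char0 (C : idomainType) (I : finType) (h : I -> I) (f : I -> C) (c : C) :
  injective h -> (forall x, f (h x) = c * f x) -> c != 1 -> \sum_x f x = 0.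
Proof.
move=> hI fh c1; apply/eqP.
have: \sum_x f x = c * \sum_x f x.
  by rewrite mulr_sumr [LHS](reindex_inj hI); apply: eq_bigr => x _; rewrite fh.
move/eqP; rewrite -subr_eq0 -{1}[\sum_x _]mul1r -mulrBl mulf_eq0 subr_eq0 eq_sym.
by rewrite (negPf c1).
Qed.

Section QuadraticForm.
Variables (a k : nat).
Local Notation Zm := (Zmod a).
Local Notation W := ('rV[Zm]_k * 'rV[Zm]_k)%type.

Definition dot (x y : 'rV[Zm]_k) : Zm := \sum_s x 0 s * y 0 s.

Lemma dotBl x y z : dot (x - y) z = dot x z - dot y z.
Proof. by rewrite -sumrB; apply: eq_bigr => s _; rewrite !mxE mulrBl. Qed.
Lemma dotBr x y z : dot z (x - y) = dot z x - dot z y.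
Proof. by rewrite -sumrB; apply: eq_bigr => s _; rewrite !mxE mulrBr. Qed.
Lemma dotDr x y z : dot z (x + y) = dot z x + dot z y.
Proof. by rewrite -big_split; apply: eq_bigr => s _; rewrite !mxE mulrDr. Qed.
Lemma dotC x y : dot x y = dot y x.
Proof. by apply: eq_bigr => s _; rewrite mulrC. Qed.
Lemma dot_delta x s : dot x (delta_mx 0 s) = x 0 s.
Proof.
rewrite /dot (bigD1 s) //= mxE !eqxx mulr1 big1 ?addr0 // => t ts.
by rewrite mxE (negPf ts) andbF mulr0.
Qed.
Lemma dot0l x : dot 0 x = 0.
Proof. by rewrite /dot big1 // => s _; rewrite mxE mul0r. Qed.
Lemma dot0r x : dot x 0 = 0.
Proof. by rewrite dotC dot0l. Qed.

Definition qf (w : W) : Zm := dot w.1 w.2.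
Definition bf (u v : W) : Zm := dot u.1 v.2 + dot v.1 u.2.

Lemma qfB u v : qf (u - v) = qf u + qf v - bf u v.
Proof.
rewrite /qf /bf /= dotBl !dotBr !opprD !opprK [- _ + dot v.1 v.2]addrC.
by rewrite !addrA; congr (_ + _); rewrite -!addrA; congr (_ + _); rewrite addrC.
Qed.

Lemma bfDr u v w : bf u (v + w) = bf u v + bf u w.
Proof.
rewrite /bf /= dotDr [dot (_ + _) _]dotC dotDr !(dotC u.2) -!addrA; congr (_ + _).
by rewrite addrCA.
Qed.

Lemma bfBl u v w : bf (u - v) w = bf u w - bf v w.
Proof.
rewrite /bf /= dotBl dotBr opprD -!addrA; congr (_ + _).
by rewrite addrCA.
Qed.

(** The multiplier [r] is 1 for the sets that govern the limits of moments, and the prime [p] for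
    the letters at those positions where only [p] times the form is controlled. *)
Definition isoset r (T : {set W}) :=
  [forall u in T, [forall v in T, qf (u - v) *+ r == 0]].

Lemma isosetP r (T : {set W}) :
  reflect (forall u v, u \in T -> v \in T -> qf (u - v) *+ r = 0) (isoset r T).
Proof.
apply: (iffP forall_inP) => [h u v uT vT|h u uT].
  by apply/eqP/(forall_inP (h u uT)).
by apply/forall_inP => v vT; apply/eqP/h.
Qed.

Section Card.
Variables (C : numClosedFieldType) (e : Zm -> C).
Hypotheses (eD : forall x y, e (x + y) = e x * e y)
  (en : forall x, `|e x| = 1) (e1 : forall x, e x = 1 -> x = 0).

Lemma char0 : e 0 = 1.
Proof.
have e0 : e 0 != 0 by rewrite -normr_eq0 en oner_eq0.
by apply: (mulfI e0); rewrite -eD addr0 mulr1.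
Qed.

Lemma charN x : e (- x) = (e x)^*.
Proof.
have ex0 : e x != 0 by rewrite -normr_eq0 en oner_eq0.
apply: (mulfI ex0); rewrite -eD subrr char0 -normCK en expr1n //.
Qed.

Lemma char_sum (I : Type) (s : seq I) (P : pred I) (F : I -> Zm) :
  e (\sum_(i <- s | P i) F i) = \prod_(i <- s | P i) e (F i).
Proof. exact: (big_morph e eD char0). Qed.

Lemma sum_bf_char r (z : W) :
  z *+ r != 0 -> \sum_(v : W) e (- (bf z v *+ r)) = 0.
Proof.
move=> zr.
(* The form [bf] pairs the two halves of W, so a unit vector in one half reads off a nonzero
   coordinate in the other. *)
have [v bv] : exists v, bf z v *+ r != 0.
  have : (z.1 *+ r != 0) || (z.2 *+ r != 0).
    rewrite -negb_and; apply: contra zr => /andP[/eqP z1 /eqP z2].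
    apply/eqP; rewrite [LHS]surjective_pairing !raddfMn /= z1 z2 //.
  case/orP => /eqP/rowP; rewrite -existsNE => -[s /eqP]; rewrite mulmxnE mxE => zs.
    by exists (0, delta_mx 0 s); rewrite /bf /= dot_delta dot0l addr0.
  by exists (delta_mx 0 s, 0); rewrite /bf /= dot0r add0r dotC dot_delta.
apply: (@sum_char0 _ _ (fun x => v + x) _ (e (- (bf z v *+ r)))).
- exact: addrI.
- by move=> x /=; rewrite bfDr mulrnDl opprD eD.
- by apply/eqP => /e1/eqP; rewrite oppr_eq0 (negPf bv).
Qed.

(* Parseval for the unitary (up to scaling) matrix e(r * qf(u - v)): its T x T
   block is the all-ones matrix. *)
Lemma isoset_card r (T : {set W}) : isoset r T ->
  (#|T| ^ 2 <= #|{: W}| * #|[set u : W | (u *+ r == 0)%R]|)%N.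
Proof.
move=> /isosetP isoT.
have [->|/finset.set0Pn[t0 t0T]] := eqVneq T finset.set0; first by rewrite cards0.
have T0 : (0 < #|T|)%N by apply/card_gt0P; exists t0.
rewrite -(leq_pmul2l T0) -(ler_nat C).
pose S v := \sum_(u in T) e (qf (u - v) *+ r).
pose F (u u' v : W) := e (qf (u - v) *+ r) * (e (qf (u' - v) *+ r))^*.
have SS v : `|S v| ^+ 2 = \sum_(u in T) \sum_(u' in T) F u u' v.
  rewrite normCK rmorph_sum mulr_suml; apply: eq_bigr => u _.
  by rewrite mulr_sumr.
(* For [v] in [T] every term of [S v] is 1, so these [v] alone contribute [#|T| ^ 3]. *)
apply: (@le_trans _ _ (\sum_v `|S v| ^+ 2)).
  rewrite [leRHS](bigID (mem T)) /= -[leLHS]addr0; apply: lerD; last first.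
    by apply: sumr_ge0 => v _; rewrite exprn_ge0.
  rewrite natrM mulr_natl -sumr_const; apply: ler_sum => v vT.
  rewrite natrX.
  rewrite /S (eq_bigr (fun=> 1)) => [|u uT]; last by rewrite isoT // char0.
  by rewrite sumr_const normr_nat.
have tot_ge0 : 0 <= \sum_v `|S v| ^+ 2 by apply: sumr_ge0 => v _; rewrite exprn_ge0.
rewrite -(ger0_norm tot_ge0) (eq_bigr _ (fun v _ => SS v)) exchange_big /=.
apply: le_trans (ler_norm_sum _ _ _) _ => /=.
apply: (@le_trans _ _ (\sum_(u in T) (#|{: W}| * #|[set u : W | (u *+ r == 0)%R]|)%:R));
  last by rewrite sumr_const -[leLHS]mulr_natl -natrM.
apply: ler_sum => u uT; rewrite exchange_big /=.
apply: le_trans (ler_norm_sum _ _ _) _ => /=.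
(* In the expanded square the summand depends on [v] only through a character of frequency
   [(u - u') *+ r], whose sum over [v] vanishes unless this frequency is 0. *)
apply: (@le_trans _ _ (\sum_(u' : W | (u - u') *+ r == 0) #|{: W}|%:R)); last first.
  rewrite sumr_const -[leLHS]mulr_natl -natrM ler_nat mulnC leq_mul2l.
  apply/orP; right; rewrite -(card_imset _ (addrI (- u))).
  apply: subset_leq_card; apply/fintype.subsetP => x /imsetP[u' uu' ->].
  rewrite inE; have {}uu' : (u - u') *+ r = 0 by exact/eqP.
  by rewrite addrC -opprB mulNrn uu' oppr0.
rewrite [leLHS]big_mkcond [leRHS]big_mkcond; apply: ler_sum => u' _.
case: ifP => [u'T|_]; last by case: ifP.
have -> : \sum_v F u u' v = \sum_v e ((qf u - qf u') *+ r) * e (- (bf (u - u') v *+ r)).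
  apply: eq_bigr => v _; rewrite /F -charN -!eD !qfB bfBl; congr e.
  by rewrite -mulrnBl -mulrnBl; congr (_ *+ r); rewrite !opprD !opprK; ring.
case: ifP => [_|/negbT uu']; last by rewrite -mulr_sumr sum_bf_char // mulr0 normr0.
apply: le_trans (ler_norm_sum _ _ _) _ => /=.
rewrite -sum1_card natr_sum; apply: ler_sum => v _.
by rewrite normrM !en mulr1.
Qed.
End Card.
End QuadraticForm.

(** * Words with few bad pairs *)

Section Limits.
Local Open Scope classical_set_scope.
Variable R : realType.
Implicit Types (x K : R).

Lemma cvg_div d (u : R^nat) (l : R) : (0 < d)%N ->
  u @ \oo --> l -> (fun n => u (n %/ d)%N : R) @ \oo --> l.
Proof.
move=> d0; apply: cvg_comp => A [N _ NA]; exists (N * d)%N => // n /= nN.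
by apply: NA => /=; rewrite leq_divRL.
Qed.

Lemma bernoulli (h : R) n : -1 <= h -> 1 + n%:R * h <= (1 + h) ^+ n.
Proof.
move=> h1; elim: n => [|n IH]; first by rewrite mul0r addr0 expr0.
have h0 : 0 <= 1 + h by lra.
rewrite exprS; apply: le_trans (ler_wpM2l h0 IH).
by have := mulr_ge0 (ler0n R n) (sqr_ge0 h); rewrite -natr1; lra.
Qed.

Lemma cvg_nat_expr x : 0 < x < 1 -> (fun n => n.+1%:R * x ^+ n) @ \oo --> (0 : R).
Proof.
(* The ratio [y], midway between [x] and 1, equals [x * (1 + h)]; Bernoulli bounds [n + 1] by
   [(1 + h^-1) * (1 + h) ^+ n], so a multiple of [y ^+ n] dominates. *)
move=> /andP[x0 x1]; pose h := (1 - x) / (2 * x); pose y := (1 + x) / 2.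
have h0 : 0 < h by rewrite divr_gt0 ?mulr_gt0 ?subr_gt0.
have yE : y = x * (1 + h) by rewrite /y /h; field; rewrite gt_eqF.
have y01 : 0 <= y < 1 by rewrite /y; lra.
have cy : (fun n => (1 + h^-1) * y ^+ n) @ \oo --> (0 : R).
  rewrite -[X in (_ --> X)](mulr0 (1 + h^-1)); apply: cvgM; first exact: cvg_cst.
  by apply: cvg_expr; case/andP: y01 => y0 y1; rewrite ger0_norm.
apply: (squeeze_cvgr _ (cvg_cst 0) cy); apply: nearW => n; apply/andP; split.
  by rewrite mulr_ge0 ?ler0n ?exprn_ge0 ?ltW.
rewrite yE exprMn mulrCA mulrC; apply: ler_wpM2l; first by rewrite exprn_ge0 ?ltW.
have hi : 0 < h^-1 by rewrite invr_gt0.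
apply: (@le_trans _ _ ((1 + h^-1) * (1 + n%:R * h))); last first.
  by apply: ler_wpM2l; [lra | apply: bernoulli; lra].
rewrite mulrDr mulr1 [(1 + h^-1) * _]mulrCA mulrDl mulVf ?gt_eqF // mul1r.
rewrite mulrDr mulr1 -natr1; have := mulr_ge0 (ler0n R n) (ltW h0); lra.
Qed.

Lemma cvg_expr_sqr x K : 0 <= x < 1 -> 0 <= K ->
  (fun n => K ^+ n * x ^+ (n ^ 2)) @ \oo --> (0 : R).
Proof.
move=> /andP[x0 x1] K0.
have cx : (fun n => K * x ^+ n) @ \oo --> (0 : R).
  rewrite -[X in (_ --> X)](mulr0 K); apply: cvgM; first exact: cvg_cst.
  by apply: cvg_expr; rewrite ger0_norm.
have c2 : (fun n => (2^-1 : R) ^+ n) @ \oo --> (0 : R).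
  by apply: cvg_expr; rewrite ger0_norm ?invr_ge0 // invf_lt1 // ltr1n.
apply: (squeeze_cvgr _ (cvg_cst 0) c2).
have h2 : (0 : R) < 2^-1 by rewrite invr_gt0.
near=> n; rewrite mulr_ge0 ?exprn_ge0 //= -mulnn exprM -exprMn.
apply: lerXn2r; rewrite ?nnegrE ?mulr_ge0 ?exprn_ge0 ?invr_ge0 //.
apply: ltW; near: n.
have /cvgrPdist_lt/(_ _ h2) := cx.
apply: filterS => n /=; rewrite sub0r normrN ger0_norm // mulr_ge0 // exprn_ge0 //.
Unshelve. all: by end_near. Qed.

(** As [(1 + t)^n (1 - t)^n <= 1], Bernoulli for [-t] gives [(1 + t)^n <= 1 / (1 - n t)], which is
    at most [1 + 2 n t] when [n t <= 1/2]. *)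
Lemma expr_add1_le (t : R) n : 0 <= t -> n%:R * t <= 2^-1 ->
  (1 + t) ^+ n - 1 <= 2 * (n%:R * t).
Proof.
move=> t0 nt; have [|n0] := posnP n; first by move->; rewrite expr0 subrr mul0r mulr0.
have n1 : (1 : R) <= n%:R by rewrite ler1n.
have t1 : t <= 2^-1 by apply: le_trans nt; rewrite ler_peMl.
have h2 : (2^-1 : R) = 1 / 2 by rewrite mul1r.
have b : 1 - n%:R * t <= (1 - t) ^+ n.
  by rewrite -mulrN; apply: bernoulli; lra.
have le1 : (1 + t) ^+ n * (1 - t) ^+ n <= 1.
  by rewrite -exprMn exprn_ile1 //; nra.
have p0 : 0 <= (1 + t) ^+ n by rewrite exprn_ge0 // addr_ge0.
move: b le1 p0 nt; set X := (1 + t) ^+ n; set Y := (1 - t) ^+ n; set z := n%:R * t.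
by move=> *; have : 0 <= z by [rewrite mulr_ge0]; nra.
Qed.

Lemma cvg_finsum (I : Type) (s : seq I) (P : pred I) (f : I -> R^nat) (l : I -> R) :
  (forall i, P i -> f i @ \oo --> l i) ->
  (fun n => \sum_(i <- s | P i) f i n : R) @ \oo --> (\sum_(i <- s | P i) l i : R).
Proof.
move=> fl; elim: s => [|i s IH].
  rewrite big_nil; under eq_fun do rewrite big_nil; exact: cvg_cst.
rewrite big_cons; under eq_fun do rewrite big_cons.
by case: ifP => // Pi; apply: cvgD => //; exact: fl.
Qed.
End Limits.

Section Independent.
Variables (W : finType) (bad : rel W) (m : nat).
Hypotheses (badxx : irreflexive bad) (badC : symmetric bad).

(** Only the graph of bad pairs matters in this section. In the application [bad] is [isobad], the
    independent sets are the isotropic ones, and [m] is [a ^ k]. *)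
Definition indep (T : {set W}) := [forall u in T, [forall v in T, ~~ bad u v]].

Lemma indepP (T : {set W}) :
  reflect (forall u v, u \in T -> v \in T -> bad u v = false) (indep T).
Proof.
apply: (iffP forall_inP) => [h u v uT vT|h u uT].
  by have /forall_inP/(_ v vT)/negPf := h u uT.
by apply/forall_inP => v vT; rewrite h.
Qed.

Hypotheses (m_gt0 : (0 < m)%N) (indep_card : forall T, indep T -> (#|T| <= m)%N).

Section Count.
Variables (n : nat) (w : {ffun 'I_n -> W}).

(** A subset of [pairs n], because each bad pair will be a potential edge of the random graph and
    contribute one factor to a characteristic function. *)
Definition bad_pairs : {set {set 'I_n}} :=
  [set e in pairs n | [exists i in e, exists l in e, bad (w i) (w l)]]%SET.

(** Having exactly one end in [A] orders each pair, so passing to unordered pairs loses nothing. *)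
Lemma bad_pairs_ge (A : pred 'I_n) :
  (#|[pred p : 'I_n * 'I_n | [&& A p.1, ~~ A p.2 & bad (w p.1) (w p.2)]]|
     <= #|bad_pairs|)%N.
Proof.
set P := [pred p | _].
have injP : {in P &, injective (fun p : 'I_n * 'I_n => [set p.1; p.2]%SET)}.
  move=> [i l] [i' l'] /and3P[/= Ai Al _] /and3P[/= Ai' Al' _] /setP eq2.
  have := eq2 i; rewrite !inE eqxx /= => /esym /orP[/eqP ii|/eqP ii]; last first.
    by rewrite -ii Ai in Al'.
  have := eq2 l; rewrite !inE eqxx orbT /= => /esym /orP[/eqP li|/eqP ->].
    by rewrite li Ai' in Al.
  by rewrite ii.
rewrite -(card_in_imset injP); apply: subset_leq_card.
apply/fintype.subsetP => _ /imsetP[[i l] /and3P[/= Ai Al bil] ->]; rewrite inE.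
apply/andP; split.
  by rewrite inE cards2; have [il|//] := eqVneq i l; rewrite -il Ai in Al.
apply/exists_inP; exists i; first by rewrite !inE eqxx.
by apply/exists_inP; exists l; rewrite ?inE ?eqxx ?orbT.
Qed.

Definition fib (v : W) := #|[pred i | w i == v]|.

Lemma bad_pairs_fib u v : bad u v -> (fib u * fib v <= #|bad_pairs|)%N.
Proof.
move=> buv; apply: leq_trans (bad_pairs_ge [pred i | w i == u]); rewrite -cardX.
apply: subset_leq_card; apply/fintype.subsetP => -[i l].
rewrite !inE /= => /andP[/eqP -> /eqP ->]; rewrite eqxx buv andbT /=.
by apply: contraTneq buv => ->; rewrite badxx.
Qed.

Lemma bad_pairs_out s (T : {set W}) :
  (forall v, v \notin T -> exists2 t, t \in T & bad v t) ->
  (forall t, t \in T -> s <= fib t)%N ->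
  (s * #|[pred i | w i \notin T]| <= #|bad_pairs|)%N.
Proof.
move=> hT hs; apply: leq_trans (bad_pairs_ge [pred i | w i \notin T]).
rewrite (eq_card (B := [pred p : 'I_n * 'I_n | (w p.1 \notin T) &&
  ((w p.2 \in T) && bad (w p.1) (w p.2))])); last first.
  by move=> p; rewrite !inE negbK.
rewrite -[leqRHS]sum1_card -(pair_big_dep (fun i => w i \notin T)
  (fun i l => (w l \in T) && bad (w i) (w l)) (fun _ _ => 1%N)) /=.
rewrite mulnC -sum_nat_const; apply: leq_sum => i wiT; have [t tT bt] := hT _ wiT.
rewrite sum1_card; apply: leq_trans (hs t tT) _.
apply: subset_leq_card; apply/fintype.subsetP => l; rewrite inE => /eqP wl; move: tT bt; rewrite -wl.
by move=> tT bt; rewrite unfold_in /= tT.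
Qed.

Definition freq d : {set W} := [set v | n <= d * fib v]%N%SET.

Lemma out_freq d : (d * #|[pred i | w i \notin freq d]| <= #|W| * n)%N.
Proof.
have -> : #|[pred i | w i \notin freq d]| = (\sum_(v | v \notin freq d) fib v)%N.
  rewrite -sum1_card (partition_big w (fun v => v \notin freq d)) //=.
  apply: eq_bigr => v vT; rewrite sum1_card; apply: eq_card => i.
  apply/andP/idP => [[_ h]|]; first by rewrite inE.
  by rewrite inE => /eqP wv; rewrite wv eqxx; split => //; rewrite inE wv.
rewrite big_distrr /= -sum_nat_const [leqRHS](bigID (fun v => v \notin freq d)) /=.
apply: leq_trans (leq_addr _ _); apply: leq_sum => v; rewrite inE -ltnNge.
exact: ltnW.
Qed.
End Count.

Section Bound.
Variables (R : realType) (rho : R) (rho0 : 0 < rho) (rho1 : rho < 1).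
Variable (n : nat).
Implicit Types (w : {ffun 'I_n -> W}) (T : {set W}).

Definition indepf w := [forall i, [forall l, ~~ bad (w i) (w l)]].

Lemma sum_weight (x : R) T :
  \sum_(w : {ffun 'I_n -> W}) \prod_i (if w i \in T then 1 else x) = (#|T|%:R + (#|W| - #|T|)%:R * x) ^+ n.
Proof.
rewrite -(bigA_distr_bigA (fun _ v => if v \in T then 1 else x)) prodr_const card_ord.
congr (_ ^+ n); rewrite (bigID (mem T)) /= (eq_bigr (fun=> 1)) => [|v ->//].
rewrite sumr_const [X in _ + X](eq_bigr (fun=> x)) => [|v /negPf ->//].
rewrite sumr_const -[X in _ + X]mulr_natl; congr (_ + _%:R * _).
by rewrite -[in RHS](cardC T) addKn.
Qed.

Lemma prod_weight (x : R) w T :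
  \prod_i (if w i \in T then 1 else x) = x ^+ #|[pred i | w i \notin T]|.
Proof.
rewrite (bigID (fun i => w i \in T)) /= big1 => [|i ->//]; rewrite mul1r.
by rewrite (eq_bigr (fun=> x)) => [|i /negPf ->//]; rewrite prodr_const.
Qed.

(* Let T be the set of values taken by w at least n/d times.  The three terms
   correspond to: T contains a bad pair, hence (n/d)^2 pairs of indices are bad;
   T is independent but |T| < m, and there are few such w; T is independent of
   size m, hence maximal, and every index with value outside T lies in n/d bad
   pairs. *)
Lemma bad_sum_bound d (be : R) : (0 < d)%N -> 1 <= be ->
  \sum_(w : {ffun 'I_n -> W} | ~~ indepf w) rho ^+ #|bad_pairs w| <=
  (2 ^ #|W|)%:R * (#|W|%:R ^+ n * rho ^+ ((n %/ d) ^ 2)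
    + (be ^+ #|W| * (m.-1%:R + #|W|%:R * be ^- d)) ^+ n
    + ((m%:R + #|W|%:R * rho ^+ (n %/ d)) ^+ n - m%:R ^+ n)).
Proof.
move=> d0 be1; have be0 : 0 < be by apply: lt_le_trans be1.
have cW : (2 ^ #|W|)%N = #|{: {set W}}| by rewrite -(cardsT W) -card_powerset powersetT cardsT.
rewrite cW mulr_natl -sumr_const.
rewrite (partition_big (fun w => freq w d) predT) //=.
apply: ler_sum => T _.
set X1 := _ * rho ^+ _; set X2 := _ ^+ n; set X3 := _ - _.
have X1_ge0 : 0 <= X1 by rewrite mulr_ge0 ?exprn_ge0 // ltW.
have X2_ge0 : 0 <= X2.
  by rewrite exprn_ge0 // mulr_ge0 ?exprn_ge0 ?addr_ge0 ?mulr_ge0 ?invr_ge0 ?exprn_ge0 // ltW.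
have X3_ge0 : 0 <= X3.
  rewrite subr_ge0 lerXn2r ?nnegrE ?addr_ge0 ?mulr_ge0 ?exprn_ge0 ?(ltW rho0) //.
  by rewrite lerDl mulr_ge0 ?exprn_ge0 // ltW.
have fibT w t : freq w d = T -> t \in T -> (n %/ d <= fib w t)%N.
  by move=> <-; rewrite inE => h; rewrite -(leq_pmul2l d0) (leq_trans _ h) // mulnC leq_divM.
have rhole k l : (k <= l)%N -> rho ^+ l <= rho ^+ k.
  by move=> kl; rewrite ler_wiXn2l // ltW.
have [indT|nindT] := boolP (indep T); last first.
  apply: (@le_trans _ _ X1); last by rewrite -addrA lerDl addr_ge0.
  move: nindT; rewrite negb_forall => /existsP[u]; rewrite negb_imply => /andP[uT].
  rewrite negb_forall => /existsP[v]; rewrite negb_imply negbK => /andP[vT buv].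
  apply: (@le_trans _ _ (\sum_(w : {ffun 'I_n -> W}) rho ^+ ((n %/ d) ^ 2))); last first.
    by rewrite sumr_const card_ffun card_ord -[leLHS]mulr_natl natrX.
  rewrite [leLHS]big_mkcond; apply: ler_sum => w _; case: ifP => [/andP[_ /eqP wT]|_].
    apply: rhole; apply: leq_trans (bad_pairs_fib w buv); rewrite -mulnn.
    by apply: leq_mul; apply: fibT.
  by rewrite exprn_ge0 // ltW.
have := indep_card indT; rewrite leq_eqVlt => /orP[/eqP cT|cT].
  apply: (@le_trans _ _ X3); last by rewrite lerDr addr_ge0.
  set r := rho ^+ (n %/ d).
  have r0 : 0 <= r by rewrite exprn_ge0 // ltW.
  (* An independent set of the extreme size [m] cannot be enlarged. *)
  have maxT v : v \notin T -> exists2 t, t \in T & bad v t.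
    move=> vT; apply/exists_inP; apply: contraT; rewrite negb_exists_in => /forall_inP h.
    have : indep (v |: T).
      apply/indepP => x y; rewrite !inE => /orP[/eqP ->|xT] /orP[/eqP ->|yT].
      - exact: badxx.
      - by rewrite (negPf (h _ yT)).
      - by rewrite badC (negPf (h _ xT)).
      - exact: (indepP _ indT).
    by move/indep_card; rewrite cardsU1 vT cT add1n ltnn.
  (* Each index with value outside [T] costs a factor [r]. The sum over all words then factorises,
     and the words with all values in [T], which contribute [m ^ n], are subtracted. *)
  apply: (@le_trans _ _ (\sum_(w : {ffun 'I_n -> W} | ~~ [forall i, w i \in T])
      \prod_i (if w i \in T then 1 else r))).
    rewrite [leLHS]big_mkcond [leRHS]big_mkcond; apply: ler_sum => w _.
    case: ifP => [/andP[nw /eqP wT]|_]; last first.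
      by case: ifP => // _; apply: prodr_ge0 => i _; case: ifP.
    have -> : [forall i, w i \in T] = false.
      apply: contraNF nw => /forallP h; apply/forallP => i; apply/forallP => l.
      by rewrite (indepP _ indT).
    rewrite /= prod_weight /r -exprM; apply: rhole; apply: bad_pairs_out => // t.
    exact: fibT.
  have := sum_weight r T; rewrite (bigID (fun w : {ffun 'I_n -> W} => [forall i, w i \in T])) /=.
  have -> : \sum_(w : {ffun 'I_n -> W} | [forall i, w i \in T]) \prod_i (if w i \in T then 1 else r)
      = m%:R ^+ n.
    rewrite (eq_bigr (fun=> 1)) => [|w /forallP h]; last by rewrite big1 // => i _; rewrite h.
    rewrite sumr_const -cT -natrX; congr _%:R.
    rewrite -[in RHS](card_ord n) -card_ffun_on; apply: eq_card => w.
    by rewrite -topredE /=; apply/forallP/ffun_onP.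
  move/eqP; rewrite addrC eq_sym -subr_eq => /eqP <-; rewrite cT lerD2r.
  rewrite lerXn2r ?nnegrE ?addr_ge0 ?mulr_ge0 //.
  by rewrite lerD2l ler_wpM2r // ler_nat leq_subr.
apply: (@le_trans _ _ X2); last by rewrite -addrA addrCA lerDl addr_ge0.
rewrite /X2 exprMn -exprM.
have xd0 : 0 <= be ^- d by rewrite invr_ge0 exprn_ge0 // ltW.
(* Exponential weighting: by [out_freq] the number of indices outside [T] times [d] is at most
   [#|W| * n], so the weights times [be ^+ (#|W| * n)] are at least 1, and their sum over all words
   factorises. *)
apply: (@le_trans _ _ (be ^+ (#|W| * n) * \sum_(w : {ffun 'I_n -> W})
   \prod_i (if w i \in T then 1 else be ^- d))); last first.
  rewrite sum_weight; apply: ler_wpM2l; first by rewrite exprn_ge0 // ltW.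
  apply: lerXn2r; rewrite ?nnegrE ?addr_ge0 ?mulr_ge0 //.
  apply: lerD; first by rewrite ler_nat -ltnS prednK.
  by rewrite ler_wpM2r // ler_nat leq_subr.
rewrite mulr_sumr [leLHS]big_mkcond; apply: ler_sum => w _.
case: ifP => [/andP[_ /eqP wT]|_]; last first.
  by rewrite mulr_ge0 ?exprn_ge0 ?prodr_ge0 ?(ltW be0) // => i _; case: ifP.
rewrite prod_weight exprVn -exprM; apply: (@le_trans _ _ 1).
  by rewrite exprn_ile1 // ltW.
rewrite -[X in _ <= _ * X^-1]mul1r ?mul1r ler_pdivlMr ?exprn_gt0 // mul1r.
by apply: ler_weXn2l => //; rewrite -wT out_freq.
Qed.
End Bound.

(** First [be] is put so close to 1 that [be ^+ N < 1 + 1/(2m)], then [d] is made so large that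
    [N * be ^- d <= 1/2]. The product is below [m] since [(1 + 1/(2m)) (m - 1/2) = m - 1/(4m)]. *)
Lemma exists_base_exponent (R : realType) (N : nat) : exists (be : R) (d : nat),
  [/\ (0 < d)%N, 1 <= be & be ^+ N * (m.-1%:R + N%:R * be ^- d) < m%:R].
Proof.
have m1 : (1 : R) <= m%:R by rewrite ler1n.
pose eta : R := (4 * m%:R * N.+1%:R)^-1.
have N1 : (0 : R) < N.+1%:R by rewrite ltr0n.
have eta0 : 0 < eta by rewrite invr_gt0 !mulr_gt0 // (lt_le_trans ltr01).
have etaE : eta * (m%:R * N.+1%:R) = 1 / 4.
  by rewrite /eta; field; rewrite !gt_eqF // ?(lt_le_trans ltr01) //= -natr1 in N1 *.
have Neta : N%:R * eta * m%:R < 1 / 4.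
  rewrite -etaE -mulrA mulrC -mulrA ltr_pM2l // ltr_pM2l; last by rewrite (lt_le_trans ltr01).
  by rewrite ltr_nat.
have N0 : (0 : R) <= N%:R by [].
have b1 : (1 + eta) ^+ N - 1 <= 2 * (N%:R * eta).
  apply: expr_add1_le; first exact: ltW.
  have : N%:R * eta <= N%:R * eta * m%:R by rewrite ler_peMr // mulr_ge0 // ltW.
  have h2 : (2^-1 : R) = 1 / 2 by rewrite mul1r.
  lra.
pose d := (Num.bound (2 * N%:R / eta)).+1.
exists (1 + eta), d; split=> //; first by rewrite lerDl ltW.
have dN : 2 * N%:R <= (1 + eta) ^+ d.
  apply: le_trans (@bernoulli _ eta d _); last by rewrite (le_trans _ (ltW eta0)) // lerN10.
  have : 2 * N%:R / eta <= d%:R.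
    apply: le_trans (ltW (archi_boundP _)) _; first by rewrite divr_ge0 ?mulr_ge0 // ltW.
    by rewrite ler_nat.
  rewrite ler_pdivrMr //; lra.
have be0 : 0 < (1 + eta) ^+ d by rewrite exprn_gt0 // addr_gt0.
have half : N%:R * (1 + eta) ^- d <= 1 / 2.
  by rewrite ler_pdivrMr //; lra.
have mE : m.-1%:R = m%:R - 1 :> R by rewrite -[in RHS](prednK m_gt0) -natr1 addrK.
have X1 : (1 + eta) ^+ N <= 1 + 2 * (N%:R * eta) by lra.
apply: (@le_lt_trans _ _ ((1 + 2 * (N%:R * eta)) * (m%:R - 1 / 2))).
  apply: ler_pM => //; first by rewrite exprn_ge0 // addr_ge0 // ltW.
    by rewrite addr_ge0 ?mulr_ge0 ?invr_ge0 // ltW.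
  by rewrite mE; lra.
nra.
Qed.

Lemma bad_sum_cvg (R : realType) (rho : R) : 0 < rho -> rho < 1 ->
  ((fun n => (\sum_(w : {ffun 'I_n -> W} | ~~ indepf w) rho ^+ #|bad_pairs w|) / m%:R ^+ n)
    @ \oo --> (0 : R))%classic.
Proof.
move=> rho0 rho1; have [be [d [d0 be1 lt_m]]] := exists_base_exponent R #|W|.
have m1 : (1 : R) <= m%:R by rewrite ler1n.
have mgt0 : (0 : R) < m%:R by rewrite ltr0n.
pose K : R := #|W|.+1%:R.
have K1 : 1 <= K by rewrite ler1n.
have K0 : 0 <= K by apply: le_trans K1.
have rhole k l : (k <= l)%N -> rho ^+ l <= rho ^+ k.
  by move=> kl; rewrite ler_wiXn2l // ltW.
have rhoge k : 0 <= rho ^+ k by rewrite exprn_ge0 // ltW.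
pose th := be ^+ #|W| * (m.-1%:R + #|W|%:R * be ^- d) / m%:R.
have th0 : 0 <= th.
  by rewrite /th !mulr_ge0 ?invr_ge0 ?addr_ge0 ?mulr_ge0 ?exprn_ge0 ?invr_ge0 ?exprn_ge0 // (le_trans ler01).
have th1 : th < 1 by rewrite ltr_pdivrMr // mul1r.
(* With [s = n %/ d], the quantities [c1 s], [th ^+ n] and [c3 s] dominate the three terms of
   [bad_sum_bound] divided by [m ^ n]. The factors [K ^+ d] and [s.+1] come from [n <= d * s.+1]. *)
pose c1 (s : nat) := K ^+ d * ((K ^+ d) ^+ s * rho ^+ (s ^ 2)).
pose c3 (s : nat) := 2 * (d%:R * #|W|%:R) * (s.+1%:R * rho ^+ s).
pose v (n : nat) := (2 ^ #|W|)%:R * (c1 (n %/ d)%N + th ^+ n + c3 (n %/ d)%N).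
have cv : (v @ \oo --> (0 : R))%classic.
  rewrite -[X in (_ --> X)%classic](mulr0 (2 ^ #|W|)%:R); apply: cvgM; first exact: cvg_cst.
  rewrite -[X in (_ --> X)%classic]addr0 -[X in (_ --> (X + _)%R)%classic]addr0.
  have c1c : (c1 @ \oo --> (0 : R))%classic.
    rewrite -[X in (_ --> X)%classic](mulr0 (K ^+ d)); apply: cvgM; first exact: cvg_cst.
    by apply: cvg_expr_sqr; rewrite ?exprn_ge0 // (ltW rho0).
  have c3c : (c3 @ \oo --> (0 : R))%classic.
    rewrite -[X in (_ --> X)%classic](mulr0 (2 * (d%:R * #|W|%:R))); apply: cvgM; first exact: cvg_cst.
    by apply: cvg_nat_expr; rewrite rho0.
  apply: cvgD; last exact: cvg_div d0 c3c.
  apply: cvgD; first exact: cvg_div d0 c1c.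
  by apply: cvg_expr; rewrite ger0_norm.
pose u (n : nat) := #|W|%:R / m%:R * rho ^+ (n %/ d).
have u0 n : 0 <= u n by rewrite mulr_ge0 // divr_ge0.
have nd (n : nat) : (n <= d * (n %/ d).+1)%N by rewrite mulnC ltnW // ltn_ceil.
have ule n : 2 * (n%:R * u n) <= c3 (n %/ d)%N.
  have h : n%:R / m%:R <= d%:R * (n %/ d).+1%:R :> R.
    rewrite ler_pdivrMr // -!natrM ler_nat; apply: leq_trans (nd n) _.
    by rewrite leq_pmulr.
  rewrite /c3 /u; set r := rho ^+ _.
  have -> : 2 * (n%:R * (#|W|%:R / m%:R * r)) = (2 * #|W|%:R * r) * (n%:R / m%:R) by ring.
  have -> : 2 * (d%:R * #|W|%:R) * ((n %/ d).+1%:R * r) = (2 * #|W|%:R * r) * (d%:R * (n %/ d).+1%:R) by ring.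
  by apply: ler_wpM2l => //; rewrite !mulr_ge0 // /r.
have c3h : (c3 \o (fun n => n %/ d)%N @ \oo --> (0 : R))%classic.
  apply: cvg_div d0 _.
  rewrite -[X in (_ --> X)%classic](mulr0 (2 * (d%:R * #|W|%:R))); apply: cvgM; first exact: cvg_cst.
  by apply: cvg_nat_expr; rewrite rho0.
apply: (squeeze_cvgr _ (cvg_cst 0) cv).
have h1 : (0 : R) < 1 by [].
(* Eventually [2 * (n * u n) <= c3 (n %/ d) < 1], the smallness that [expr_add1_le] requires. *)
have /cvgrPdist_lt/(_ _ h1) := c3h.
apply: filterS => n /=; rewrite sub0r normrN => c3n.
have c3n1 : c3 (n %/ d)%N < 1 by apply: le_lt_trans (ler_norm _) c3n.
apply/andP; split.
  by rewrite divr_ge0 ?exprn_ge0 // sumr_ge0.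
rewrite ler_pdivrMr ?exprn_gt0 //.
apply: le_trans (bad_sum_bound rho0 rho1 _ d0 be1) _.
rewrite /v -mulrA ler_wpM2l // mulrDl mulrDl; apply: lerD; first apply: lerD.
- apply: (@le_trans _ _ (c1 (n %/ d)%N)); last first.
    rewrite ler_peMr ?exprn_ege1 //; rewrite /c1; apply: mulr_ge0; first exact: exprn_ge0.
    by apply: mulr_ge0 => //; do 2!apply: exprn_ge0.
  rewrite /c1 mulrA; apply: ler_wpM2r => //.
  rewrite -exprM -exprD; apply: (@le_trans _ _ (K ^+ n)).
    by rewrite lerXn2r ?nnegrE // ler_nat.
  by apply: ler_weXn2l => //; rewrite -mulnS.
- by rewrite /th expr_div_n divfK // expf_neq0 // gt_eqF.
have -> : m%:R + #|W|%:R * rho ^+ (n %/ d) = m%:R * (1 + u n).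
  by rewrite /u mulrDr mulr1 mulrCA !mulrA mulfVK // gt_eqF.
rewrite exprMn -[X in _ - X]mulr1 -mulrBr mulrC; apply: ler_wpM2r; first by rewrite exprn_ge0.
apply: le_trans (ule n); apply: expr_add1_le => //.
have := ule n; have h2 : (2^-1 : R) = 1 / 2 by rewrite mul1r.
lra.
Qed.

Section ImageCount.
Variable n : nat.

Definition fimage (w : {ffun 'I_n -> W}) : {set W} := [set w i | i : 'I_n]%SET.

Lemma indepfE w : indepf w = indep (fimage w).
Proof.
apply/forallP/indepP => [h _ _ /imsetP[i _ ->] /imsetP[l _ ->]|h i].
  by have /forallP/(_ l)/negPf := h i.
by apply/forallP => l; rewrite h // imset_f.
Qed.

Lemma card_fimage_le (T : {set W}) : (#|[pred w | fimage w == T]| <= #|T| ^ n)%N.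
Proof.
rewrite -[X in (_ ^ X)%N](card_ord n) -card_ffun_on; apply: subset_leq_card.
apply/fintype.subsetP => w; rewrite inE => /eqP <-; apply/ffun_onP => i.
by apply/imsetP; exists i.
Qed.

(** A word in [T] that is not onto misses some [t], and for each [t] there are [(#|T| - 1) ^ n]
    words avoiding it. *)
Lemma card_fimage_ge (T : {set W}) :
  (#|T| ^ n <= #|[pred w | fimage w == T]| + #|T| * #|T|.-1 ^ n)%N.
Proof.
rewrite -[X in (_ ^ X <= _)%N](card_ord n) -card_ffun_on.
rewrite -(cardID [pred w | fimage w == T] (ffun_on T)) leq_add //.
  by apply: subset_leq_card; apply/fintype.subsetP => w; rewrite inE => /andP[].
pose fo t := [pred w : {ffun 'I_n -> W} | w \in ffun_on (T :\ t)%SET].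
apply: (@leq_trans (\sum_(t in T) #|fo t|)).
  rewrite -sum1_card; apply: (@leq_trans (\sum_(w in [predD ffun_on T & [pred w | fimage w == T]])
     \sum_(t in T) (w \in fo t))).
    apply: leq_sum => w; rewrite !inE => /andP[imT /ffun_onP wT].
    have : ~~ (T \subset fimage w).
      apply: contra imT => sT; rewrite finset.eqEsubset sT andbT.
      by apply/fintype.subsetP => _ /imsetP[i _ ->].
    case/subsetPn => t tT tw; rewrite (bigD1 t) //= -[1%N]addn0 leq_add //.
    rewrite lt0b inE; apply/ffun_onP => i; rewrite !inE wT andbT.
    by apply: contraNneq tw => <-; apply/imsetP; exists i.
  rewrite exchange_big /=; apply: leq_sum => t _; rewrite -sum1_card [leqRHS]big_mkcond /=.
  rewrite [leqLHS]big_mkcond /=; apply: leq_sum => w _; case: ifP => // _; case: (w \in _) => //.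
rewrite -sum_nat_const leq_sum // => t tT.
rewrite (eq_card (B := ffun_on (T :\ t)%SET)) => [|w]; last by rewrite inE.
by rewrite card_ffun_on card_ord (cardsD1 t T) tT add1n.
Qed.
End ImageCount.

Lemma card_fimage_cvg (R : realType) (T : {set W}) : (#|T| <= m)%N ->
  ((fun n => #|[pred w | @fimage n w == T]|%:R / m%:R ^+ n) @ \oo
    --> ((#|T| == m)%:R : R))%classic.
Proof.
move=> Tm; have mgt0 : (0 : R) < m%:R by rewrite ltr0n.
have c0 (j : nat) : (j < m)%N -> ((fun n => (j%:R / m%:R) ^+ n : R) @ \oo --> (0 : R))%classic.
  move=> jm; apply: cvg_expr; rewrite ger0_norm ?divr_ge0 //.
  by rewrite ltr_pdivrMr // mul1r ltr_nat.
move: Tm; rewrite leq_eqVlt => /orP[/eqP Tm|Tm]; last first.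
  rewrite (ltn_eqF Tm); apply: (squeeze_cvgr _ (cvg_cst 0) (c0 _ Tm)); apply: nearW => n.
  rewrite divr_ge0 ?exprn_ge0 //= expr_div_n ler_wpM2r ?invr_ge0 ?exprn_ge0 //.
  by rewrite -natrX ler_nat card_fimage_le.
rewrite Tm eqxx /=.
have cl : ((fun n => 1 - m%:R * (m.-1%:R / m%:R) ^+ n : R) @ \oo --> (1 : R))%classic.
  rewrite -[X in (_ --> X)%classic](subr0 (1 : R)); apply: cvgB; first exact: cvg_cst.
  rewrite -[X in (_ --> X)%classic](mulr0 m%:R); apply: cvgM; first exact: cvg_cst.
  by apply: c0; rewrite prednK.
apply: (squeeze_cvgr _ cl (@cvg_cst _ (1 : R) _ _ _)); apply: nearW => n.
have me : (0 : R) < m%:R ^+ n by rewrite exprn_gt0.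
rewrite ler_pdivlMr // ler_pdivrMr // mul1r mulrBl mul1r expr_div_n -mulrA divfK ?gt_eqF //.
rewrite -!natrX -natrM lerBlDr -natrD !ler_nat -Tm card_fimage_le card_fimage_ge //.
Qed.

(** Words are grouped by their image. After division by [m ^ n] only images of the extreme size [m]
    survive, each with total weight tending to 1. *)
Lemma indep_sum_cvg (R : realType) (g : {set W} -> R) :
  ((fun n => (\sum_(w : {ffun 'I_n -> W} | indepf w) g (fimage w)) / m%:R ^+ n) @ \oo
    --> (\sum_(T | indep T && (#|T| == m)) g T : R))%classic.
Proof.
have -> : (fun n => (\sum_(w : {ffun 'I_n -> W} | indepf w) g (fimage w)) / m%:R ^+ n) =
  (fun n => \sum_(T | indep T) g T * (#|[pred w | @fimage n w == T]|%:R / m%:R ^+ n)).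
  apply/funext => n; rewrite (partition_big (@fimage n) indep) /=; last by move=> w; rewrite indepfE.
  rewrite mulr_suml; apply: eq_bigr => T iT; rewrite mulrA; congr (_ / _).
  rewrite (eq_bigr (fun=> g T)) => [|w /andP[_ /eqP ->//]].
  rewrite sumr_const mulr_natr; congr (_ *+ _); apply: eq_card => w.
  rewrite unfold_in /= [RHS]inE indepfE; case: eqP => [->|]; rewrite ?andbF //.
  by rewrite iT.
have -> : \sum_(T | indep T && (#|T| == m)) g T = \sum_(T | indep T) g T * (#|T| == m)%:R.
  by rewrite big_mkcondr; apply: eq_bigr => T _; case: eqP; rewrite ?mulr1 ?mulr0.
apply: cvg_finsum => T iT; apply: cvgM; first exact: cvg_cst.
exact/card_fimage_cvg/indep_card.
Qed.
End Independent.

(** * Moments of kernels and Fourier inversion *)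

Section KernelTuples.
Variable a : nat.
Local Notation Zm := (Zmod a).

Definition ann (N k : nat) (c : 'M[Zm]_(N, k)) : {set 'cV[Zm]_k} :=
  [set l : 'cV[Zm]_k | c *m l == 0]%SET.
Definition cs (N k : nat) (c : 'M[Zm]_(N, k)) : {set 'cV[Zm]_N} :=
  [set c *m l | l : 'cV[Zm]_k]%SET.
Definition kerset (N : nat) (A : 'M[Zm]_N) : {set 'cV[Zm]_N} := ann A.

(* A moment of K = kerset A: the columns of c form a k-tuple in K, cs c is the
   subgroup it generates and ann c is its group of relations. *)
Definition Phi (R : realType) (s : seq nat) (N k : nat) (U : {set 'cV[Zm]_k} -> R)
    (A : 'M[Zm]_N) : R :=
  \sum_(c : 'M[Zm]_(N, k) | A *m c == 0)
    U (ann c) *+ all (fun p => ~~ (p %| #|kerset A| %/ #|cs c|)%N) s.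
End KernelTuples.

Lemma card_Zmod a : (0 < a)%N -> #|{: Zmod a}| = a.
Proof. by move=> a0; rewrite card_ord prednK. Qed.

Section Zmod.
Variables (a : nat) (a_gt0 : (0 < a)%N).
Local Notation Zm := (Zmod a).

Lemma val_Zmod_natr n : (n%:R : Zm) = (n %% a)%N :> nat.
Proof.
have -> : (n%:R : Zm) = (@Zp1 a.-1 : 'I_a.-1.+1) *+ n by [].
by rewrite Zp_mulrn /= prednK // modnMml mul1n.
Qed.

Lemma Zmod_natr_val (x : Zm) : (nat_of_ord (x : 'I_a.-1.+1))%:R = x.
Proof.
apply: (@ord_inj a.-1.+1); rewrite val_Zmod_natr modn_small //.
by apply: leq_trans (ltn_ord (x : 'I_a.-1.+1)) _; rewrite prednK.
Qed.

Lemma Zmod_natr_eq0 n : ((n%:R : Zm) == 0) = (a %| n)%N.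
Proof.
apply/eqP/idP => [h|/eqP h].
  by have := val_Zmod_natr n; rewrite h /dvdn => <-.
by apply: (@ord_inj a.-1.+1); rewrite val_Zmod_natr h.
Qed.

Lemma Zmod_mulrn_eq0 (x : Zm) n : (x *+ n == 0) = (a %| nat_of_ord (x : 'I_a.-1.+1) * n)%N.
Proof. by rewrite -Zmod_natr_eq0 natrM Zmod_natr_val mulr_natr. Qed.
End Zmod.

Section Fourier.
Variables (a k : nat) (a_gt0 : (0 < a)%N) (R : realType).
Local Notation Zm := (Zmod a).
Local Notation W := ('rV[Zm]_k * 'rV[Zm]_k)%type.
Local Notation C := R[i].
Local Notation toC := (real_complex R).
Variables (e : Zm -> C).
Hypotheses (eD : forall x y, e (x + y) = e x * e y)
  (en : forall x, `|e x| = 1) (e1 : forall x, e x = 1 -> x = 0).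

Definition isobad : rel W := fun u v => qf (u - v) != 0.

Lemma qfN (u : W) : qf (- u) = qf u.
Proof. by rewrite -[- u]sub0r qfB /bf /qf /= !dot0l !dot0r addr0 add0r subr0. Qed.

Lemma isobadxx : irreflexive isobad.
Proof. by move=> u; rewrite /isobad subrr /qf dot0l eqxx. Qed.

Lemma isobadC : symmetric isobad.
Proof. by move=> u v; rewrite /isobad -opprB qfN. Qed.

Lemma indep_isoset T : indep isobad T = isoset 1 T.
Proof.
apply/indepP/isosetP => h u v uT vT.
  by apply/eqP/negPn; rewrite mulr1n; apply/negPf/(h u v uT vT).
by rewrite /isobad -[qf _]mulr1n h // eqxx.
Qed.

Lemma card_rows : #|{: 'rV[Zm]_k}| = (a ^ k)%N.
Proof. by rewrite card_mx card_Zmod // mul1n. Qed.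

Lemma indep_isobad_card T : indep isobad T -> (#|T| <= a ^ k)%N.
Proof.
rewrite indep_isoset => /(isoset_card eD en e1).
rewrite (_ : [set u : W | _]%SET = [set (0%R : W)]%SET); last first.
  by apply/setP => u; rewrite !inE mulr1n.
by rewrite cards1 muln1 card_prod card_rows mulnn leq_exp2r.
Qed.

Section Rows.
Variable N : nat.
Implicit Types (w : {ffun 'I_N -> W}) (A : 'M[Zm]_N).

Definition mx1 w : 'M[Zm]_(N, k) := \matrix_i (w i).1.
Definition mx2 w : 'M[Zm]_(N, k) := \matrix_i (w i).2.

Lemma sum_rows (V : nmodType) (F : 'M[Zm]_(N, k) -> 'M[Zm]_(N, k) -> V) :
  \sum_c \sum_x F c x = \sum_(w : {ffun 'I_N -> W}) F (mx1 w) (mx2 w).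
Proof.
rewrite pair_bigA /= (reindex (fun w => (mx1 w, mx2 w))) //=.
exists (fun p => [ffun i => (row i p.1, row i p.2)]) => [w _ | [c x] _] /=.
  by apply/ffunP => i; rewrite ffunE !rowK -surjective_pairing.
by congr (_, _); apply/row_matrixP => i; rewrite rowK ffunE.
Qed.

Definition pairing A w : Zm := \sum_i \sum_l A i l * dot (w i).2 (w l).1.

Lemma pairingE A w : \sum_i \sum_s mx2 w i s * (A *m mx1 w) i s = pairing A w.
Proof.
apply: eq_bigr => i _; rewrite (eq_bigr (fun s => \sum_l A i l * ((w i).2 0 s * (w l).1 0 s))).
  by rewrite exchange_big /=; apply: eq_bigr => l _; rewrite -mulr_sumr.
move=> s _; rewrite !mxE mulr_sumr; apply: eq_bigr => l _; rewrite mxE.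
by rewrite mulrCA.
Qed.

Lemma sum_char_mx (z : 'M[Zm]_(N, k)) :
  \sum_(x : 'M[Zm]_(N, k)) e (\sum_i \sum_s x i s * z i s) = ((a ^ k) ^ N)%:R *+ (z == 0).
Proof.
have [->|z0] := eqVneq.
  rewrite (eq_bigr (fun=> 1)) => [|x _].
    by rewrite sumr_const card_mx card_Zmod // mulr1n -expnM mulnC.
  rewrite big1 ?(char0 eD en) // => i _; rewrite big1 // => s _.
  by rewrite mxE mulr0.
have [i [s zis]] : exists i s, z i s != 0.
  apply: contra_notP (elimN eqP z0) => h; apply/matrixP => i s; rewrite mxE.
  by apply: contra_notP h => /eqP zis; exists i, s.
rewrite mulr0n; apply: (@sum_char0 _ _ (fun x => delta_mx i s + x) _ (e (z i s))).
- exact: addrI.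
- move=> x; rewrite -eD; congr e.
  under eq_bigr => i' _ do under eq_bigr => s' _ do rewrite mxE mulrDl.
  under eq_bigr => i' _ do rewrite big_split /=.
  rewrite big_split /=; congr (_ + _).
  rewrite (bigD1 i) //= (bigD1 s) //= mxE !eqxx mul1r.
  rewrite big1 => [|s' /negPf ss']; last by rewrite mxE ss' andbF mul0r.
  rewrite addr0 big1 ?addr0 // => i' /negPf ii'; rewrite big1 // => s' _.
  by rewrite mxE ii' mul0r.
- by apply: contra_neq zis => /e1.
Qed.

(** The equation [A *m c == 0] is detected by averaging characters over an auxiliary matrix [x]. Row
    i of [c] and row i of [x] together form the letter [w i] of W, which is why W is a product. *)
Lemma card_mul_ker A (g : 'M[Zm]_(N, k) -> C) :
  \sum_(c : 'M[Zm]_(N, k) | A *m c == 0) g c =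
  ((a ^ k) ^ N)%:R^-1 * \sum_(w : {ffun 'I_N -> W}) g (mx1 w) * e (pairing A w).
Proof.
under [X in _ = _ * X]eq_bigr do rewrite -pairingE.
rewrite -(sum_rows (fun c x => g c * e (\sum_i \sum_s x i s * (A *m c) i s))).
rewrite big_mkcond mulr_sumr; apply: eq_bigr => c _.
rewrite -mulr_sumr sum_char_mx mulrCA; case: ifP => _; last by rewrite !mulr0.
by rewrite mulVf ?mulr1 // pnatr_eq0 -lt0n !expn_gt0 a_gt0.
Qed.

(** For Laplacians the adjoined 0 is the letter of the deleted vertex. *)
Definition isof w := indep isobad ((0%R : W) |: fimage w)%SET.

Lemma ann_mx1 w : ann (mx1 w) = [set l : 'cV[Zm]_k | [forall t in fimage w, t.1 *m l == 0]]%SET.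
Proof.
apply/setP => l; rewrite !inE; apply/eqP/forall_inP => [wl t /imsetP[i _ ->]|h].
  by have := congr1 (row i) wl; rewrite row_mul rowK row0 => ->.
apply/row_matrixP => i; rewrite row_mul rowK row0; apply/eqP/h.
by apply/imsetP; exists i.
Qed.
End Rows.

Definition beta N (w : {ffun 'I_N -> W}) i l : Zm := dot (w i).2 (w l).1.

Lemma qf_beta N (w : {ffun 'I_N -> W}) i l :
  qf (w i - w l) = beta w i i + beta w l l - (beta w i l + beta w l i).
Proof.
by rewrite qfB /bf /qf /beta ![dot (w _).1 _]dotC [dot _ (w l).1 + _]addrC.
Qed.

Lemma isofP N (w : {ffun 'I_N -> W}) :
  reflect ((forall i, beta w i i = 0) /\ (forall i l, beta w i l + beta w l i = 0)) (isof w).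
Proof.
apply: (iffP (indepP _ _)) => [h|[h1 h2]].
  have b0 i : beta w i i = 0.
    have := h (w i) 0; rewrite !inE eqxx imset_f // orbT /isobad subr0 => /(_ isT isT)/negbFE/eqP.
    by rewrite /qf dotC.
  split=> // i l; have := h (w i) (w l); rewrite !inE !imset_f // !orbT => /(_ isT isT)/negbFE/eqP.
  by rewrite qf_beta !b0 addr0 sub0r => /eqP; rewrite oppr_eq0 => /eqP.
have q0 i : qf (w i) = 0 by rewrite /qf dotC; exact: h1.
move=> u v; rewrite !inE => /orP[/eqP ->|/imsetP[i _ ->]] /orP[/eqP ->|/imsetP[l _ ->]].
- exact: isobadxx.
- by rewrite /isobad sub0r qfN q0 eqxx.
- by rewrite /isobad subr0 q0 eqxx.
- by rewrite /isobad qf_beta !h1 h2 subr0 addr0 eqxx.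
Qed.

Definition annT (T : {set W}) : {set 'cV[Zm]_k} :=
  [set l : 'cV[Zm]_k | [forall t in T, t.1 *m l == 0]]%SET.

(** For [T] of the largest possible size [a ^ k], independence of [T] with 0 adjoined amounts to 0
    lying in [T]. *)
Definition limPhi (U : {set 'cV[Zm]_k} -> R) : R :=
  \sum_(T | indep isobad T && (#|T| == a ^ k)%N)
     (if indep isobad ((0%R : W) |: T)%SET then U (annT T) else 0).

Lemma toC_norm (x : R) : `|toC x| = toC `|x|.
Proof.
have [x0|x0] := leP 0 x; first by rewrite !ger0_norm // ler0c.
by rewrite -normrN -rmorphN -(normrN x) !ger0_norm ?oppr_ge0 ?(ltW x0) // ler0c oppr_ge0 ltW.
Qed.

Section Base.
Variables (Om : nat -> finType) (P : forall N, Om N -> R) (X : forall N, Om N -> 'M[Zm]_N).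

Definition charfun N (w : {ffun 'I_N -> W}) : C :=
  \sum_(o : Om N) toC (P o) * e (pairing (X o) w).

Hypothesis charfun_iso : forall N (w : {ffun 'I_N -> W}), isof w -> charfun w = 1.
Variable psi : forall N, {ffun 'I_N -> W} -> R.
Hypothesis charfun_noniso : forall N (w : {ffun 'I_N -> W}), ~~ isof w ->
  `|charfun w| <= toC (psi w).
Hypothesis psi_cvg : ((fun N => (\sum_(w : {ffun 'I_N -> W} | ~~ isof w) psi w) / (a ^ k)%:R ^+ N)
  @ \oo --> (0 : R))%classic.

(** By Fourier inversion the words satisfying [isof] contribute exactly [S N]: there [ann (mx1 w)]
    depends only on the image of [w], so [indep_sum_cvg] applies. The other words contribute at most
    [B] times the normalised sum of [psi]. *)
Lemma base_cvg (U : {set 'cV[Zm]_k} -> R) :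
  ((fun N => \sum_(o : Om N) P o * Phi [::] U (X o)) @ \oo --> limPhi U)%classic.
Proof.
have m0 : (0 < a ^ k)%N by rewrite expn_gt0 a_gt0.
have mR N : (0 : R) < (a ^ k)%:R ^+ N by rewrite exprn_gt0 // ltr0n.
pose g T := if indep isobad ((0%R : W) |: T)%SET then U (annT T) else 0.
pose S N := (\sum_(w : {ffun 'I_N -> W} | indepf isobad w) g (fimage w)) / (a ^ k)%:R ^+ N.
have cS : (S @ \oo --> limPhi U)%classic by apply: indep_sum_cvg m0 indep_isobad_card _ _.
pose B := \sum_T `|U T|.
have UB T : `|U T| <= B by rewrite /B (bigD1 T) //= lerDl sumr_ge0.
have SE N : S N = (\sum_(w : {ffun 'I_N -> W} | isof w) U (ann (mx1 w))) / (a ^ k)%:R ^+ N.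
  rewrite /S; congr (_ / _); rewrite [LHS]big_mkcond [RHS]big_mkcond; apply: eq_bigr => w _.
  rewrite /g -/(isof w) indepfE ann_mx1; case: ifP => // /negbT ni.
  case: ifP => // /indepP iw; case/negP: ni; apply/indepP => u v uT vT.
  by apply: iw; rewrite !inE ?uT ?vT orbT.
have PhiE N : toC (\sum_(o : Om N) P o * Phi [::] U (X o)) =
    ((a ^ k) ^ N)%:R^-1 * \sum_(w : {ffun 'I_N -> W}) toC (U (ann (mx1 w))) * charfun w.
  rewrite rmorph_sum /=.
  under [LHS]eq_bigr => o _.
    rewrite rmorphM rmorph_sum /= (eq_bigr (fun c => toC (U (ann c)))) => [|c _]; last by rewrite mulr1n.
    rewrite card_mul_ker mulrCA mulr_sumr. over.
  rewrite -mulr_sumr exchange_big /=; congr (_ * _); apply: eq_bigr => w _.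
  by rewrite mulr_sumr; apply: eq_bigr => o _; rewrite mulrCA.
have toCm N : toC ((a ^ k)%:R ^+ N) = ((a ^ k) ^ N)%:R.
  by rewrite -natrX rmorph_nat.
have diff N : `|\sum_(o : Om N) P o * Phi [::] U (X o) - S N| <=
    B * ((\sum_(w : {ffun 'I_N -> W} | ~~ isof w) psi w) / (a ^ k)%:R ^+ N).
  rewrite -lecR -toC_norm rmorphB /= PhiE SE fmorph_div /= toCm [X in `|X - _|]mulrC -mulrBl.
  rewrite (bigID (@isof N)) /= rmorph_sum /=.
  rewrite (eq_bigr (fun w => toC (U (ann (mx1 w))))) => [|w iw]; last by rewrite charfun_iso // mulr1.
  rewrite [X in `|X / _|]addrAC subrr add0r normrM normfV normr_nat mulrA [leRHS]rmorphM fmorphV /= toCm.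
  apply: ler_wpM2r; first by rewrite invr_ge0.
  rewrite rmorphM [X in _ <= _ * X]rmorph_sum mulr_sumr; apply: le_trans (ler_norm_sum _ _ _) _.
  apply: ler_sum => w nw; rewrite normrM toC_norm; apply: ler_pM => //.
  - by rewrite ler0c.
  - by rewrite lecR.
  - exact: charfun_noniso.
have cB : ((fun N => B * ((\sum_(w : {ffun 'I_N -> W} | ~~ isof w) psi w) / (a ^ k)%:R ^+ N))
    @ \oo --> (0 : R))%classic.
  by rewrite -[X in (_ --> X)%classic](mulr0 B); apply: cvgM => //; exact: cvg_cst.
have cD : ((fun N => \sum_(o : Om N) P o * Phi [::] U (X o) - S N) @ \oo --> (0 : R))%classic.
  apply/norm_cvg0P; apply: (squeeze_cvgr _ (@cvg_cst _ (0 : R) _ _ _) cB).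
  by apply: nearW => N; rewrite normr_ge0 diff.
rewrite -[X in (_ --> X)%classic]add0r.
rewrite (_ : (fun N => _) = (fun N => \sum_(o : Om N) P o * Phi [::] U (X o) - S N + S N)).
  exact: cvgD.
by apply/funext => N; rewrite subrK.
Qed.
End Base.
End Fourier.

(** * Uniform symmetric matrices *)

Lemma sum_sym (V : nmodType) N (F : 'I_N -> 'I_N -> V) :
  \sum_i \sum_l F i l = \sum_i F i i + \sum_(i < N) \sum_(l < N | (i < l)%N) (F i l + F l i).
Proof.
under [X in _ + X]eq_bigr do rewrite big_split /=.
rewrite big_split /= [X in _ + (_ + X)](exchange_big_dep predT) //= -!big_split /=.
apply: eq_bigr => i _; rewrite (bigD1 i) //=; congr (_ + _).
rewrite (bigID (fun l : 'I_N => (i < l)%N)) /=; congr (_ + _); apply: eq_bigl => l.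
  by rewrite andb_idl // => il; rewrite -val_eqE gtn_eqF.
by rewrite -leqNgt ltn_neqAle -val_eqE.
Qed.

Lemma sum_sig (V : nmodType) (I : finType) (P : pred I) (F : I -> V) :
  \sum_(x : {x | P x}) F (val x) = \sum_(x | P x) F x.
Proof.
rewrite [RHS](reindex_omap (val : {x | P x} -> I) insub) => [|i Pi]; last by rewrite insubT.
by apply: eq_bigl => -[i Pi] /=; rewrite insubT Pi /= eqxx.
Qed.

Section Models.
Variables (a k : nat) (a_gt0 : (0 < a)%N) (R : realType).
Local Notation Zm := (Zmod a).
Local Notation W := ('rV[Zm]_k * 'rV[Zm]_k)%type.
Local Notation C := R[i].
Local Notation toC := (real_complex R).
Variables (e : Zm -> C).
Hypotheses (eD : forall x y, e (x + y) = e x * e y)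
  (en : forall x, `|e x| = 1) (e1 : forall x, e x = 1 -> x = 0).

Section Rows.
Variable N : nat.
Implicit Types (w : {ffun 'I_N -> W}) (A : 'M[Zm]_N).

Lemma pairingD A B w : pairing (A + B) w = pairing A w + pairing B w.
Proof.
rewrite -big_split; apply: eq_bigr => i _; rewrite -big_split; apply: eq_bigr => l _.
by rewrite mxE mulrDl.
Qed.

Lemma pairing_delta x i l w : pairing (x *: delta_mx i l) w = x * beta w i l.
Proof.
rewrite /pairing (bigD1 i) //= (bigD1 l) //= !mxE !eqxx mulr1 !big1 ?addr0 // => t /negPf tn.
  by rewrite big1 // => s _; rewrite !mxE tn mulr0 mul0r.
by rewrite !mxE tn andbF mulr0 mul0r.
Qed.

Lemma pairing_sym A w : A^T = A ->
  pairing A w = \sum_i A i i * beta w i i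
    + \sum_(i < N) \sum_(l < N | (i < l)%N) A i l * (beta w i l + beta w l i).
Proof.
move=> sA; rewrite /pairing sum_sym; congr (_ + _); apply: eq_bigr => i _.
by apply: eq_bigr => l _; rewrite -[in A l i]sA mxE -mulrDr.
Qed.

Lemma charfun_sum_eq0 (P : pred 'M[Zm]_N) (M0 : 'M[Zm]_N) w :
  (forall M, P (M0 + M) = P M) -> pairing M0 w != 0 ->
  \sum_(M | P M) e (pairing M w) = 0.
Proof.
move=> PM0 p0; rewrite big_mkcond.
apply: (@sum_char0 _ _ (fun M => M0 + M) _ (e (pairing M0 w))).
- exact: addrI.
- by move=> M; rewrite PM0 pairingD eD; case: ifP; rewrite ?mulr0.
- by apply: contra_neq p0 => /e1.
Qed.

(* An entry is divisible by p when a/p kills it. *)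
Definition zone p j : pred 'M[Zm]_N := fun M =>
  (M^T == M) && [forall i : 'I_N, (i < j)%N ==> [forall l, M i l *+ (a %/ p) == 0]].

Lemma zoneP p j M : reflect (M^T = M /\ (forall i l : 'I_N, (i < j)%N -> M i l *+ (a %/ p) = 0))
  (zone p j M).
Proof.
apply: (iffP andP) => [[/eqP sM /forall_inP h]|[sM h]]; split=> //; try exact/eqP.
  by move=> i l ij; have /forallP/(_ l)/eqP := h i ij.
by apply/forall_inP => i ij; apply/forallP => l; apply/eqP/h.
Qed.

Lemma zoneD p j M0 M : zone p j M0 -> zone p j (M0 + M) = zone p j M.
Proof.
move=> /zoneP[s0 z0]; apply/zoneP/zoneP => -[sM zM]; split.
- by move: sM; rewrite linearD /= s0 => /addrI.
- by move=> i l ij; have := zM i l ij; rewrite mxE mulrnDl z0 // add0r.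
- by rewrite linearD /= s0 sM.
- by move=> i l ij; rewrite mxE mulrnDl z0 // zM // addr0.
Qed.

Lemma zone_delta p j x (i l : 'I_N) :
  ((i < j)%N || (l < j)%N -> x *+ (a %/ p) = 0) ->
  zone p j (x *: (delta_mx i l + delta_mx l i)).
Proof.
move=> hx; apply/zoneP; split; first by rewrite linearZ linearD /= !trmx_delta addrC.
move=> s t sj; rewrite !mxE -mulrnAl.
have [E|] := boolP ((s == i) || (s == l)).
  by rewrite hx ?mul0r //; case/orP: E => /eqP <-; rewrite sj ?orbT.
by rewrite negb_or => /andP[/negPf -> /negPf ->]; rewrite addr0 mulr0.
Qed.

Lemma zone_delta1 p j x (i : 'I_N) :
  ((i < j)%N -> x *+ (a %/ p) = 0) -> zone p j (x *: delta_mx i i).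
Proof.
move=> hx; apply/zoneP; split; first by rewrite linearZ /= trmx_delta.
move=> s t sj; rewrite !mxE -mulrnAl; have [E|] := eqVneq s i; last by rewrite mulr0.
by rewrite hx ?mul0r // -E.
Qed.

(** The zone is a group of symmetric matrices, so a nonzero sum forces the character to be trivial
    on it. The relations come from testing it on symmetrised unit matrices in rows and columns from
    [j] on, and on [p] times such matrices anywhere. *)
Lemma zone_sum_neq0 p j w : (p %| a)%N ->
  \sum_(M | zone p j M) e (pairing M w) != 0 ->
  (forall i l : 'I_N, (j <= i)%N -> (j <= l)%N -> beta w i i = 0 /\ beta w i l + beta w l i = 0) /\
  (forall i l : 'I_N, beta w i i *+ p = 0 /\ (beta w i l + beta w l i) *+ p = 0).
Proof.
move=> pa nz.
have key M0 : zone p j M0 -> pairing M0 w = 0.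
  move=> z0; apply/eqP; apply: contraNT nz => p0; apply/eqP.
  by apply: charfun_sum_eq0 p0 => M; apply: zoneD.
have px0 : (p%:R : Zm) *+ (a %/ p) = 0.
  by rewrite -mulrnA mulnC divnK //; apply/eqP; rewrite Zmod_natr_eq0.
split=> [i l ij lj|i l]; split.
- rewrite -[LHS]mul1r -pairing_delta; apply: key; apply: zone_delta1.
  by rewrite ltnNge ij.
- rewrite -[LHS]mul1r mulrDr -!pairing_delta -pairingD -scalerDr; apply: key; apply: zone_delta.
  by rewrite !ltnNge ij lj.
- by rewrite -mulr_natl -pairing_delta; apply/key/zone_delta1.
- rewrite -mulr_natl mulrDr -!pairing_delta -pairingD -scalerDr.
  by apply: key; apply: zone_delta.
Qed.
End Rows.

Lemma charfun_uniform_iso N (w : {ffun 'I_N -> W}) : isof w ->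
  charfun e (fun N (M : symmx a N) => (#|symmx a N|%:R)^-1 : R) (fun N M => val M) w = 1.
Proof.
move/isofP => [h1 h2]; rewrite /charfun -mulr_sumr (eq_bigr (fun=> 1)) => [|M _].
  rewrite sumr_const cardT -cardE fmorphV rmorph_nat mulVf // pnatr_eq0 -lt0n.
  by apply/card_gt0P; exists (exist (fun M : 'M[Zm]_N => M^T == M) 0 (introT eqP (trmx0 _ _ _))).
rewrite pairing_sym; last exact/eqP/(valP M).
rewrite big1 => [|i _]; last by rewrite h1 mulr0.
rewrite big1 ?addr0 ?(char0 eD en) // => i _.
by rewrite big1 // => l _; rewrite h2 mulr0.
Qed.

Lemma charfun_uniform_noniso N (w : {ffun 'I_N -> W}) : ~~ isof w ->
  charfun e (fun N (M : symmx a N) => (#|symmx a N|%:R)^-1 : R) (fun N M => val M) w = 0.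
Proof.
move=> niw; rewrite /charfun -mulr_sumr.
(* With [j = 0] no row is constrained and the zone consists of all symmetric matrices. *)
have -> : \sum_(M : symmx a N) e (pairing (val M) w) = \sum_(M | zone 1 0 M) e (pairing M w).
  rewrite [RHS](eq_bigl (fun M => M^T == M)) => [|M]; first exact: (sum_sig _ (fun M => e (pairing M w))).
  by rewrite /zone; case: eqP => // _; apply/forallP.
apply/eqP; rewrite mulf_eq0; apply/orP; right; apply: contraNT niw => /zone_sum_neq0 - /(_ (dvd1n _)) [h _].
apply/isofP; split=> [i|i l]; first by have [] := h i i.
by have [] := h i l.
Qed.
End Models.

(** * Reduced Laplacians of random graphs *)

Lemma sum_graph (V : nmodType) n (F : {set {set 'I_n}} -> V) :
  \sum_(g : graph n) F (edges g) = \sum_(E : {set {set 'I_n}} | E \subset pairs n) F E.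
Proof.
rewrite [RHS](reindex_omap (val : graph n -> {set {set 'I_n}}) insub) => [|E sE]; last by rewrite insubT.
by apply: eq_bigl => -[E sE] /=; rewrite insubT sE /= eqxx.
Qed.

Definition er_weight (R : realType) (q : R) n (g : graph n) : R :=
  \prod_(d in pairs n) (if d \in edges g then q else 1 - q).

(** Independence of the edges: expanding the product over pairs yields one term for each edge
    set. *)
Lemma sum_er_weight (R : realType) (C : comNzRingType) (f : {rmorphism R -> C}) (q : R) n
    (z : {set 'I_n} -> C) :
  \sum_(g : graph n) f (er_weight q g) * \prod_(d in edges g) z d =
  \prod_(d in pairs n) (1 - f q + f q * z d).
Proof.
rewrite (sum_graph (fun E => f (\prod_(d in pairs n) (if d \in E then q else 1 - q))
  * \prod_(d in E) z d)).
(* The product is extended to all subsets of vertices; the value 0 of [F] off [pairs n] kills every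
   family that contains something other than a pair. *)
pose F d := if d \in pairs n then f q * z d else 0.
pose G d := if d \in pairs n then 1 - f q else 1.
have -> : \prod_(d in pairs n) (1 - f q + f q * z d) = \prod_d (F d + G d).
  rewrite big_mkcond; apply: eq_bigr => d _; rewrite /F /G; case: ifP => _.
    by rewrite addrC.
  by rewrite add0r.
rewrite bigA_distr big_mkcond; apply: eq_bigr => E _.
case: ifP => [sE|/negbT/subsetPn[d dE dn]]; last first.
  by rewrite (bigD1 d) //= dE /F (negPf dn) mul0r.
rewrite rmorph_prod /= [X in X * _]big_mkcond [X in _ * X]big_mkcond -big_split /=.
apply: eq_bigr => d _; rewrite /F /G; have [dE|dE] := boolP (d \in E).
  by rewrite (fintype.subsetP sE _ dE).
by rewrite mulr1; case: ifP; rewrite // rmorphB rmorph1.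
Qed.

Section Laplacian.
Variables (a k : nat) (a_gt0 : (0 < a)%N) (R : realType) (q : R).
Hypotheses (q_gt0 : 0 < q) (q_lt1 : q < 1).
Local Notation Zm := (Zmod a).
Local Notation W := ('rV[Zm]_k * 'rV[Zm]_k)%type.
Local Notation C := R[i].
Local Notation toC := (real_complex R).
Variables (e : Zm -> C).
Hypotheses (eD : forall x y, e (x + y) = e x * e y)
  (en : forall x, `|e x| = 1) (e1 : forall x, e x = 1 -> x = 0).

Definition redlap n (g : graph n.+1) : 'M[Zm]_n :=
  \matrix_(i, l) (laplacian g (lift ord0 i) (lift ord0 l))%:~R.

(** With the letter 0 at the deleted vertex, the reduced Laplacian pairs with [w] as the full
    Laplacian does with [ext0 w]. *)
Definition ext0 N (w : {ffun 'I_N -> W}) : {ffun 'I_N.+1 -> W} :=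
  [ffun i => if unlift ord0 i is Some i' then w i' else 0].

Section Rows.
Variable n : nat.
Implicit Types (w : {ffun 'I_n -> W}) (d : {set 'I_n}).

(** Minus the contribution of a single edge [d] to the pairing. The double sum avoids ordering the
    two ends; on an edge it is [qf] of the difference of the letters, which is how the quadratic
    form enters. *)
Definition theta w d : Zm :=
  \sum_(i in d) (beta w i i - \sum_(l in d | l != i) beta w i l).

Lemma theta_pair w i l : i != l -> theta w [set i; l]%SET = qf (w i - w l).
Proof.
move=> il; rewrite /theta big_setU1 ?inE //= big_set1 qf_beta.
rewrite (bigD1 l) ?inE ?eqxx ?orbT 1?eq_sym //= big1 => [|t]; last first.
  by rewrite !inE -andbA; case/and3P => /orP[/eqP ->|/eqP ->]; rewrite eqxx.
rewrite [\sum_(t in _ | t != l) _](bigD1 i) ?inE ?eqxx //= big1 => [|t]; last first.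
  by rewrite !inE -andbA; case/and3P => /orP[/eqP ->|/eqP ->]; rewrite eqxx.
by rewrite !addr0; ring.
Qed.

Lemma theta_bad w d : d \in pairs n ->
  (theta w d != 0) = (d \in bad_pairs (@isobad a k) w).
Proof.
rewrite !inE => d2; rewrite d2 /=; case/cards2P: d2 => i [l [il ->]].
rewrite theta_pair //; apply/idP/exists_inP => [h|[s]].
  exists i; rewrite ?inE ?eqxx //; apply/exists_inP; exists l; rewrite ?inE ?eqxx ?orbT //.
rewrite !inE => si /exists_inP[t]; rewrite !inE => ti.
case/orP: si ti => /eqP -> /orP[/eqP ->|/eqP ->] //; rewrite ?isobadxx //.
by rewrite isobadC.
Qed.

Lemma sum_laplacian w (g : graph n) :
  \sum_i \sum_l (laplacian g i l)%:~R * beta w i l = - \sum_(d in edges g) theta w d.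
Proof.
have -> : \sum_(d in edges g) theta w d = \sum_i \sum_(d in edges g | i \in d)
    (beta w i i - \sum_(l in d | l != i) beta w i l).
  by rewrite (exchange_big_dep predT) //=; apply: eq_bigr => i _; apply: eq_bigl => d; rewrite andbT.
rewrite -sumrN; apply: eq_bigr => i _.
rewrite (bigD1 i) //= mxE eqxx sumrB opprB addrC; congr (_ + _); last first.
  rewrite mulrNz mulNr -pmulrn mulr_natl /vdeg -sumr_const; congr (- _).
  by apply: eq_bigl => d; rewrite inE.
rewrite (exchange_big_dep (fun l => l != i)) /=; last by move=> d l _ /andP[].
apply: eq_bigr => l li; rewrite mxE eq_sym (negPf li).
rewrite (eq_bigl (fun d => (d == [set i; l]%SET) && (d \in edges g))); last first.
  move=> d; rewrite andbT; apply/idP/idP => [/andP[/andP[dg id_] ld]|/andP[/eqP -> ->]].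
    rewrite dg andbT eq_sym eqEcard finset.subUset !finset.sub1set id_ ld /=.
    have /fintype.subsetP/(_ d dg) : edges g \subset pairs n by case: (g).
    by rewrite inE => /eqP ->; rewrite cards2 eq_sym li.
  by rewrite !inE !eqxx orbT.
rewrite big_mkcondr big_pred1_eq; case: ifP => _; first by rewrite mul1r.
by rewrite mul0r.
Qed.
End Rows.

Lemma pairing_redlap N (w : {ffun 'I_N -> W}) (g : graph N.+1) :
  pairing (redlap g) w = - \sum_(d in edges g) theta (ext0 w) d.
Proof.
have b0l l : beta (ext0 w) ord0 l = 0 by rewrite /beta ffunE unlift_none dot0l.
have b0r i : beta (ext0 w) i ord0 = 0 by rewrite /beta [ext0 w ord0]ffunE unlift_none dot0r.
rewrite -sum_laplacian big_ord_recl big1 ?add0r => [|l _]; last by rewrite b0l mulr0.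
apply: eq_bigr => i _; rewrite big_ord_recl b0r mulr0 add0r.
by apply: eq_bigr => l _; rewrite mxE /beta !ffunE !liftK.
Qed.

Lemma isof_ext0 N (w : {ffun 'I_N -> W}) : isof w = indepf (@isobad a k) (ext0 w).
Proof.
rewrite indepfE /isof; congr indep; apply/setP => u; rewrite !inE.
apply/orP/imsetP => [[/eqP ->|/imsetP[i _ ->]]|[i _ ->]].
- by exists ord0 => //; rewrite ffunE unlift_none.
- by exists (lift ord0 i) => //; rewrite ffunE liftK.
rewrite ffunE; case: unliftP => [i' _|_]; last by left.
by right; apply/imsetP; exists i'.
Qed.

Lemma charfun_redlap N (w : {ffun 'I_N -> W}) :
  charfun e (fun N (g : graph N.+1) => er_weight q g) redlap w =
  \prod_(d in pairs N.+1) (1 - toC q + toC q * e (- theta (ext0 w) d)).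
Proof.
rewrite -(sum_er_weight (real_complex R)) /charfun; apply: eq_bigr => g _; congr (_ * _).
by rewrite pairing_redlap -sumrN (char_sum eD en).
Qed.

(** A proper convex combination of 1 and another point of the unit circle lies strictly inside the
    disc, and only finitely many values [e x] occur. *)
Lemma exists_rho : exists rho : R, [/\ 0 < rho, rho < 1 &
  forall x : Zm, x != 0 -> `|1 - toC q + toC q * e x| <= toC rho].
Proof.
have nrm (x : Zm) : x != 0 -> exists2 r : R, r < 1 & `|1 - toC q + toC q * e x| = toC r.
  move=> x0; have := en x; have : e x != 1 by apply: contra_neq x0 => /e1.
  case: (e x) => u v; rewrite eq_complex /= => uv1.
  rewrite normc_def => /(congr1 (@complex.Re R)) /= /(congr1 (fun t => t ^+ 2)).
  rewrite expr1n sqr_sqrtr ?addr_ge0 ?sqr_ge0 // => uv.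
  have u1 : u < 1.
    rewrite lt_neqAle; apply/andP; split; last by have := sqr_ge0 v; nra.
    apply: contraNN uv1 => /eqP u1; move: uv; rewrite u1 expr1n eqxx /= => /eqP.
    by rewrite -subr_eq0 addrC addKr sqrf_eq0.
  exists (Num.sqrt ((1 - q + q * u) ^+ 2 + (q * v) ^+ 2)).
    rewrite -[X in _ < X]sqrtr1 ltr_sqrt ?ltr01 //.
    have -> : (1 - q + q * u) ^+ 2 + (q * v) ^+ 2 =
       (1 - q) ^+ 2 + 2 * (1 - q) * q * u + q ^+ 2 * (u ^+ 2 + v ^+ 2) by ring.
    rewrite uv; have : 0 < (1 - q) * q * (1 - u) by rewrite !mulr_gt0 // subr_gt0.
    nra.
  have -> : 1 - toC q + toC q * (u +i* v)%C = ((1 - q + q * u) +i* (q * v))%C.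
    by apply/eqP; rewrite eq_complex /=; apply/andP; split; apply/eqP; ring.
  by rewrite normc_def.
suff [rho [h0 h1 h]] : exists rho : R, [/\ 0 < rho, rho < 1 & forall x, x \in enum {: Zm} ->
    x != 0 -> `|1 - toC q + toC q * e x| <= toC rho].
  by exists rho; split=> // x; apply: h; rewrite mem_enum.
elim: (enum _) => [|x s [rho [h0 h1 h]]].
  (* Any starting value strictly between 0 and 1 would do; it keeps [rho] positive even if no
     nonzero [x] exists, as for [a = 1]. *)
  by exists (1 / 2); split=> //; rewrite ?divr_gt0 // ltr_pdivrMr // mul1r ltr1n.
have [->|/[dup] x0 /nrm [r r1 rE]] := eqVneq x 0.
  by exists rho; split=> // y; rewrite inE => /orP[/eqP ->|/h//]; rewrite eqxx.
exists (Num.max rho r); split; first by rewrite lt_max h0.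
  by rewrite gt_max h1.
move=> y; rewrite inE => /orP[/eqP -> _|ys y0].
  by rewrite rE lecR le_max lexx orbT.
by apply: le_trans (h y ys y0) _; rewrite lecR le_max lexx.
Qed.

Lemma redlap_base (U : {set 'cV[Zm]_k} -> R) :
  ((fun N => \sum_(g : graph N.+1) er_weight q g * Phi [::] U (redlap g)) @ \oo
    --> limPhi U)%classic.
Proof.
have [rho [rho0 rho1 rhoP]] := exists_rho.
pose psi N (w : {ffun 'I_N -> W}) := rho ^+ #|bad_pairs (@isobad a k) (ext0 w)|.
apply: (@base_cvg _ _ a_gt0 _ _ eD en e1 _ _ _ _ psi) => [N w iw|N w niw|].
- rewrite charfun_redlap big1 // => d dp.
  have -> : theta (ext0 w) d = 0.
    apply/eqP; apply: contraLR iw => th0; rewrite isof_ext0 indepfE; apply/negP => /indepP h.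
    rewrite theta_bad // inE in th0; case/andP: th0 => _ /exists_inP[i _ /exists_inP[l _]].
    by rewrite h //; apply/imsetP; [exists i | exists l].
  by rewrite oppr0 (char0 eD en) mulr1 subrK.
- rewrite charfun_redlap normr_prod (bigID (mem (bad_pairs (@isobad a k) (ext0 w)))) /=.
  rewrite /psi -prodr_const rmorph_prod -[leRHS]mulr1.
  apply: ler_pM; rewrite ?prodr_ge0 //.
    rewrite [leLHS](eq_bigl (mem (bad_pairs (@isobad a k) (ext0 w)))) => [|d]; last first.
      by rewrite andb_idl // inE => /andP[].
    apply: ler_prod => d db; rewrite normr_ge0 /=; apply: rhoP; rewrite oppr_eq0 theta_bad //.
    by case/finset.setIdP: (db : d \in bad_pairs _ _).
  apply: prodr_ile1 => d /andP[dp nb]; rewrite normr_ge0 /=.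
  have -> : theta (ext0 w) d = 0 by apply/eqP/negPn; rewrite theta_bad.
  by rewrite oppr0 (char0 eD en) mulr1 subrK normr1.
have mR N : (0 : R) < (a ^ k)%:R ^+ N by rewrite exprn_gt0 // ltr0n expn_gt0 a_gt0.
pose S N := (\sum_(w : {ffun 'I_N -> W} | ~~ indepf (@isobad a k) w)
  rho ^+ #|bad_pairs (@isobad a k) w|) / (a ^ k)%:R ^+ N.
have cS : (S @ \oo --> (0 : R))%classic.
  apply: (bad_sum_cvg _ _ _ (indep_isobad_card a_gt0 eD en e1)) => //.
  - exact: isobadxx.
  - exact: isobadC.
  - by rewrite expn_gt0 a_gt0.
(* Extending by the letter 0 turns words of length N into some of the words of length N+1;
   comparison with all of those costs one factor [a ^ k]. *)
have cS1 : ((fun N => (a ^ k)%:R * S N.+1) @ \oo --> (0 : R))%classic.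
  rewrite -[X in (_ --> X)%classic](mulr0 (a ^ k)%:R); apply: cvgM; first exact: cvg_cst.
  by rewrite (cvg_shiftS S).
apply: (squeeze_cvgr _ (@cvg_cst _ (0 : R) _ _ _) cS1); apply: nearW => N.
rewrite divr_ge0 ?(ltW (mR N)) ?sumr_ge0 //=; last by move=> w _; rewrite exprn_ge0 // ltW.
have m0 : (a ^ k)%:R != 0 :> R by rewrite gt_eqF // ltr0n expn_gt0 a_gt0.
have -> : (a ^ k)%:R * S N.+1 = (\sum_(w : {ffun 'I_N.+1 -> W} | ~~ indepf (@isobad a k) w)
  rho ^+ #|bad_pairs (@isobad a k) w|) / (a ^ k)%:R ^+ N.
  by rewrite /S exprS invfM mulrCA [_ * (_^-1 * _)]mulrA divff // mul1r.
apply: ler_wpM2r; first by rewrite invr_ge0 ltW.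
have injx : injective (@ext0 N).
  move=> w w' /ffunP ww; apply/ffunP => i.
  by have := ww (lift ord0 i); rewrite !ffunE !liftK.
rewrite /psi (eq_bigl (fun w => w \in [set w | ~~ indepf (@isobad a k) (ext0 w)]%SET)); last first.
  by move=> w; rewrite inE isof_ext0.
rewrite -(big_imset (fun w => rho ^+ #|bad_pairs (@isobad a k) w|)); last by move=> w w' _ _ /injx.
rewrite [leLHS]big_mkcond [leRHS]big_mkcond; apply: ler_sum => w _.
case: ifP => [/imsetP[w']|_]; first by rewrite inE => nw ->; rewrite nw.
by case: ifP => // _; rewrite exprn_ge0 // ltW.
Qed.

Lemma uniform_base (U : {set 'cV[Zm]_k} -> R) :
  ((fun N => \sum_(M : symmx a N) #|symmx a N|%:R^-1 * Phi [::] U (val M)) @ \oo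
    --> limPhi U)%classic.
Proof.
apply: (@base_cvg _ _ a_gt0 _ _ eD en e1 _ _ _ _ (fun _ _ => 0)) => [N w|N w niw|].
- exact: charfun_uniform_iso.
- by rewrite (charfun_uniform_noniso a_gt0 eD e1) // normr0.
by under eq_fun do rewrite big1 // mul0r; exact: cvg_cst.
Qed.
End Laplacian.

(** * Independent p-torsion tuples in uniform kernels *)

Lemma mulmxMnl (K : pzRingType) m n l (A : 'M[K]_(m, n)) (B : 'M[K]_(n, l)) d :
  (A *+ d) *m B = (A *m B) *+ d.
Proof. by elim: d => [|d IH]; rewrite ?mulr0n ?mul0mx // !mulrS mulmxDl IH. Qed.

Lemma mulmxMnr (K : pzRingType) m n l (A : 'M[K]_(m, n)) (B : 'M[K]_(n, l)) d :
  A *m (B *+ d) = (A *m B) *+ d.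
Proof. by elim: d => [|d IH]; rewrite ?mulr0n ?mulmx0 // !mulrS mulmxDr IH. Qed.

Section Torsion.
Variables (a p : nat) (a_gt0 : (0 < a)%N) (p_pr : prime p) (pa : (p %| a)%N).
Local Notation Zm := (Zmod a).

Lemma app : (a %/ p * p)%N = a. Proof. exact: divnK. Qed.
Lemma ap_gt0 : (0 < a %/ p)%N.
Proof. by rewrite divn_gt0 ?prime_gt0 // dvdn_leq. Qed.

Lemma val_lt (x : Zm) : (nat_of_ord (x : 'I_a.-1.+1) < a)%N.
Proof. by apply: leq_trans (ltn_ord (x : 'I_a.-1.+1)) _; rewrite prednK. Qed.

Lemma mulrn_p (x : Zm) : (x *+ p == 0) = (a %/ p %| nat_of_ord (x : 'I_a.-1.+1))%N.
Proof. by rewrite Zmod_mulrn_eq0 // -[X in (X %| _)%N]app dvdn_pmul2r // prime_gt0. Qed.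

Lemma mulrn_ap (x : Zm) : (x *+ (a %/ p) == 0) = (p %| nat_of_ord (x : 'I_a.-1.+1))%N.
Proof. by rewrite Zmod_mulrn_eq0 // -[X in (X %| _)%N]app [(_ %/ _ * p)%N]mulnC dvdn_pmul2r // ap_gt0. Qed.

Lemma card_divisible d : (0 < d)%N -> (d %| a)%N ->
  (#|[set x : Zm | (d %| nat_of_ord (x : 'I_a.-1.+1))%N]| <= a %/ d)%N.
Proof.
move=> d0 da; have q0 : (0 < a %/ d)%N by rewrite divn_gt0 // dvdn_leq.
have lt_q (x : Zm) : (nat_of_ord (x : 'I_a.-1.+1) %/ d < (a %/ d).-1.+1)%N.
  by rewrite (prednK q0) ltn_divLR // divnK // val_lt.
pose f (x : Zm) : 'I_(a %/ d).-1.+1 := inord (nat_of_ord (x : 'I_a.-1.+1) %/ d).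
have fI : {in [set x : Zm | (d %| nat_of_ord (x : 'I_a.-1.+1))%N] &, injective f}.
  move=> x y; rewrite !inE => dx dy /(congr1 val) /=.
  rewrite !inordK ?lt_q // => xy.
  by apply: (@ord_inj a.-1.+1); rewrite -(divnK dx) -(divnK dy) xy.
by rewrite -(card_in_imset fI) (leq_trans (max_card _)) // card_ord ?(prednK q0) ?(prednK p0).
Qed.

Lemma card_ptors m n : (#|[set D : 'M[Zm]_(m, n) | (D *+ p == 0)%R]| <= p ^ (m * n))%N.
Proof.
pose f (x : Zm) : 'I_p.-1.+1 := inord (nat_of_ord (x : 'I_a.-1.+1) %/ (a %/ p)).
have p0 := prime_gt0 p_pr.
have lt_p (x : Zm) : (nat_of_ord (x : 'I_a.-1.+1) %/ (a %/ p) < p.-1.+1)%N.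
  by rewrite (prednK p0) ltn_divLR ?ap_gt0 // mulnC app val_lt.
have fI : {in [set D : 'M[Zm]_(m, n) | (D *+ p == 0)%R] &, injective (map_mx f)}.
  move=> D E; rewrite !inE => /eqP/matrixP pD /eqP/matrixP pE /matrixP fDE.
  apply/matrixP => i l; have := fDE i l; rewrite !mxE => /(congr1 val) /=.
  have /eqP := pD i l; have /eqP := pE i l; rewrite !mulmxnE !mxE !mulrn_p => dE dD.
  rewrite !inordK ?lt_p // => xy.
  by apply: (@ord_inj a.-1.+1); rewrite -(divnK dD) -(divnK dE) xy.
by rewrite -(card_in_imset fI) (leq_trans (max_card _)) // card_mx card_ord ?(prednK q0) ?(prednK p0).
Qed.

(** For [D] killed by [p] this is linear independence of the columns over the field with [p]
    elements: [l *+ (a %/ p) = 0] means that [p] divides every entry of [l]. *)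
Definition pindep N j (D : 'M[Zm]_(N, j)) :=
  [forall l : 'cV[Zm]_j, (D *m l == 0) ==> (l *+ (a %/ p) == 0)].

(* Write D = (a/p) X; the Smith form of the integer matrix X, whose reduction
   mod p has rank j, provides the change of basis. *)
Lemma smith_zone N j (D : 'M[Zm]_(N, j)) : D *+ p = 0 -> pindep D ->
  exists U U' : 'M[Zm]_N, [/\ U *m U' = 1%:M, U' *m U = 1%:M, (j <= N)%N &
    forall M, M^T = M -> M *m D = 0 -> zone p j (U^T *m M *m U)].
Proof.
move=> pD /forallP indD.
pose X : 'M[int]_(N, j) := \matrix_(i, l) (nat_of_ord (D i l : 'I_a.-1.+1) %/ (a %/ p))%:Z.
have DX : D = map_mx intr X *+ (a %/ p).
  apply/matrixP => i l; rewrite mulmxnE !mxE -pmulrn -mulrnA divnK ?Zmod_natr_val //.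
  by rewrite -mulrn_p -mulmxnE pD mxE.
have [L uL [V uV [s _ XE]]] := int_Smith_normal_form X.
pose phi m n (Y : 'M[int]_(m, n)) : 'M[Zm]_(m, n) := map_mx intr Y.
have phi1 n : phi n n 1%:M = 1%:M by rewrite /phi map_mx1.
pose U := phi _ _ L; pose U' := phi _ _ (invmx L).
pose V1 := phi _ _ V; pose V' := phi _ _ (invmx V).
have UU' : U *m U' = 1%:M by rewrite -map_mxM mulmxV // map_mx1.
have U'U : U' *m U = 1%:M by rewrite -map_mxM mulVmx // map_mx1.
have VV' : V1 *m V' = 1%:M by rewrite -map_mxM mulmxV // map_mx1.
pose De := \matrix_(i < N, l < j) (s`_i *+ (i == l :> nat)) : 'M[int]_(N, j).
have DE : D = (U *m phi _ _ De *m V1) *+ (a %/ p) by rewrite DX XE !map_mxM.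
have DV' : D *m V' = (U *m phi _ _ De) *+ (a %/ p).
  by rewrite DE mulmxMnl -!mulmxA VV' mulmx1.
(* Otherwise [V' *m dt] would be a relation of [D]; being part of an invertible matrix, it is not
   divisible by [p]. *)
have col0 (t : 'I_j) : col t (phi _ _ De) *+ (a %/ p) != 0.
  apply/eqP => ct; pose dt : 'cV[Zm]_j := delta_mx t 0.
  have DV0 : D *m (V' *m dt) = 0.
    by rewrite mulmxA DV' mulmxMnl -mulmxA -colE -mulmxMnr ct mulmx0.
  have := indD (V' *m dt); rewrite DV0 eqxx => /eqP h.
  have /matrixP/(_ t 0) : V1 *m ((V' *m dt) *+ (a %/ p)) = 0 by rewrite h mulmx0.
  rewrite mulmxMnr mulmxA VV' mul1mx mulmxnE !mxE !eqxx /= => /eqP.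
  rewrite Zmod_natr_eq0 // => /dvdn_leq; rewrite ap_gt0 => /(_ isT).
  by rewrite leqNgt ltn_Pdiv ?prime_gt1.
have jN : (j <= N)%N.
  rewrite leqNgt; apply/negP => Nj; have /eqP[] := col0 (Ordinal Nj).
  by apply/matrixP => i l; rewrite mulmxnE !mxE (ltn_eqF (ltn_ord i)) mulr0n mul0rn.
exists U, U'; split=> // M sM MD.
have sM' : (U^T *m M *m U)^T = U^T *m M *m U by rewrite !trmx_mul trmxK sM mulmxA.
apply/zoneP; split=> //.
(* From [M *m D = 0], the entry [(M *m U) t i] times the invariant factor [s_i] is killed by
   [a %/ p]. As [s_i] is prime to [p], the entry itself is divisible by [p]. *)
have MU (t i : 'I_N) : (i < j)%N -> (M *m U) t i *+ (a %/ p) = 0.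
  move=> ij; pose i' := Ordinal ij; pose z : int := s`_i.
  have zE : z%:~R = (-1) ^+ (z < 0)%R * (absz z)%:R :> Zm.
    by rewrite {1}[z]intEsign rmorphM rmorphXn rmorphN1.
  have ndvd : ~~ (p %| absz z)%N.
    apply: contra (col0 i') => ds; apply/eqP/matrixP => l y; rewrite mulmxnE !mxE /=.
    have [->|li] := eqVneq (l : nat) i; last by rewrite mulr0n mul0rn.
    rewrite mulr1n -/z zE -mulrnAr -mulr_natr -natrM.
    have -> : (absz z * (a %/ p))%:R = 0 :> Zm; last by rewrite mulr0.
    by apply/eqP; rewrite Zmod_natr_eq0 // -[X in (X %| _)%N]app mulnC dvdn_pmul2r // ap_gt0.
  have : (M *m D *m V') t i' = 0 by rewrite MD mul0mx mxE.
  have -> : (M *m D *m V') t i' = (M *m U) t i * z%:~R *+ (a %/ p).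
    have De_i l : phi _ _ De l i' = (z *+ (l == i))%:~R.
      rewrite !mxE /=; have [->|li] := eqVneq l i; first by rewrite eqxx.
      by rewrite (_ : (l == i :> nat) = false) //; apply: contraNF li => /eqP/ord_inj ->.
    rewrite -mulmxA DV' mulmxMnr mulmxA mulmxnE mxE (bigD1 i) //= De_i eqxx big1 ?addr0 //.
    by move=> l /negPf li; rewrite De_i li mulr0.
  set x := (M *m U) t i => h.
  have : x *+ (a %/ p * absz z)%N = 0.
    rewrite mulrnA -mulr_natr; move: h; rewrite zE.
    move=> /(congr1 (fun y => (-1) ^+ (z < 0)%R * y)); rewrite mulr0 => <-.
    by rewrite -!mulrnAl mulrCA [_ * (_ * (absz z)%:R)]mulrA -expr2 sqrr_sign mul1r.
  move/eqP; rewrite Zmod_mulrn_eq0 // -[X in (X %| _)%N]app mulnCA dvdn_pmul2l ?ap_gt0 //.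
  rewrite Euclid_dvdM // (negPf ndvd) orbF => px.
  by apply/eqP; rewrite mulrn_ap.
(* Left multiplication by [U^T] preserves divisibility of the first [j] columns, and symmetry
   transfers it to the rows. *)
move=> i l ij; rewrite -sM' mxE -mulmxA mxE -sumrMnl big1 // => t _.
by rewrite -mulrnAr MU // mulr0.
Qed.
End Torsion.

Lemma leq_expl m n d : (m <= n)%N -> (m ^ d <= n ^ d)%N.
Proof. by case: d => // d mn; rewrite leq_exp2r. Qed.

Lemma card_set_pairs (T : finType) : #|{: {set T} * {set T}}| = (4 ^ #|T|)%N.
Proof.
have cT : #|{: {set T}}| = (2 ^ #|T|)%N by rewrite -(cardsT T) -card_powerset powersetT cardsT.
by rewrite card_prod cT -expnMn.
Qed.

Section ZoneCount.
Variables (a p : nat) (a_gt0 : (0 < a)%N) (p_pr : prime p) (pa : (p %| a)%N).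
Variables (k : nat) (R : realType).
Local Notation C := R[i].
Local Notation Zm := (Zmod a).
Local Notation W := ('rV[Zm]_k * 'rV[Zm]_k)%type.
Variables (e : Zm -> C).
Hypotheses (eD : forall x y, e (x + y) = e x * e y)
  (en : forall x, `|e x| = 1) (e1 : forall x, e x = 1 -> x = 0).

Lemma card_W_ptors : (#|[set u : W | (u *+ p == 0)%R]| <= (p ^ k) ^ 2)%N.
Proof.
pose A := [set x : 'rV[Zm]_k | (x *+ p == 0)%R]%SET.
apply: (@leq_trans #|finset.setX A A|).
  apply: subset_leq_card; apply/fintype.subsetP => -[x y]; rewrite !inE /= => /eqP h.
  have := congr1 fst h; have := congr1 snd h; rewrite !raddfMn /= => -> ->.
  by rewrite eqxx.
by rewrite cardsX -mulnn leq_mul // (leq_trans (card_ptors _ _ _ _ _)) // mul1n.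
Qed.

Lemma isoset1_card T : @isoset a k 1 T -> (#|T| <= a ^ k)%N.
Proof. by rewrite -indep_isoset; apply: (indep_isobad_card a_gt0 eD en e1). Qed.

Lemma isosetp_card T : @isoset a k p T -> (#|T| <= a ^ k * p ^ k)%N.
Proof.
move/(isoset_card eD en e1) => h; rewrite -(leq_exp2r _ _ (isT : (0 < 2)%N)).
apply: leq_trans h _; rewrite expnMn leq_mul ?card_W_ptors //.
by rewrite card_prod card_rows // mulnn.
Qed.

Section Rows.
Variables (N j : nat) (jN : (j <= N)%N).
Implicit Types (w : {ffun 'I_N -> W}).

(* The condition on w for the sum of e (pairing M w) over the zone not to vanish. *)
Definition zone_cond w :=
  [forall i : 'I_N, [forall l : 'I_N, [&& beta w i i *+ p == 0, (beta w i l + beta w l i) *+ p == 0 &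
   ((j <= i)%N && (j <= l)%N) ==> (beta w i i == 0) && (beta w i l + beta w l i == 0)]]].

(** Words are sorted by the sets [T1] and [T2] of letters used below position [j] and from [j] on;
    [4 ^ #|W|] counts these pairs of sets. [T2] is isotropic, whereas [T1] is so only after
    multiplication by [p], hence the extra factor [p ^ k] at each of the first [j] positions. *)
Lemma card_zone_cond :
  (#|[pred w | zone_cond w]| <= 4 ^ #|{: W}| * ((a ^ k * p ^ k) ^ j * (a ^ k) ^ (N - j)))%N.
Proof.
pose lo w := [set w i | i : 'I_N & (i < j)%N]%SET.
pose hi w := [set w i | i : 'I_N & (j <= i)%N]%SET.
rewrite -sum1_card (partition_big (fun w => (lo w, hi w)) predT) //=.
rewrite -card_set_pairs -sum_nat_const; apply: leq_sum => -[T1 T2] _.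
rewrite sum1_card; pose Q := [pred w | zone_cond w && ((lo w, hi w) == (T1, T2))].
rewrite (eq_card (B := Q)) => [|w]; last by rewrite [RHS]inE.
have [w0|Q0] := pickP Q; last by rewrite eq_card0 // => x; apply: Q0.
rewrite /Q /= => /andP[w0c /eqP[lo0 hi0]].
have zc i l := forallP (forallP w0c i) l.
have iso1 : (#|T1| <= a ^ k * p ^ k)%N.
  apply: isosetp_card; apply/isosetP; rewrite -lo0 => _ _ /imsetP[i _ ->] /imsetP[l _ ->].
  have /and3P[/eqP b1 /eqP b2 _] := zc i l; have /and3P[/eqP b3 _ _] := zc l l.
  by rewrite qf_beta mulrnBl b2 mulrnDl b1 b3 addr0 subr0.
have iso2 : (#|T2| <= a ^ k)%N.
  apply: isoset1_card; apply/isosetP; rewrite -hi0 => _ _ /imsetP[i ij ->] /imsetP[l lj ->].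
  move: ij lj; rewrite !inE => ij lj.
  have /and3P[_ _] := zc i l; rewrite ij lj /= => /andP[/eqP b1 /eqP b2].
  have /and3P[_ _] := zc l l; rewrite lj /= => /andP[/eqP b3 _].
  by rewrite qf_beta b2 b1 b3 addr0 subr0.
pose F (i : 'I_N) := if (i < j)%N then T1 else T2.
apply: (@leq_trans #|family F|).
  apply: subset_leq_card; apply/fintype.subsetP => w /andP[_ /eqP[lw hw]].
  apply/familyP => i; rewrite /F; case: ltnP => ij.
    by rewrite -lw; apply/imsetP; exists i; rewrite ?inE.
  by rewrite -hw; apply/imsetP; exists i; rewrite ?inE.
rewrite card_family foldrE big_map big_enum /=.
rewrite (eq_bigr (fun i : 'I_N => if (i < j)%N then #|T1| else #|T2|)); last first.
  by move=> i _; rewrite /F; case: ifP.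
rewrite -(big_mkord predT (fun i => if (i < j)%N then #|T1| else #|T2|)).
rewrite (big_cat_nat (n := j)) //= (eq_big_nat _ _ (F2 := fun=> #|T1|)) => [|i /andP[_ ->]//].
rewrite [X in (_ * X)%N](eq_big_nat _ _ (F2 := fun=> #|T2|)) => [|i]; last first.
  by rewrite leqNgt => /andP[/negPf -> _].
by rewrite !prod_nat_const_nat subn0; apply: leq_mul; apply: leq_expl.
Qed.

Definition nker (M : 'M[Zm]_N) := #|[set c : 'M[Zm]_(N, k) | M *m c == 0]%SET|.

(** Fourier inversion over the zone: a word contributes at most the size of the zone, and nothing at
    all unless it satisfies [zone_cond]. *)
Lemma zone_kernel_le :
  ((\sum_(M : 'M[Zm]_N | zone p j M) nker M) * (a ^ k) ^ N <=
   #|[pred M : 'M[Zm]_N | zone p j M]| * #|[pred w | zone_cond w]|)%N.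
Proof.
have m0 : (0 < (a ^ k) ^ N)%N by rewrite !expn_gt0 a_gt0.
rewrite -(ler_nat C) natrM natr_sum.
have card1 (M : 'M[Zm]_N) : \sum_(c : 'M[Zm]_(N, k) | M *m c == 0) 1 =
    ((a ^ k) ^ N)%:R^-1 * \sum_(w : {ffun 'I_N -> W}) e (pairing M w).
  rewrite (card_mul_ker a_gt0 eD en e1 M (fun=> 1)); congr (_ * _).
  by apply: eq_bigr => w _; rewrite mul1r.
have -> : \sum_(M : 'M[Zm]_N | zone p j M) (nker M)%:R = ((a ^ k) ^ N)%:R^-1 *
    \sum_(w : {ffun 'I_N -> W}) \sum_(M : 'M[Zm]_N | zone p j M) e (pairing M w) :> C.
  rewrite exchange_big mulr_sumr; apply: eq_bigr => M _ /=.
  rewrite /nker -sum1_card natr_sum (eq_bigl (fun c => M *m c == 0)) => [|c]; last by rewrite inE.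
  exact: card1.
rewrite mulrC mulrA divff ?mul1r ?pnatr_eq0 -?lt0n //.
have bd w : `|\sum_(M : 'M[Zm]_N | zone p j M) e (pairing M w)| <=
    #|[pred M : 'M[Zm]_N | zone p j M]|%:R * (zone_cond w)%:R.
  have [zw|nzw] := boolP (zone_cond w).
    rewrite mulr1 -sum1_card natr_sum; apply: le_trans (ler_norm_sum _ _ _) _.
    by apply: ler_sum => M _; rewrite en.
  rewrite mulr0 normr_le0; apply: contraNT nzw => /(zone_sum_neq0 a_gt0 eD e1 pa)[h1 h2].
  apply/forallP => i; apply/forallP => l; have [-> ->] := h2 i l; rewrite eqxx /=.
  by apply/implyP => /andP[ij lj]; have [-> ->] := h1 i l ij lj; rewrite eqxx.
have S0 : 0 <= \sum_(w : {ffun 'I_N -> W}) \sum_(M : 'M[Zm]_N | zone p j M) e (pairing M w).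
  rewrite exchange_big; apply: sumr_ge0 => M _ /=.
  have h := card1 M; have m0' : 0 < ((a ^ k) ^ N)%:R^-1 :> C by rewrite invr_gt0 ltr0n.
  by rewrite -(pmulr_rge0 _ m0') -h sumr_ge0.
rewrite -(ger0_norm S0); apply: le_trans (ler_norm_sum _ _ _) _.
apply: le_trans (ler_sum _ (fun w _ => bd w)) _.
rewrite -mulr_sumr natrM; apply: ler_wpM2l => //.
rewrite -sum1_card natr_sum [leRHS]big_mkcond; apply: ler_sum => w _.
by rewrite inE; case: (zone_cond w).
Qed.
End Rows.
End ZoneCount.

Section ZoneCard.
Variables (a p : nat) (a_gt0 : (0 < a)%N) (p_pr : prime p) (pa : (p %| a)%N).
Local Notation Zm := (Zmod a).
Variables (N j : nat) (jN : (j <= N)%N).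

Definition upper_fam (A : 'I_N -> {set Zm}) (x : 'I_N * 'I_N) : {set Zm} :=
  if (x.1 <= x.2)%N then A x.1 else [set 0]%SET.

Lemma card_upper_fam A :
  #|family (upper_fam A)| = (\prod_(i < N) \prod_(l < N | (i <= l)%N) #|A i|)%N.
Proof.
rewrite card_family foldrE big_map big_enum /=.
rewrite (pair_big_dep predT (fun i l : 'I_N => (i <= l)%N) (fun i l => #|A i|)) /=.
rewrite [RHS]big_mkcond /=; apply: eq_bigr => -[i l] _; rewrite /upper_fam /=.
by case: ifP => // _; rewrite cards1.
Qed.

Definition upper (M : 'M[Zm]_N) : {ffun 'I_N * 'I_N -> Zm} :=
  [ffun x : 'I_N * 'I_N => if (x.1 <= x.2)%N then M x.1 x.2 else 0].

Lemma upper_inj (M M' : 'M[Zm]_N) : M^T = M -> M'^T = M' -> upper M = upper M' -> M = M'.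
Proof.
move=> sM sM' /ffunP E; apply/matrixP => i l.
have h (s t : 'I_N) : (s <= t)%N -> M s t = M' s t.
  by move=> st; have := E (s, t); rewrite !ffunE /= st.
have [il|li] := leqP i l; first exact: h.
by rewrite -sM -sM' !mxE h // ltnW.
Qed.

Definition of_upper (f : {ffun 'I_N * 'I_N -> Zm}) : 'M[Zm]_N :=
  \matrix_(i, l) (if (i <= l)%N then f (i, l) else f (l, i)).

Lemma of_upper_sym f : (of_upper f)^T = of_upper f.
Proof.
apply/matrixP => i l; rewrite !mxE; case: ltngtP => // /ord_inj ->//.
Qed.

(** A symmetric matrix is given by its entries on and above the diagonal. Of these,
    [j * N - 'C(j, 2)] lie in the first [j] rows, where only [a / p] values are divisible by [p]. *)
Lemma card_zone :
  (#|[pred M : 'M[Zm]_N | zone p j M]| * p ^ (j * N) <=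
   p ^ 'C(j, 2) * #|[pred M : 'M[Zm]_N | M^T == M]|)%N.
Proof.
pose A1 (i : 'I_N) : {set Zm} :=
  if (i < j)%N then [set x : Zm | (x *+ (a %/ p) == 0)%R]%SET else [set: Zm]%SET.
pose A2 (i : 'I_N) : {set Zm} := [set: Zm]%SET.
have le1 : (#|[pred M : 'M[Zm]_N | zone p j M]| <= #|family (upper_fam A1)|)%N.
  have uI : {in [pred M : 'M[Zm]_N | zone p j M] &, injective upper}.
    by move=> M M' /zoneP[sM _] /zoneP[sM' _]; apply: upper_inj.
  rewrite -(card_in_imset uI); apply: subset_leq_card.
  apply/fintype.subsetP => _ /imsetP[M /zoneP[sM zM] ->]; apply/familyP => -[i l].
  rewrite /upper_fam ffunE /=; case: ifP => il; last by rewrite inE.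
  by rewrite /A1; case: ifP => ij; rewrite inE // zM.
have le2 : (#|family (upper_fam A2)| <= #|[pred M : 'M[Zm]_N | M^T == M]|)%N.
  have oI : {in family (upper_fam A2) &, injective of_upper}.
    move=> f g /familyP ff /familyP fg /matrixP E; apply/ffunP => -[i l].
    have := E i l; rewrite !mxE; case: ifP => il // _.
    have := ff (i, l); have := fg (i, l); rewrite /upper_fam /= il !inE.
    by move=> /eqP -> /eqP ->.
  rewrite -(card_in_imset oI); apply: subset_leq_card.
  by apply/fintype.subsetP => _ /imsetP[f _ ->]; rewrite inE of_upper_sym.
apply: leq_trans (_ : (#|family (upper_fam A1)| * p ^ (j * N) <= _)%N).
  by rewrite leq_mul2r le1 orbT.
apply: leq_trans (_ : (p ^ 'C(j, 2) * #|family (upper_fam A2)| <= _)%N); last first.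
  by rewrite leq_mul2l le2 orbT.
rewrite !card_upper_fam.
have -> : (j * N = 'C(j, 2) + \sum_(i < N) \sum_(l < N | (i <= l)%N) (i < j))%N.
  have -> : (\sum_(i < N) \sum_(l < N | (i <= l)%N) (i < j) = \sum_(i < N | (i < j)%N) (N - i))%N.
    rewrite [RHS]big_mkcond; apply: eq_bigr => i _; case: (i < j)%N; last by rewrite big1.
    by rewrite -(big_geq_mkord i N predT (fun=> 1%N)) sum_nat_const_nat muln1.
  rewrite -(big_ord_widen N (fun i => N - i)%N jN) -bin2_sum big_mkord -big_split /=.
  rewrite (eq_bigr (fun=> N)) => [|i _]; last by rewrite addnC subnK // (leq_trans (ltnW (ltn_ord i))).
  by rewrite sum_nat_const card_ord.
rewrite expnD mulnCA leq_mul2l; apply/orP; right.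
rewrite expn_sum -big_split /=; apply: leq_prod => i _.
rewrite expn_sum -big_split /=; apply: leq_prod => l _.
rewrite /A1 /A2 cardsT card_Zmod //; case: ifP => ij; last by rewrite expn0 muln1 cardsT card_Zmod.
rewrite expn1 -[leqRHS](app pa) leq_mul2r; apply/orP; right.
rewrite (eq_card (B := [set x : Zm | (p %| nat_of_ord (x : 'I_a.-1.+1))%N]%SET)).
  exact: card_divisible (prime_gt0 p_pr) pa.
by move=> x; rewrite !inE mulrn_ap.
Qed.
End ZoneCard.

Section UniformBound.
Variables (a p : nat) (a_gt0 : (0 < a)%N) (p_pr : prime p) (pa : (p %| a)%N).
Local Notation Zm := (Zmod a).
Variables (k N : nat) (R : realType).
Local Notation W := ('rV[Zm]_k * 'rV[Zm]_k)%type.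

(** The change of basis of [smith_zone] sends the symmetric [M] killing [D] injectively into the
    zone, and multiplication by [U'] embeds each kernel into the new one. *)
Lemma conj_zone_le j (D : 'M[Zm]_(N, j)) : D *+ p = 0 -> pindep p D ->
  (j <= N)%N /\ (\sum_(M : 'M[Zm]_N | (M^T == M) && (M *m D == 0)%R) nker k M
   <= \sum_(M : 'M[Zm]_N | zone p j M) nker k M)%N.
Proof.
move=> pD iD; have [U [U' [UU' U'U jN zU]]] := smith_zone a_gt0 p_pr pa pD iD; split=> //.
have UtU : U'^T *m U^T = 1%:M by rewrite -trmx_mul UU' trmx1.
pose h (M : 'M[Zm]_N) := U^T *m M *m U.
have hI : injective h.
  move=> M M' /(congr1 (fun X => U'^T *m X *m U')).
  by rewrite /h !mulmxA UtU !mul1mx -!mulmxA UU' !mulmx1.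
have nh M : (nker k M <= nker k (h M))%N.
  have cI : injective (fun c : 'M[Zm]_(N, k) => U' *m c).
    by move=> c c' /(congr1 (mulmx U)); rewrite !mulmxA UU' !mul1mx.
  rewrite /nker -(card_imset _ cI); apply: subset_leq_card.
  apply/fintype.subsetP => _ /imsetP[c + ->]; rewrite !inE => /eqP Mc.
  by rewrite /h -!mulmxA [U *m _]mulmxA UU' mul1mx Mc mulmx0.
apply: leq_trans (_ : (\sum_(M : 'M[Zm]_N | (M^T == M) && (M *m D == 0)%R) nker k (h M) <= _)%N).
  exact: leq_sum.
rewrite (eq_bigl (fun M => M \in [set M : 'M[Zm]_N | (M^T == M) && (M *m D == 0)%R]%SET)); last first.
  by move=> M; rewrite inE.
rewrite -(big_imset (fun M => nker k M)) /=; last by move=> M M' _ _ /hI.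
rewrite [leqLHS]big_mkcond [leqRHS]big_mkcond; apply: leq_sum => M _.
case: ifP => // /imsetP[M']; rewrite inE => /andP[/eqP sM /eqP MD] ->.
by rewrite (zU _ sM MD).
Qed.

(** There are at most [p ^ (j * N)] tuples [D], and for each of them the zone is at most the
    fraction [p ^ 'C(j, 2) / p ^ (j * N)] of all symmetric matrices, so N cancels. *)
Lemma uniform_pindep_sum j :
  (\sum_(M : 'M[Zm]_N | M^T == M) nker k M *
     #|[set D : 'M[Zm]_(N, j) | [&& M *m D == 0, D *+ p == 0 & pindep p D]%R]|
   <= p ^ ('C(j, 2) + k * j) * 4 ^ #|{: W}| * #|[pred M : 'M[Zm]_N | M^T == M]|)%N.
Proof.
have [e [eD en e1]] := faithful_char_ex a_gt0 R[i].
set S := #|[pred M : 'M[Zm]_N | M^T == M]|.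
pose G := [set D : 'M[Zm]_(N, j) | (D *+ p == 0)%R && pindep p D]%SET.
have -> : (\sum_(M : 'M[Zm]_N | M^T == M) nker k M *
     #|[set D : 'M[Zm]_(N, j) | [&& M *m D == 0, D *+ p == 0 & pindep p D]%R]| =
   \sum_(D in G) \sum_(M : 'M[Zm]_N | (M^T == M) && (M *m D == 0)%R) nker k M)%N.
  rewrite (exchange_big_dep (fun M : 'M[Zm]_N => M^T == M)) /=; last by move=> D M _ /andP[].
  apply: eq_bigr => M sM; rewrite sum_nat_const mulnC; congr (_ * _)%N.
  by apply: eq_card => D; rewrite !inE sM unfold_in /= !inE andbC.
have p0 := prime_gt0 p_pr.
have bd D : D \in G -> (p ^ (j * N) * \sum_(M : 'M[Zm]_N | (M^T == M) && (M *m D == 0)%R) nker k M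
    <= p ^ ('C(j, 2) + k * j) * 4 ^ #|{: W}| * S)%N.
  rewrite inE => /andP[/eqP pD iD]; have [jN h] := conj_zone_le pD iD.
  apply: leq_trans (_ : (p ^ (j * N) * \sum_(M : 'M[Zm]_N | zone p j M) nker k M <= _)%N).
    by rewrite leq_mul2l h orbT.
  have m0 : (0 < (a ^ k) ^ N)%N by rewrite !expn_gt0 a_gt0.
  rewrite -(leq_pmul2r m0) -mulnA.
  apply: leq_trans (leq_mul (leqnn _) (zone_kernel_le a_gt0 pa k eD en e1 N j)) _.
  apply: leq_trans (leq_mul (leqnn _) (leq_mul (leqnn _) (card_zone_cond a_gt0 p_pr pa k eD en e1 jN))) _.
  have -> : ((a ^ k * p ^ k) ^ j * (a ^ k) ^ (N - j) = (a ^ k) ^ N * p ^ (k * j))%N.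
    by rewrite expnMn -(expnM p) mulnAC -expnD subnKC.
  set Z := #|_|; set F := (4 ^ _)%N; set m := ((a ^ k) ^ N)%N.
  have -> : (p ^ (j * N) * (Z * (F * (m * p ^ (k * j)))) = (Z * p ^ (j * N)) * (F * m * p ^ (k * j)))%N.
    by ring.
  apply: leq_trans (leq_mul (card_zone a_gt0 p_pr pa jN) (leqnn _)) _.
  by rewrite expnD -/S; apply: eq_leq; ring.
have pN0 : (0 < p ^ (j * N))%N by rewrite expn_gt0 p0.
rewrite -(leq_pmul2l pN0) big_distrr /=.
apply: (@leq_trans (\sum_(D in G) (p ^ ('C(j, 2) + k * j) * 4 ^ #|{: W}| * S))%N).
  by apply: leq_sum => D DG; apply: bd.
rewrite sum_nat_const leq_mul2r; apply/orP; right.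
rewrite mulnC; apply: leq_trans (card_ptors a_gt0 p_pr pa N j).
by apply: subset_leq_card; apply/fintype.subsetP => D; rewrite !inE => /andP[].
Qed.
End UniformBound.

(** * The index of a subgroup modulo p *)

Section InjectiveCount.
Variables (R : realType) (p : nat).

(* For y = p ^ x, the number of injective linear maps from F_p^j to F_p^x. *)
Definition inj_count (j : nat) (y : R) : R := \prod_(i < j) (y - p%:R ^+ i).

Lemma inj_countS j y : inj_count j.+1 y = inj_count j y * (y - p%:R ^+ j).
Proof. exact: big_ord_recr. Qed.

(** Both sides are the product of [p y - p^i] over [i <= j]: the factor at [i = 0] is [p y - 1], and
    each later one is [p] times a factor of [inj_count j y]. *)
Lemma inj_count_mulp j y :
  inj_count j (p%:R * y) * (p%:R * y - p%:R ^+ j) = p%:R ^+ j * (p%:R * y - 1) * inj_count j y.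
Proof.
rewrite -inj_countS /inj_count big_ord_recl expr0 /=.
have -> : p%:R ^+ j = \prod_(i < j) (p%:R : R) by rewrite prodr_const card_ord.
rewrite [RHS]mulrAC -big_split /= [RHS]mulrC; congr (_ * _).
by apply: eq_bigr => i _; rewrite /bump /= add1n exprS mulrBr.
Qed.

Lemma inj_count_pow_eq0 j x : (x < j)%N -> inj_count j (p%:R ^+ x) = 0.
Proof. by move=> xj; rewrite /inj_count (bigD1 (Ordinal xj)) //= subrr mul0r. Qed.
End InjectiveCount.

Section AbelianGroup.
Local Open Scope group_scope.
Variables (gT : finGroupType) (abT : abelian [set: gT]%SET) (p : nat) (p_pr : prime p).
Implicit Types K C E : {group gT}.

Lemma abT_mulC (x y : gT) : x * y = y * x.
Proof. by apply: (centsP abT); rewrite inE. Qed.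

Lemma abT_expMg (x y : gT) n : (x * y) ^+ n = x ^+ n * y ^+ n.
Proof. by apply: expgMn; apply: abT_mulC. Qed.

Lemma abT_norm (A : {set gT}) C : A \subset 'N(C).
Proof.
apply: fintype.subset_trans (cent_sub _); apply: fintype.subset_trans (finset.subsetT _) _.
by rewrite centsC (fintype.subset_trans (finset.subsetT _)) // centsC // (fintype.subset_trans _ abT) // finset.subsetT.
Qed.

Definition powset (K : {set gT}) := [set x ^+ p | x in K]%SET.
Definition rootset (K C : {set gT}) := [set x in K | x ^+ p \in C]%SET.

Lemma powset_group_set K : group_set (powset K).
Proof.
apply/group_setP; split; first by apply/imsetP; exists 1; rewrite ?group1 ?expg1n.
move=> _ _ /imsetP[x xK ->] /imsetP[y yK ->]; rewrite -abT_expMg.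
by apply/imsetP; exists (x * y); rewrite ?groupM.
Qed.
Canonical powset_group K := Group (powset_group_set K).

Lemma rootset_group_set K C : group_set (rootset K C).
Proof.
apply/group_setP; split; first by rewrite inE !group1 expg1n group1.
by move=> x y; rewrite !inE => /andP[xK xC] /andP[yK yC]; rewrite abT_expMg !groupM.
Qed.
Canonical rootset_group K C := Group (rootset_group_set K C).

Lemma card_rootset K C : C \subset K -> exists x, #|rootset K C| = (#|C| * p ^ x)%N.
Proof.
move=> CK; have sCD : C \subset rootset K C.
  by apply/fintype.subsetP => x xC; rewrite inE (fintype.subsetP CK) // groupX.
have ab : p.-abelem (rootset K C / C).
  rewrite abelemE //; apply/andP; split.
    by apply: quotient_abelian; apply: abelianS (finset.subsetT _) abT.
  apply/exponentP => _ /morphimP[x xN + ->]; rewrite inE => /andP[_ xC].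
  by rewrite -morphX //; apply: coset_id.
exists (logn p #|rootset K C / C|).
rewrite -(card_pgroup (abelem_pgroup ab)) card_quotient ?abT_norm //.
by rewrite Lagrange.
Qed.

(** Raising to the power [p] and reducing modulo [C] is a morphism on [K] with kernel [rootset K C]
    and image [powset K / C]. *)
Lemma card_rootset_powset K C : C \subset K ->
  (#|rootset K C| * #|C <*> powset K| = #|C| * #|K|)%N.
Proof.
move=> CK.
pose f x := coset C (x ^+ p).
have fM : {in K &, {morph f : x y / x * y}}.
  move=> x y _ _; rewrite /f abT_expMg morphM //;
    by apply: (fintype.subsetP (abT_norm [set: gT]%SET C)); rewrite inE.
pose fm := Morphism fM.
have kerf : 'ker fm = rootset K C.
  apply/setP => x; rewrite !inE; apply: andb_id2l => xK; rewrite /= /f.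
  apply/eqP/idP => [|xC]; last exact: coset_id.
  by apply: coset_idr; apply: (fintype.subsetP (abT_norm [set: gT]%SET C)); rewrite inE.
have imf : fm @* K = powset K / C.
  rewrite morphimE finset.setIid; apply/setP => y; apply/imsetP/idP => [[x xK ->]|].
    by apply: mem_quotient; apply/imsetP; exists x.
  case/morphimP => _ _ /imsetP[x xK ->] ->; by exists x.
have cK : #|K| = (#|rootset K C| * #|powset K / C|)%N.
  have := card_morphim fm K; rewrite finset.setIid kerf imf => ->.
  by rewrite Lagrange //; apply/fintype.subsetP => x; rewrite inE => /andP[].
have cE : #|C <*> powset K| = (#|C| * #|powset K / C|)%N.
  rewrite -(quotientYidl (abT_norm (powset K) C)) card_quotient ?abT_norm //.
  by rewrite Lagrange // joing_subl.
by rewrite cK cE; ring.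
Qed.

Definition pindex K C : nat := #|K : C <*> powset K|.

(** This trades an index for a count of elements, which is what makes powers of the index into
    moments. *)
Lemma pindexE K C : C \subset K -> #|rootset K C| = (#|C| * pindex K C)%N.
Proof.
move=> CK; have := card_rootset_powset CK.
have sE : C <*> powset K \subset K.
  rewrite join_subG CK; apply/fintype.subsetP => _ /imsetP[x xK ->]; exact: groupX.
rewrite -(Lagrange sE) mulnA mulnAC => /eqP; rewrite eqn_pmul2r ?cardG_gt0 // => /eqP ->.
by [].
Qed.

Lemma pindex_pow K C : C \subset K -> exists x, pindex K C = (p ^ x)%N.
Proof.
move=> CK; have [x] := card_rootset CK; rewrite pindexE // => /eqP.
by rewrite eqn_pmul2l ?cardG_gt0 // => /eqP ->; exists x.
Qed.

(** A form of Nakayama's lemma. If [pindex] is 1 then [rootset K C = C], and Cauchy rules out an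
    element of order [p] in [K / C]. Conversely [pindex] is the index of [C] in [rootset K C], hence
    a divisor of [#|K : C|]. *)
Lemma pindex_eq1 K C : C \subset K -> (pindex K C == 1%N) = ~~ (p %| #|K : C|)%N.
Proof.
move=> CK; have cq : #|K / C| = #|K : C| by rewrite card_quotient ?abT_norm.
rewrite -cq; apply/idP/idP => [/eqP y1|].
  apply/negP => /Cauchy -/(_ p_pr)[_ /morphimP[x xN xK ->] o].
  have xC : x ^+ p \in C.
    by apply: coset_idr; rewrite ?groupX // morphX // -o expg_order.
  have : rootset K C = C.
    apply/eqP; rewrite eq_sym eqEcard pindexE // y1 muln1 leqnn andbT.
    by apply/fintype.subsetP => z zC; rewrite inE (fintype.subsetP CK) // groupX.
  move/setP/(_ x); rewrite inE xK xC /= => /esym xC'.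
  by move: o; rewrite /= coset_id // order1 => p1; have := prime_gt1 p_pr; rewrite -p1.
apply: contraR => y1; have [x yx] := pindex_pow CK.
have px : (p %| pindex K C)%N.
  by rewrite yx dvdn_exp // lt0n; apply: contra y1 => /eqP x0; rewrite yx x0.
apply: dvdn_trans px _; rewrite cq; apply: (@dvdn_trans #|rootset K C : C|).
  have sCD : C \subset rootset K C.
    by apply/fintype.subsetP => z zC; rewrite inE (fintype.subsetP CK) // groupX.
  have := Lagrange sCD; rewrite pindexE // => /eqP; rewrite eqn_pmul2l ?cardG_gt0 // => /eqP ->.
  exact: dvdnn.
apply: indexSg; apply/fintype.subsetP => z.
  by move=> zC; rewrite inE (fintype.subsetP CK) // groupX.
by rewrite inE => /andP[].
Qed.

Lemma pindex_join K C v : C \subset K -> v \in K ->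
  pindex K C = (if v \in C <*> powset K then pindex K (C <*> <[v]>)
                else p * pindex K (C <*> <[v]>))%N.
Proof.
move=> CK vK; set E := (C <*> powset K)%G.
have EK : E \subset K.
  rewrite join_subG CK; apply/fintype.subsetP => _ /imsetP[x xK ->]; exact: groupX.
have Ev : C <*> <[v]> <*> powset K = E <*> <[v]> by rewrite -!joingA [<[v]> <*> _]joingC.
have EvK : E <*> <[v]> \subset K by rewrite join_subG EK cycle_subG.
rewrite /pindex Ev -/(gval E); case: ifP => [vE|/negbT vE].
  by congr #|_ : _|; apply/esym/joing_idPl; rewrite cycle_subG.
have vN : v \in 'N(E) by apply: (fintype.subsetP (abT_norm [set: gT]%SET E)); rewrite inE.
have ordv : #[coset E v] = p.
  apply: nt_prime_order => //.
    rewrite -morphX //; apply: coset_id; apply: (fintype.subsetP (joing_subr _ _)).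
    by apply/imsetP; exists v.
  by apply: contra vE => /eqP; apply: coset_idr.
have : #|E <*> <[v]>| = (#|E| * p)%N.
  rewrite -ordv orderE -quotient_cycle // -(quotientYidl (abT_norm _ E)).
  by rewrite card_quotient ?abT_norm // Lagrange // joing_subl.
have := Lagrange EvK; rewrite -(Lagrange EK) => + cE; rewrite cE -mulnA => /eqP.
by rewrite eqn_pmul2l ?cardG_gt0 // => /eqP ->.
Qed.

(* With y = pindex K C, a proportion 1/y of the v in K lies in C <*> powset K and
   leaves y unchanged; the others divide it by p. *)
Lemma sum_inj_count_pindex (R : realType) K C j : C \subset K ->
  (\sum_(v in K) inj_count p j (pindex K (C <*> <[v]>))%:R =
   #|K|%:R * p%:R ^- j * inj_count p j (pindex K C)%:R :> R)%R.
Proof.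
move=> CK; set E := (C <*> powset K)%G.
have EK : E \subset K.
  rewrite join_subG CK; apply/fintype.subsetP => _ /imsetP[x xK ->]; exact: groupX.
have cK : #|K| = (#|E| * pindex K C)%N by rewrite /pindex Lagrange.
have p0 : (p%:R != 0 :> R)%R by rewrite pnatr_eq0 -lt0n prime_gt0.
rewrite (bigID (mem E)) /=.
rewrite (eq_bigr (fun=> inj_count p j (pindex K C)%:R))%R => [|v /andP[vK vE]]; last first.
  by rewrite (pindex_join CK vK) vE.
have -> : (\sum_(v in K | v \in E) inj_count p j (pindex K C)%:R =
    #|E|%:R * inj_count p j (pindex K C)%:R :> R)%R.
  rewrite (eq_bigl (mem E)) => [|v]; first by rewrite sumr_const mulr_natl.
  by rewrite andb_idl //; apply: (fintype.subsetP EK).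
have [x yx] := pindex_pow CK; case: x yx => [|x] yx.
  have KE : K :=: E.
    by apply/eqP; rewrite eq_sym eqEcard EK /= cK yx muln1.
  rewrite big1 => [|v /andP[]]; last by rewrite -KE => ->.
  rewrite cK yx expn0 muln1 addr0; case: j => [|j]; first by rewrite expr0 invr1 mulr1.
  by rewrite -[1%:R]/(p%:R ^+ 0)%R inj_count_pow_eq0 // !mulr0.
rewrite (eq_bigr (fun=> inj_count p j (p ^ x)%:R))%R => [|v /andP[vK /negPf vE]]; last first.
  have := pindex_join CK vK; rewrite vE yx expnS => /eqP.
  by rewrite eqn_pmul2l ?prime_gt0 // => /eqP ->.
have -> : (\sum_(v in K | v \notin E) inj_count p j (p ^ x)%:R =
    (#|K|%:R - #|E|%:R) * inj_count p j (p ^ x)%:R :> R)%R.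
  rewrite (eq_bigl (mem (K :\: E)%SET)) => [|v]; last by rewrite !inE andbC.
  rewrite sumr_const -[LHS]mulr_natl; congr (_ * _)%R.
  rewrite cardsD (finset.setIidPr EK) natrB //; exact: subset_leq_card.
rewrite cK yx natrM expnS natrM; set y : R := (p ^ x)%:R%R; set w : R := #|E|%:R%R.
have h := inj_count_mulp p j y.
apply: (mulfI (expf_neq0 j p0)).
have -> : (p%:R ^+ j * (w * inj_count p j (p%:R * y) + (w * (p%:R * y) - w) * inj_count p j y) =
  w * (p%:R ^+ j * inj_count p j (p%:R * y) + p%:R ^+ j * (p%:R * y - 1) * inj_count p j y))%R by ring.
rewrite -h; have -> : (p%:R ^+ j * (w * (p%:R * y) / p%:R ^+ j * inj_count p j (p%:R * y)) =
  w * (p%:R * y) * inj_count p j (p%:R * y) * (p%:R ^+ j / p%:R ^+ j))%R by ring.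
by rewrite divff ?expf_neq0 //; ring.
Qed.
End AbelianGroup.

(** * Kernels, spans of columns and relations as finite groups *)

Section MatrixGroups.
Variables (a : nat) (a_gt0 : (0 < a)%N).
Local Notation Zm := (Zmod a).

Lemma sum_row_mx (V : nmodType) N k i (F : 'M[Zm]_(N, k + i) -> V) :
  \sum_c F c = \sum_c \sum_d F (row_mx c d).
Proof.
rewrite pair_bigA /= (reindex (fun x : 'M[Zm]_(N, k) * 'M[Zm]_(N, i) => row_mx x.1 x.2)) //=.
exists (fun c => (lsubmx c, rsubmx c)) => [[c d] _ | c _] /=.
  by rewrite row_mxKl row_mxKr.
exact: hsubmxK.
Qed.

Lemma mulmx_row_eq0 N k i (A : 'M[Zm]_N) (c : 'M[Zm]_(N, k)) (d : 'M[Zm]_(N, i)) :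
  (A *m row_mx c d == 0) = (A *m c == 0) && (A *m d == 0).
Proof.
rewrite mul_mx_row; apply/eqP/andP => [h|[/eqP -> /eqP ->]]; last exact: row_mx0.
by move: h; rewrite -[0 in X in X -> _]row_mx0 => /eq_row_mx[-> ->].
Qed.

Lemma ann_group_set N k (c : 'M[Zm]_(N, k)) : group_set (ann c).
Proof.
apply/group_setP; split; first by rewrite inE mulmx0.
by move=> x y; rewrite !inE => /eqP xc /eqP yc; rewrite FinRing.zmodMgE mulmxDr xc yc addr0.
Qed.
Canonical ann_group N k (c : 'M[Zm]_(N, k)) := Group (ann_group_set c).
Canonical kerset_group N (A : 'M[Zm]_N) := Group (ann_group_set A : group_set (kerset A)).

Lemma cs_group_set N k (c : 'M[Zm]_(N, k)) : group_set (cs c).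
Proof.
apply/group_setP; split; first by apply/imsetP; exists 0; rewrite ?mulmx0.
move=> _ _ /imsetP[x _ ->] /imsetP[y _ ->]; apply/imsetP; exists (x + y) => //.
by rewrite mulmxDr.
Qed.
Canonical cs_group N k (c : 'M[Zm]_(N, k)) := Group (cs_group_set c).

Lemma abelian_cV N : abelian [set: 'cV[Zm]_N]%SET.
Proof. exact: FinRing.zmod_abelian. Qed.

Lemma col_cs N k (c : 'M[Zm]_(N, k)) t : col t c \in cs c.
Proof. by apply/imsetP; exists (delta_mx t 0); rewrite // colE. Qed.

Lemma col_eq0 N k (c : 'M[Zm]_(N, k)) : (forall t, col t c = 0) -> c = 0.
Proof. by move=> h; apply/matrixP => i t; have /colP/(_ i) := h t; rewrite !mxE. Qed.

Lemma cs_sub N k (A : 'M[Zm]_N) (c : 'M[Zm]_(N, k)) : (cs c \subset kerset A) = (A *m c == 0).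
Proof.
apply/fintype.subsetP/eqP => [h|Ac _ /imsetP[l _ ->]]; last by rewrite inE mulmxA Ac mul0mx.
by apply: col_eq0 => t; have := h _ (col_cs c t); rewrite inE => /eqP; rewrite !colE mulmxA.
Qed.

Lemma mul_cV1 N (v : 'cV[Zm]_N) (l : 'cV[Zm]_1) :
  v *m l = v *+ nat_of_ord (l 0 0 : 'I_a.-1.+1).
Proof.
apply/matrixP => i t; rewrite !ord1 mxE big_ord1 mulmxnE -mulr_natr Zmod_natr_val //.
Qed.

Lemma cs_row_mx N k (v : 'cV[Zm]_N) (c : 'M[Zm]_(N, k)) :
  cs (row_mx v c) = (cs c <*> <[v]>)%g.
Proof.
apply/eqP; rewrite finset.eqEsubset join_subG cycle_subG; apply/and3P; split.
- apply/fintype.subsetP => _ /imsetP[l _ ->].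
  rewrite -[l]vsubmxK mul_row_col mul_cV1 -FinRing.zmodXgE addrC -FinRing.zmodMgE.
  apply: groupM; last by apply: (fintype.subsetP (joing_subr _ _)); apply: mem_cycle.
  by apply: (fintype.subsetP (joing_subl _ _)); apply/imsetP; exists (dsubmx l).
- apply/fintype.subsetP => _ /imsetP[l _ ->]; apply/imsetP; exists (col_mx 0 l) => //.
  by rewrite mul_row_col mulmx0 add0r.
- apply/imsetP; exists (col_mx (1%:M) 0) => //.
  by rewrite mul_row_col mulmx0 addr0 mulmx1.
Qed.

Lemma card_cs N k (c : 'M[Zm]_(N, k)) : (#|cs c| * #|ann c| = a ^ k)%N.
Proof.
have fM : {in [set: 'cV[Zm]_k]%SET &, {morph (mulmx c) : x y / (x * y)%g}}.
  by move=> x y _ _ /=; rewrite !FinRing.zmodMgE mulmxDr.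
have := card_morphim (Morphism fM) [set: 'cV[Zm]_k]%SET.
have -> : (Morphism fM @* [set: 'cV[Zm]_k]%SET)%g = cs c.
  by rewrite morphimE finset.setIid; apply/setP => x; apply/imsetP/imsetP => -[l _ ->]; exists l; rewrite ?inE.
have -> : ('ker (Morphism fM))%g = ann c by apply/setP => l; rewrite !inE.
rewrite finset.setIid => ->; rewrite mulnC Lagrange ?finset.subsetT //.
by rewrite cardsT card_mx card_Zmod // muln1.
Qed.

Definition yindex p N k (A : 'M[Zm]_N) (c : 'M[Zm]_(N, k)) := pindex p (kerset A) (cs c).

Lemma card_col_mx N i (S : {set 'cV[Zm]_N}) :
  #|[set d : 'M[Zm]_(N, i) | [forall t, col t d \in S]]%SET| = (#|S| ^ i)%N.
Proof.
pose f (d : 'M[Zm]_(N, i)) := [ffun t => col t d].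
have fI : injective f.
  move=> d d' /ffunP E; apply/matrixP => s t; have := E t; rewrite !ffunE => /colP/(_ s).
  by rewrite !mxE.
rewrite -[i in RHS](card_ord i) -card_ffun_on -(card_imset _ fI); apply: eq_card => g.
apply/imsetP/ffun_onP => [[d + ->] t|h]; first by rewrite inE ffunE => /forallP.
exists (\matrix_(s, t) g t s 0); first rewrite inE; first apply/forallP => t.
  by rewrite (_ : col t _ = g t) ?h //; apply/colP => s; rewrite !mxE.
by apply/ffunP => t; rewrite ffunE; apply/colP => s; rewrite !mxE.
Qed.

Lemma yindex_tuples p N k i (A : 'M[Zm]_N) (c : 'M[Zm]_(N, k)) : prime p -> A *m c = 0 ->
  ((#|cs c| * yindex p A c) ^ i =
   #|[set d : 'M[Zm]_(N, i) | (A *m d == 0)%R && [forall t, (col t d *+ p)%R \in cs c]]%SET|)%N.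
Proof.
move=> p_pr Ac; have CK : cs c \subset kerset A by rewrite cs_sub Ac.
rewrite -(pindexE (abelian_cV N) p CK) -card_col_mx; apply: eq_card => d; rewrite !inE.
apply/forallP/andP => [h|[/eqP Ad /forallP h] t].
  split; last by apply/forallP => t; have := h t; rewrite inE => /andP[].
  by apply/eqP/col_eq0 => t; have := h t; rewrite !inE => /andP[/eqP + _]; rewrite !colE mulmxA.
by rewrite inE (h t) andbT inE colE mulmxA Ad mul0mx.
Qed.

Lemma nkerE N k (A : 'M[Zm]_N) : nker k A = (#|kerset A| ^ k)%N.
Proof.
rewrite -card_col_mx; apply: eq_card => c; rewrite !inE.
apply/eqP/forallP => [Ac t|h]; first by rewrite inE colE mulmxA Ac mul0mx.
by apply: col_eq0 => t; have := h t; rewrite inE => /eqP; rewrite !colE mulmxA.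
Qed.

(** Columns are summed out one at a time, each giving the factor [#|K| * p ^- j] of
    [sum_inj_count_pindex], until the trivial subgroup remains. *)
Lemma sum_inj_count_yindex (R : realType) p N k j (A : 'M[Zm]_N) : prime p ->
  \sum_(c : 'M[Zm]_(N, k) | A *m c == 0) inj_count p j (yindex p A c)%:R =
  (nker k A)%:R * p%:R ^- (j * k) * inj_count p j (pindex p (kerset A) 1%G)%:R :> R.
Proof.
move=> p_pr; elim: k => [|k IH].
  rewrite muln0 expr0 invr1 mulr1 nkerE expn0 mul1r (big_pred1 (0 : 'M[Zm]_(N, 0))).
    congr (inj_count _ _ _%:R); rewrite /yindex /pindex /=; congr #|_ : _ <*> _|%g; apply/setP => v.
    rewrite !inE; apply/imsetP/eqP => [[l _ ->]|->]; first by rewrite mul0mx.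
    by exists 0; rewrite ?mulmx0.
  by move=> c /=; rewrite [c]thinmx0 mulmx0 eqxx; apply/esym/eqP.
rewrite -[k.+1]/(1 + k)%N big_mkcond sum_row_mx /= exchange_big /=.
rewrite (eq_bigr (fun c : 'M[Zm]_(N, k) => if A *m c == 0 then
   #|kerset A|%:R * p%:R ^- j * inj_count p j (yindex p A c)%:R else 0)) => [|c _]; last first.
  have [Ac|Ac] := boolP (A *m c == 0); last first.
    by rewrite big1 // => v _; rewrite mulmx_row_eq0 (negPf Ac) andbF.
  have CK : cs c \subset kerset A by rewrite cs_sub.
  rewrite -(sum_inj_count_pindex (abelian_cV N) p_pr R j CK) [RHS]big_mkcond /=.
  apply: eq_bigr => v _; rewrite mulmx_row_eq0 Ac andbT inE.
  by case: ifP => // _; rewrite /yindex /pindex /= cs_row_mx.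
rewrite -big_mkcond -mulr_sumr IH !nkerE expnS natrM mulnS exprD invfM.
by ring.
Qed.
End MatrixGroups.

Section InjectiveBound.
Variables (a p : nat) (a_gt0 : (0 < a)%N) (p_pr : prime p) (pa : (p %| a)%N).
Local Notation Zm := (Zmod a).
Variables (R : realType).

Definition pbases N j (A : 'M[Zm]_N) : {set 'M[Zm]_(N, j)} :=
  [set D : 'M[Zm]_(N, j) | [&& A *m D == 0, D *+ p == 0 & pindep p D]%R]%SET.

Lemma card_cs_ptors N j (D : 'M[Zm]_(N, j)) : D *+ p = 0 -> (#|cs D| <= p ^ j)%N.
Proof.
move=> pD; have p0 := prime_gt0 p_pr.
pose g (r : 'cV['I_p.-1.+1]_j) : 'cV[Zm]_N := D *m map_mx (fun x : 'I_p.-1.+1 => x%:R) r.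
apply: (@leq_trans #|[set g r | r : 'cV['I_p.-1.+1]_j]%SET|); last first.
  apply: leq_trans (leq_imset_card _ _) _; apply: leq_trans (max_card _) _.
  by rewrite card_mx card_ord muln1 prednK.
apply: subset_leq_card; apply/fintype.subsetP => _ /imsetP[l _ ->]; apply/imsetP.
exists (map_mx (fun x : Zm => inord (nat_of_ord (x : 'I_a.-1.+1) %% p)) l) => //.
apply/matrixP => i t; rewrite !mxE; apply: eq_bigr => s _; rewrite !mxE inordK; last first.
  by rewrite (prednK (prime_gt0 p_pr)) ltn_mod.
rewrite -[in LHS](Zmod_natr_val a_gt0 (l s t)) {1}(divn_eq (nat_of_ord (l s t)) p).
rewrite natrD mulrDr natrM mulrCA (mulr_natr (D i s) p).
by have /matrixP/(_ i s) := pD; rewrite mulmxnE mxE => ->; rewrite mulr0 add0r.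
Qed.

Lemma pindep_row N j (v : 'cV[Zm]_N) (D : 'M[Zm]_(N, j)) :
  v *+ p = 0 -> v \notin cs D -> pindep p D -> pindep p (row_mx v D).
Proof.
move=> pv vD /forallP iD; apply/forallP => l; apply/implyP.
rewrite -[l]vsubmxK mul_row_col mul_cV1 //; set x := nat_of_ord _ => /eqP vl.
have px : (p %| x)%N.
  apply: contraR vD => px.
  have x0 : (0 < x)%N by rewrite lt0n; apply: contra px => /eqP ->; apply: dvdn0.
  have /(coprimeP _ x0)[[u1 u2] /= ux] : coprime x p by rewrite coprime_sym prime_coprime.
  apply/imsetP; exists (- (dsubmx l) *+ u1) => //.
  rewrite mulmxMnr mulmxN; move/eqP: vl; rewrite addr_eq0 => /eqP <-; rewrite -mulrnA.
  have -> : (x * u1 = 1 + u2 * p)%N by lia.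
  by rewrite mulrnDr mulr1n mulnC mulrnA pv mul0rn addr0.
have lx : (usubmx l) *+ (a %/ p) = 0.
  by apply/colP => i; rewrite ord1 mulmxnE [RHS]mxE; apply/eqP; rewrite mulrn_ap.
move: vl; have [y ->] := dvdnP px; rewrite mulnC mulrnA pv mul0rn add0r => /eqP Dl.
have := iD (dsubmx l); rewrite Dl /= => /eqP ly.
apply/eqP/matrixP => s t; rewrite mulmxnE mxE [RHS]mxE; case: splitP => z _.
  by rewrite -mulmxnE lx mxE.
by rewrite -mulmxnE ly mxE.
Qed.

(** For the trivial subgroup [y] is the number of elements of the kernel killed by [p]. The columns
    of an independent [D] span at most [p ^ j] of them, so at least [y - p ^ j] columns extend
    [D]. *)
Lemma inj_count_le N j (A : 'M[Zm]_N) :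
  inj_count p j (pindex p (kerset A) 1%G)%:R <= #|pbases j A|%:R :> R.
Proof.
have p0 := prime_gt0 p_pr.
set y := pindex _ _ _.
have y_tors : y = #|[set d : 'cV[Zm]_N | (A *m d == 0) && (d *+ p == 0)]%R%SET|.
  have := pindexE (abelian_cV a N) p (sub1G (kerset_group A)).
  rewrite cards1 mul1n -/y => <-; apply: eq_card => d; rewrite !inE.
  by rewrite FinRing.zmodXgE.
have [x yx] := pindex_pow (abelian_cV a N) p_pr (sub1G (kerset_group A)); rewrite -/y in yx.
elim: j => [|j IH].
  rewrite /inj_count big_ord0 ler1n; apply/card_gt0P; exists 0; rewrite inE mulmx0 mul0rn !eqxx /=.
  by apply/forallP => l; apply/implyP => _; apply/eqP/matrixP => -[].
have [xj|jx] := ltnP x j.+1.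
  by rewrite yx natrX inj_count_pow_eq0.
have pjy : (p ^ j <= y)%N by rewrite yx leq_exp2l ?prime_gt1 // ltnW.
rewrite inj_countS -natrX -natrB //; apply: (@le_trans _ _ (#|pbases j A| * (y - p ^ j))%:R).
  by rewrite natrM ler_wpM2r.
rewrite ler_nat -sum_nat_const.
apply: (@leq_trans (\sum_(D in pbases j A) #|[set v : 'cV[Zm]_N |
   [&& A *m v == 0, v *+ p == 0 & v \notin cs D]]%R%SET|)).
  apply: leq_sum => D; rewrite inE => /and3P[_ /eqP pD _].
  rewrite (@leq_trans (y - #|cs D|)) ?leq_sub2l ?card_cs_ptors // y_tors.
  rewrite leq_subLR -cardsUI -[X in (X <= _)%N]addn0; apply: leq_add => //.
  apply: subset_leq_card; apply/fintype.subsetP => v; rewrite !inE => /andP[-> ->] /=.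
  by case: (v \in cs D).
rewrite -[leqRHS]sum1_card [leqRHS]big_mkcond -[j.+1]/(1 + j)%N sum_row_mx /= exchange_big /=.
rewrite [leqLHS]big_mkcond; apply: leq_sum => D _; case: ifP => // DA.
rewrite -sum1_card [leqLHS]big_mkcond; apply: leq_sum => v _; rewrite !inE.
case: ifP => // /and3P[Av /eqP pv vD]; move: DA; rewrite inE => /and3P[AD /eqP pD iD].
rewrite mulmx_row_eq0 Av AD pindep_row // andbT.
suff -> : row_mx v D *+ p = 0 by rewrite eqxx.
apply/matrixP => s t; rewrite mulmxnE mxE [RHS]mxE; case: splitP => u _.
  by rewrite -mulmxnE pv mxE.
by rewrite -mulmxnE pD mxE.
Qed.

(** The factor [p ^- (j * k)] of [sum_inj_count_yindex] cancels [p ^ (k * j)] in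
    [uniform_pindep_sum]. *)
Lemma uniform_inj_bound N k j :
  \sum_(M : symmx a N) #|symmx a N|%:R^-1 *
     \sum_(c : 'M[Zm]_(N, k) | val M *m c == 0) inj_count p j (yindex p (val M) c)%:R
  <= p%:R ^+ 'C(j, 2) * (4 ^ #|{: 'rV[Zm]_k * 'rV[Zm]_k}|)%:R :> R.
Proof.
have cS : #|symmx a N| = #|[pred M : 'M[Zm]_N | M^T == M]| by rewrite card_sig.
have S0 : (0 < #|symmx a N|)%N.
  by apply/card_gt0P; exists (exist (fun M : 'M[Zm]_N => M^T == M) 0 (introT eqP (trmx0 _ _ _))).
have p0 : (0 : R) < p%:R by rewrite ltr0n prime_gt0.
rewrite -mulr_sumr ler_pdivrMl ?ltr0n //.
under eq_bigr do rewrite sum_inj_count_yindex //.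
rewrite (sum_sig (fun M : 'M[Zm]_N => M^T == M) (fun M => (nker k M)%:R * p%:R ^- (j * k) *
   inj_count p j (pindex p (kerset M) 1%G)%:R)).
have := uniform_pindep_sum a_gt0 p_pr pa k N R j.
rewrite -(ler_nat R) natr_sum -cS !natrM natrX exprD => h.
apply: (@le_trans _ _ (p%:R ^- (j * k) * \sum_(M : 'M[Zm]_N | M^T == M) (nker k M * #|pbases j M|)%:R)).
  rewrite mulr_sumr; apply: ler_sum => M _; rewrite natrM -mulrA mulrCA.
  apply: ler_wpM2l; first by rewrite invr_ge0 exprn_ge0 // ltW.
  by apply: ler_wpM2l => //; apply: inj_count_le.
rewrite ler_pdivrMl ?exprn_gt0 //; apply: le_trans h _.
rewrite [(j * k)%N]mulnC; set z := (4 ^ _)%:R; set t := #|_|%:R.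
set x := _ ^+ 'C(j, 2); set y := _ ^+ (k * j); move: x y z t => x y z t.
by rewrite (_ : x * y * z * t = y * (t * (x * z))) //; ring.
Qed.
End InjectiveBound.

(** * Approximating the indicator of generation *)

Section PhiPow.
Variables (a p : nat) (a_gt0 : (0 < a)%N) (p_pr : prime p).
Local Notation Zm := (Zmod a).
Variables (R : realType).

Definition ann_left k i (B : {set 'cV[Zm]_(k + i)}) : {set 'cV[Zm]_k} :=
  [set l : 'cV[Zm]_k | col_mx l (0 : 'cV[Zm]_i) \in B]%SET.

(* With y = yindex p A c, there are (|cs c| y)^i tuples d in K^i such that p d
   lies in cs c; dividing by |cs c|^i expresses U (ann c) y^i as a moment of
   (k+i)-tuples. *)
Definition pU k i (U : {set 'cV[Zm]_k} -> R) (B : {set 'cV[Zm]_(k + i)}) : R :=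
  U (ann_left B) * (#|ann_left B|%:R / (a ^ k)%:R) ^+ i *+
  [forall t : 'I_i, [exists l : 'cV[Zm]_k, col_mx l (- (delta_mx t 0 *+ p)) \in B]].

Lemma ann_left_row N k i (c : 'M[Zm]_(N, k)) (d : 'M[Zm]_(N, i)) :
  ann_left (ann (row_mx c d)) = ann c.
Proof. by apply/setP => l; rewrite !inE mul_row_col mulmx0 addr0. Qed.

(** By [card_cs], [#|ann c| / a ^ k] is the inverse of [#|cs c|]; a relation with lower half
    [- p e_t] exhibits [p] times column [t] of [d] as an element of [cs c]. *)
Lemma pU_row N k i (U : {set 'cV[Zm]_k} -> R) (c : 'M[Zm]_(N, k)) (d : 'M[Zm]_(N, i)) :
  pU U (ann (row_mx c d)) =
  U (ann c) * (#|cs c|%:R^-1) ^+ i *+ [forall t, (col t d *+ p)%R \in cs c].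
Proof.
rewrite /pU ann_left_row; congr (_ * _ ^+ _ *+ _).
  have c0 : (#|cs c|%:R != 0 :> R) by rewrite pnatr_eq0 -lt0n (cardG_gt0 (cs_group c)).
  have n0 : (#|ann c|%:R != 0 :> R) by rewrite pnatr_eq0 -lt0n (cardG_gt0 (ann_group c)).
  by rewrite -(card_cs a_gt0 c) natrM invfM mulrCA divff // mulr1.
congr (nat_of_bool _); apply/eq_forallb => t; apply/existsP/imsetP => -[l].
  rewrite inE mul_row_col mulmxN mulmxMnr -colE subr_eq0 => /eqP <-.
  by exists l.
by move=> _ E; exists l; rewrite inE mul_row_col mulmxN mulmxMnr -colE E subrr.
Qed.

(** For [c] in the kernel and primes [s], the columns generate a subgroup containing the Sylow
    subgroups of the kernel at the primes of [s]. *)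
Definition cop s N k (A : 'M[Zm]_N) (c : 'M[Zm]_(N, k)) :=
  all (fun q => ~~ (q %| #|kerset A| %/ #|cs c|)%N) s.

(** The enlarged span lies between [cs c] and [rootset p K (cs c)], so the index between the spans
    is a power of [p] and invisible to the primes of [s]. *)
Lemma cop_row s N k i (A : 'M[Zm]_N) (c : 'M[Zm]_(N, k)) (d : 'M[Zm]_(N, i)) :
  all prime s -> p \notin s -> A *m c = 0 -> A *m d = 0 ->
  [forall t, (col t d *+ p)%R \in cs c] -> cop s A (row_mx c d) = cop s A c.
Proof.
move=> s_pr ps Ac Ad /forallP pd; apply: eq_in_all => q qs.
have CK : cs c \subset kerset A by rewrite cs_sub Ac eqxx.
have RK : cs (row_mx c d) \subset kerset A by rewrite cs_sub mulmx_row_eq0 Ac Ad !eqxx.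
have CR : cs c \subset cs (row_mx c d).
  apply/fintype.subsetP => _ /imsetP[l _ ->]; apply/imsetP; exists (col_mx l 0) => //.
  by rewrite mul_row_col mulmx0 addr0.
have RD : cs (row_mx c d) \subset rootset p (kerset A) (cs c).
  apply/fintype.subsetP => x xR; rewrite inE (fintype.subsetP RK) //=.
  case/imsetP: xR => l _ ->; rewrite FinRing.zmodXgE -[l]vsubmxK mul_row_col mulrnDl.
  rewrite -!mulmxMnr -FinRing.zmodMgE; apply: (groupM (G := cs_group c)).
    by apply/imsetP; exists (usubmx l *+ p).
  rewrite mulmxMnr -mulmxMnl; apply/imsetP.
  have /fin_all_exists[f fE] t : exists u : 'cV[Zm]_k, col t d *+ p = c *m u.
    by have /imsetP[u _] := pd t; exists u.
  exists (\sum_t f t *m (dsubmx l t 0)%:M) => //.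
  rewrite mulmx_sumr; apply/colP => u; rewrite mxE summxE; apply: eq_bigr => t _.
  by rewrite mul_mx_scalar -scalemxAr -fE [RHS]mxE mulrC !mulmxnE [col t d u 0]mxE.
have [x /= rx] := card_rootset (abelian_cV a N) p_pr CK.
pose D := rootset_group (abelian_cV a N) p (kerset_group A) (cs_group c).
have CD : cs c \subset D by apply: fintype.subset_trans CR RD.
have iD : #|D : cs c|%g = (p ^ x)%N.
  have := Lagrange CD; rewrite [#|D|]rx => /eqP.
  by rewrite eqn_pmul2l ?(cardG_gt0 (cs_group c)) // => /eqP.
rewrite (divgS RK) (divgS CK); congr (~~ _).
have -> : #|kerset A : cs c|%g = (#|kerset A : cs (row_mx c d)|%g * #|cs (row_mx c d) : cs c|%g)%N.
  by rewrite (Lagrange_index RK CR).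
have q_pr := allP s_pr q qs.
rewrite Euclid_dvdM // orbC; case: (boolP (q %| #|cs (row_mx c d) : cs c|%g)%N) => // qd.
have : (q %| p ^ x)%N.
  rewrite -iD; apply: dvdn_trans qd _; exact: (indexSg CR (RD : _ \subset D)).
case: x {rx iD} => [|x]; first by rewrite dvdn1 => /eqP q1; rewrite q1 in q_pr.
rewrite Euclid_dvdX // andbT dvdn_prime2 // => /eqP qp.
by rewrite -qp qs in ps.
Qed.

Lemma PhiE s N k (U : {set 'cV[Zm]_k} -> R) (A : 'M[Zm]_N) :
  Phi s U A = \sum_(c : 'M[Zm]_(N, k) | A *m c == 0) U (ann c) *+ cop s A c.
Proof. by []. Qed.

Lemma Phi_pow s N k i (U : {set 'cV[Zm]_k} -> R) (A : 'M[Zm]_N) :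
  all prime s -> p \notin s ->
  Phi s (pU (i := i) U) A =
  \sum_(c : 'M[Zm]_(N, k) | A *m c == 0) U (ann c) *+ cop s A c * (yindex p A c)%:R ^+ i.
Proof.
move=> s_pr ps; rewrite PhiE big_mkcond sum_row_mx [RHS]big_mkcond; apply: eq_bigr => c _.
have [Ac|nAc] := boolP (A *m c == 0); last first.
  by rewrite big1 // => d _; rewrite mulmx_row_eq0 (negPf nAc).
have c0 : (#|cs c|%:R != 0 :> R) by rewrite pnatr_eq0 -lt0n (cardG_gt0 (cs_group c)).
have -> : (yindex p A c)%:R ^+ i = \sum_(d : 'M[Zm]_(N, i) |
    (A *m d == 0)%R && [forall t, (col t d *+ p)%R \in cs c]) (#|cs c|%:R^-1) ^+ i :> R.
  rewrite sumr_const -[LHS](mulfK (expf_neq0 i c0)) -exprMn -natrM -natrX mulnC.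
  rewrite (yindex_tuples i p_pr (eqP Ac)) -[RHS]mulr_natl exprVn; congr (_%:R * _).
  by apply: eq_card => d; rewrite !inE.
rewrite mulr_sumr [RHS]big_mkcond; apply: eq_bigr => d _.
rewrite mulmx_row_eq0 Ac /=; case: ifP => //= Ad.
rewrite pU_row; case: ifP => pd; last by rewrite mulr0n mul0rn.
by rewrite (cop_row s_pr ps (eqP Ac) (eqP Ad) pd) mulr1n -mulrnAl.
Qed.

Lemma Phi_poly s N k (U : {set 'cV[Zm]_k} -> R) (Q : {poly R}) (A : 'M[Zm]_N) :
  all prime s -> p \notin s ->
  \sum_(i < size Q) Q`_i * Phi s (pU (i := i) U) A =
  \sum_(c : 'M[Zm]_(N, k) | A *m c == 0) U (ann c) *+ cop s A c * Q.[(yindex p A c)%:R].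
Proof.
move=> s_pr ps; under eq_bigr do rewrite Phi_pow // mulr_sumr.
rewrite exchange_big; apply: eq_bigr => c _ /=.
by rewrite horner_coef mulr_sumr; apply: eq_bigr => i _; rewrite mulrCA.
Qed.
End PhiPow.

Section Approximation.
Variables (R : realType) (p : nat) (p_gt1 : (1 < p)%N).

Let p0 : (0 : R) < p%:R. Proof. by rewrite ltr0n ltnW. Qed.

Definition tden m : R := \prod_(i < m) (1 - p%:R ^- i.+1).

Lemma tden_ge m : 4^-1 <= tden m.
Proof.
have q2 : (p%:R : R)^-1 <= 2^-1 by rewrite lef_pV2 ?posrE ?ler_nat.
have qi i : (p%:R : R) ^- i <= 2^-1 ^+ i.
  by rewrite -exprVn; apply: lerXn2r; rewrite ?nnegrE ?invr_ge0 // ltW.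
case: m => [|m]; first by rewrite /tden big_ord0 invf_le1 // ler1n.
(* The bound 1/4 alone is not inductive; the extra term absorbs the next factor. *)
suff : 4^-1 + 2^-1 ^+ m.+2 <= tden m.+1 by apply: le_trans; rewrite lerDl exprn_ge0.
have e4 : (4^-1 : R) = 2^-1 ^+ 2 by rewrite exprVn -natrX.
elim: m => [|m IH].
  by rewrite /tden big_ord1 expr1 -e4; lra.
rewrite /tden big_ord_recr -/(tden m.+1) /=.
set t : R := 2^-1 ^+ m.+2 in IH *.
have tE : (2^-1 : R) ^+ m.+3 = t * (1 / 2) by rewrite exprSr mul1r.
have t0 : 0 <= t by rewrite exprn_ge0.
have t1 : t <= 1 / 4.
  rewrite mul1r e4 /t -[m.+2]addn2 exprD; apply: ler_piMl; rewrite ?exprn_ge0 //.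
  by rewrite exprn_ile1 // invf_le1 // ler1n.
have qt : (p%:R : R) ^- m.+2 <= t by apply: qi.
have e41 : (4^-1 : R) = 1 / 4 by rewrite mul1r.
rewrite tE e41 in IH *; set q := _ ^- _ in qt *.
apply: (@le_trans _ _ ((1 / 4 + t) * (1 - t))); first by nra.
apply: ler_pM => //; lra.
Qed.

Lemma tden_gt0 m : 0 < tden m.
Proof. by apply: lt_le_trans (tden_ge m); rewrite invr_gt0. Qed.

(* Vanishes at p, ..., p^m and equals 1 at 1. *)
Definition tpoly m : {poly R} := (tden m)^-1 *: \prod_(i < m) (1 - p%:R ^- i.+1 *: 'X).

Definition hpoly j : {poly R} := \prod_(i < j) ('X - (p%:R ^+ i)%:P).

Lemma horner_hpoly j y : (hpoly j).[y] = inj_count p j y.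
Proof. by rewrite horner_prod; apply: eq_bigr => i _; rewrite !hornerE. Qed.

Lemma horner_tpoly m y : (tpoly m).[y] = (tden m)^-1 * \prod_(i < m) (1 - p%:R ^- i.+1 * y).
Proof. by rewrite hornerZ horner_prod; congr (_ * _); apply: eq_bigr => i _; rewrite !hornerE. Qed.

Lemma inj_count_ge0 j x : 0 <= inj_count p j (p%:R ^+ x) :> R.
Proof.
have [xj|jx] := ltnP x j; first by rewrite inj_count_pow_eq0.
apply: prodr_ge0 => i _; rewrite subr_ge0 ler_weXn2l ?ler1n ?(ltnW p_gt1) //.
by apply: leq_trans jx; apply: ltnW.
Qed.

(** At [x = 0] the polynomial is exact and for [1 <= x <= m] it vanishes. Beyond, its product is
    [p ^- 'C(m.+1, 2)] times the product of the [y - p^i] for [1 <= i <= m]; [inj_count] has the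
    further factor [y - 1 >= p ^ m], whence the second part of the exponent. The 4 bounds the
    inverse of [tden m]. *)
Lemma tpoly_approx m x :
  `|(x == 0%N)%:R - (tpoly m).[p%:R ^+ x]| <=
  4 * p%:R ^- ('C(m.+1, 2) + m) * inj_count p m.+1 (p%:R ^+ x).
Proof.
have c0 : 0 <= 4 * p%:R ^- ('C(m.+1, 2) + m) :> R.
  by rewrite mulr_ge0 // invr_ge0 exprn_ge0 // ltW.
rewrite horner_tpoly; case: x => [|x].
  rewrite expr0 eqxx (_ : \prod_(i < m) _ = tden m); last by apply: eq_bigr => i _; rewrite mulr1.
  by rewrite mulVf ?gt_eqF ?tden_gt0 // subrr normr0 mulr_ge0 // -[1](expr0 p%:R) inj_count_ge0.
rewrite sub0r normrN normrM normfV (gtr0_norm (tden_gt0 m)) normr_prod -mulrA.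
apply: ler_pM; rewrite ?invr_ge0 ?(ltW (tden_gt0 m)) //.
    by apply: prodr_ge0.
  by rewrite invf_ple ?posrE ?tden_gt0 // tden_ge.
have [xm|mx] := ltnP x m.
  rewrite (bigD1 (Ordinal xm)) //= mulVf ?expf_neq0 ?gt_eqF // subrr normr0 mul0r.
  by rewrite mulr_ge0 ?inj_count_ge0 // invr_ge0 exprn_ge0 // ltW.
set y := p%:R ^+ x.+1.
have ygt i : (i <= m)%N -> p%:R ^+ i < y :> R.
  by move=> im; rewrite ltr_eXn2l ?ltr1n // ltnS (leq_trans im).
have -> : \prod_(i < m) `|1 - p%:R ^- i.+1 * y| =
    p%:R ^- 'C(m.+1, 2) * \prod_(i < m) (y - p%:R ^+ i.+1).
  have -> : p%:R ^- 'C(m.+1, 2) = \prod_(i < m) (p%:R : R) ^- i.+1.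
    rewrite prodfV prodrXr; congr (_ ^- _).
    by rewrite -bin2_sum big_nat_recl // add0n big_mkord.
  rewrite -big_split /=; apply: eq_bigr => i _.
  have pi0 : (0 : R) < p%:R ^+ i.+1 by rewrite exprn_gt0.
  rewrite -normrN opprB -[X in `|_ - X|](mulVf (lt0r_neq0 pi0)) -mulrBr normrM ger0_norm ?invr_ge0 ?ltW //.
  by rewrite gtr0_norm // subr_gt0 ygt.
rewrite /inj_count big_ord_recl expr0 exprD invfM -!mulrA ler_pM2l ?invr_gt0 ?exprn_gt0 //.
rewrite mulrA ler_peMl //.
  by apply: prodr_ge0 => i _; rewrite subr_ge0 ltW // ygt.
rewrite ler_pdivlMl ?exprn_gt0 // mulr1 lerBrDr.
apply: (@le_trans _ _ (p%:R ^+ m.+1)); last by rewrite ler_eXn2l ?ltr1n.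
rewrite exprSr (@le_trans _ _ (p%:R ^+ m * 2)) // ?ler_wpM2l ?ler_nat ?exprn_ge0 ?(ltW p0) //.
by rewrite mulrDr mulr1 lerD2l exprn_ege1 // ler1n ltnW.
Qed.
End Approximation.

(** * Universality by induction on primes *)

Section ApproxLimit.
Local Open Scope classical_set_scope.
Variable R : realType.

(** At fixed [m] and large N the error [H m N] is barely above [e m]. Comparing two indices at a
    common large N gives [|l m - l n| <= e m + e n], so [l] is Cauchy. *)
Lemma approx_cvg (F : nat -> R) (G H : nat -> nat -> R) (l L e : nat -> R) :
  (forall m, G m @ \oo --> l m) -> (forall m, H m @ \oo --> L m) ->
  (forall m, L m <= e m) -> e @ \oo --> (0 : R) ->
  (forall m N, `|F N - G m N| <= H m N) ->
  cvgn l /\ F @ \oo --> limn l.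
Proof.
move=> Gl HL Le e0 FG.
have near_H m (t : R) : 0 < t -> \forall N \near \oo, H m N < e m + t.
  move=> t0; have : e m + t > L m by rewrite (le_lt_trans (Le m)) // ltrDl.
  exact: cvgr_lt.
have near_G m (t : R) : 0 < t -> \forall N \near \oo, `|l m - G m N| < t.
  by move=> t0; have /cvgrPdist_lt/(_ _ t0) := Gl m.
have ln m n : `|l m - l n| <= e m + e n.
  apply/ler_addgt0Pr => t t0; have t4 : 0 < t / 4 by rewrite divr_gt0.
  near \oo => N.
  have h1 : `|l m - G m N| < t / 4 by near: N; exact: near_G.
  have h2 : `|l n - G n N| < t / 4 by near: N; exact: near_G.
  have h3 : H m N < e m + t / 4 by near: N; exact: near_H.
  have h4 : H n N < e n + t / 4 by near: N; exact: near_H.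
  have h5 := FG m N; have h6 := FG n N.
  have -> : l m - l n = (l m - G m N) + ((F N - G n N) - (F N - G m N)) - (l n - G n N) by ring.
  apply: le_trans (ler_normB _ _) _; apply: (@le_trans _ _ (`|l m - G m N| +
    (`|F N - G n N| + `|F N - G m N|) + `|l n - G n N|)).
    by rewrite lerD2r (le_trans (ler_normD _ _)) // lerD2l ler_normB.
  lra.
have cl : cvgn l.
  apply/cauchy_cvgP/cauchy_exP => t t0 /=.
  have t2 : 0 < t / 2 by rewrite divr_gt0.
  have : \forall m \near \oo, e m < t / 2 by apply: (cvgr_lt 0).
  move=> [M _ hM]; exists (l M); exists M => // n /= Mn.
  rewrite /ball /=; apply: le_lt_trans (ln M n) _.
  have := hM M (leqnn M); have := hM n Mn; rewrite /=; lra.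
split=> //; apply/cvgrPdist_lt => t t0.
have t4 : 0 < t / 4 by rewrite divr_gt0.
near \oo => m.
have em : e m < t / 4 by near: m; apply: (cvgr_lt 0).
have lm : `|limn l - l m| < t / 4 by near: m; have /cvgrPdist_lt/(_ _ t4) := cl.
near=> N.
have h1 : `|l m - G m N| < t / 4 by near: N; exact: near_G.
have h3 : H m N < e m + t / 4 by near: N; exact: near_H.
have h5 := FG m N.
have -> : limn l - F N = (limn l - l m) + (l m - G m N) - (F N - G m N) by ring.
apply: le_lt_trans (ler_normB _ _) _; apply: (@le_lt_trans _ _ (`|limn l - l m| + `|l m - G m N| +
  `|F N - G m N|)); first by rewrite lerD2r ler_normD.
lra.
Unshelve. all: by end_near. Qed.
End ApproxLimit.

(** A common shape for both random matrices, so that the induction on primes can quantify over all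
    models with the moments of the uniform one. *)
Record matrix_model (a : nat) (R : realType) := MatrixModel {
  mm_space : nat -> finType;
  mm_weight : forall N, mm_space N -> R;
  mm_matrix : forall N, mm_space N -> 'M[Zmod a]_N;
  mm_weight_ge0 : forall N (o : mm_space N), 0 <= mm_weight o }.

Section Models.
Variables (a : nat) (a_gt0 : (0 < a)%N) (R : realType).
Local Notation Zm := (Zmod a).
Implicit Types (mu : matrix_model a R).

Definition expect mu N (F : 'M[Zm]_N -> R) : R :=
  \sum_(o : mm_space mu N) mm_weight o * F (mm_matrix o).

Lemma expect_lin mu N n (c : 'I_n -> R) (F : 'I_n -> 'M[Zm]_N -> R) :
  expect mu (fun A => \sum_i c i * F i A) = \sum_i c i * expect mu (F i).
Proof.
under [RHS]eq_bigr do rewrite mulr_sumr.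
rewrite exchange_big; apply: eq_bigr => o _ /=; rewrite mulr_sumr.
by apply: eq_bigr => i _; rewrite mulrCA.
Qed.

Lemma expectZ mu N (c : R) (F : 'M[Zm]_N -> R) :
  expect mu (fun A => c * F A) = c * expect mu F.
Proof. by rewrite mulr_sumr; apply: eq_bigr => o _; rewrite mulrCA. Qed.

Lemma expect_dist mu N (F G H : 'M[Zm]_N -> R) : (forall A, `|F A - G A| <= H A) ->
  `|expect mu F - expect mu G| <= expect mu H.
Proof.
move=> h; rewrite -sumrB; apply: le_trans (ler_norm_sum _ _ _) _; apply: ler_sum => o _.
by rewrite -mulrBr normrM ger0_norm ?mm_weight_ge0 // ler_wpM2l ?mm_weight_ge0.
Qed.

(* The limits of all moments are those of the uniform model. *)
Definition universal mu := forall k (U : {set 'cV[Zm]_k} -> R),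
  ((fun N => expect mu (Phi (N := N) [::] U)) @ \oo --> limPhi U)%classic.

Lemma invn_ge0 n : (0 : R) <= n%:R^-1. Proof. by rewrite invr_ge0. Qed.

Definition unif_model : matrix_model a R :=
  @MatrixModel a R (symmx a) (fun N _ => #|symmx a N|%:R^-1) (fun N M => val M)
    (fun N _ => invn_ge0 _).

Lemma unif_universal : universal unif_model.
Proof.
move=> k U; have [e [eD en e1]] := faithful_char_ex a_gt0 R[i].
exact: uniform_base.
Qed.

Section Induction.
Variables (p : nat) (p_pr : prime p) (pa : (p %| a)%N).

Lemma cop_cons s N k (A : 'M[Zm]_N) (c : 'M[Zm]_(N, k)) : A *m c = 0 ->
  exists x, yindex p A c = (p ^ x)%N /\ cop (p :: s) A c = (x == 0%N) && cop s A c.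
Proof.
move=> Ac; have CK : cs c \subset kerset A by rewrite cs_sub Ac eqxx.
have [x yx] := pindex_pow (abelian_cV a N) p_pr CK.
exists x; split=> //; rewrite /cop /= (divgS CK) -(pindex_eq1 (abelian_cV a N) p_pr CK) yx.
by rewrite -[X in _ == X](expn0 p) eqn_exp2l // prime_gt1.
Qed.

Definition err k j N (A : 'M[Zm]_N) : R :=
  \sum_(c : 'M[Zm]_(N, k) | A *m c == 0) inj_count p j (yindex p A c)%:R.

Definition lim_err k j : R :=
  \sum_(i < size (hpoly R p j)) (hpoly R p j)`_i * limPhi (pU (a := a) p (k := k) (i := i) (fun=> 1)).

Lemma err_poly k j N (A : 'M[Zm]_N) : err k j A =
  \sum_(i < size (hpoly R p j)) (hpoly R p j)`_i * Phi [::] (pU (a := a) p (k := k) (i := i) (fun=> 1)) A.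
Proof.
rewrite (Phi_poly a_gt0 p_pr) //; apply: eq_bigr => c _.
by rewrite horner_hpoly mul1r.
Qed.

Lemma err_cvg mu k j : universal mu ->
  ((fun N => expect mu (err k j (N := N))) @ \oo --> lim_err k j)%classic.
Proof.
move=> muU.
rewrite (_ : (fun N => _) = (fun N => \sum_(i < size (hpoly R p j)) (hpoly R p j)`_i *
    expect mu (Phi (N := N) [::] (pU (a := a) p (k := k) (i := i) (fun=> 1))))); last first.
  apply/funext => N; rewrite -expect_lin; apply: eq_bigr => o _; congr (_ * _).
  exact: err_poly.
by apply: cvg_finsum => i _; apply: cvgM; [exact: cvg_cst | exact: muU].
Qed.

Lemma lim_err_le k j :
  lim_err k j <= p%:R ^+ 'C(j, 2) * (4 ^ #|{: 'rV[Zm]_k * 'rV[Zm]_k}|)%:R.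
Proof.
apply: (cvgr_to_le (err_cvg (k := k) (j := j) unif_universal)); apply: nearW => N. exact: uniform_inj_bound.
Qed.

Lemma cancel_weight (b w x y : R) : x != 0 -> b * (4 * (x^-1 * y)) * (x * w) = b * 4 * w * y.
Proof.
move=> x0; rewrite (_ : b * _ * _ = b * 4 * w * y * (x^-1 * x)); last by ring.
by rewrite mulVf // mulr1.
Qed.

Lemma Phi_cvg_step s : all prime s -> p \notin s ->
  (forall k (U : {set 'cV[Zm]_k} -> R), exists l : R, forall mu, universal mu ->
     ((fun N => expect mu (Phi (N := N) s U)) @ \oo --> l)%classic) ->
  forall k (U : {set 'cV[Zm]_k} -> R), exists l : R, forall mu, universal mu ->
     ((fun N => expect mu (Phi (N := N) (p :: s) U)) @ \oo --> l)%classic.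
Proof.
move=> s_pr ps IH k U.
(* These limits are chosen before any model, so [l] and its limit are common to all universal
   models. *)
pose ell k' (U' : {set 'cV[Zm]_k'} -> R) := sval (cid (IH k' U')).
have ellP k' (U' : {set 'cV[Zm]_k'} -> R) mu : universal mu ->
    ((fun N => expect mu (Phi (N := N) s U')) @ \oo --> ell k' U')%classic.
  by rewrite /ell; case: cid => x /= h muU; exact: h.
pose B : R := \sum_T `|U T|.
have B0 : 0 <= B by apply: sumr_ge0.
have UB T : `|U T| <= B by rewrite /B (bigD1 T) //= lerDl sumr_ge0.
pose T m := tpoly R p m.
pose l m := \sum_(i < size (T m)) (T m)`_i * ell _ (pU p (i := i) U).
pose c m : R := B * (4 * p%:R ^- ('C(m.+1, 2) + m)).
pose G mu m N := expect mu (fun A : 'M[Zm]_N => \sum_(i < size (T m)) (T m)`_i * Phi s (pU p (i := i) U) A).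
pose H mu m N := expect mu (fun A : 'M[Zm]_N => c m * err k m.+1 A).
pose W4 : R := (4 ^ #|{: 'rV[Zm]_k * 'rV[Zm]_k}|)%:R.
(* The bound on [lim_err k m.+1] grows like [p ^ 'C(m.+1, 2)], which cancels against [c m] and
   leaves [p ^- m]. *)
pose eps m : R := B * 4 * W4 * (p%:R^-1) ^+ m.
have pR : (0 : R) < p%:R by rewrite ltr0n prime_gt0.
have c0 m : 0 <= c m by rewrite mulr_ge0 // mulr_ge0 // invr_ge0 exprn_ge0 // ltW.
have eps0 : (eps @ \oo --> (0 : R))%classic.
  rewrite -[X in (_ --> X)%classic](mulr0 (B * 4 * W4)); apply: cvgM; first exact: cvg_cst.
  apply: cvg_expr; rewrite ger0_norm ?invr_ge0 ?ltW // invf_lt1 // ltr1n.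
  exact: prime_gt1.
suff h mu : universal mu -> cvgn l /\ ((fun N => expect mu (Phi (N := N) (p :: s) U)) @ \oo --> limn l)%classic.
  by exists (limn l) => mu /h[].
move=> muU; apply: (@approx_cvg R _ (G mu) (H mu) l (fun m => c m * lim_err k m.+1) eps) => //.
- move=> m; rewrite /G; under eq_fun do rewrite expect_lin.
  by apply: cvg_finsum => i _; apply: cvgM; [exact: cvg_cst | exact: ellP].
- move=> m; rewrite /H; under eq_fun do rewrite expectZ.
  by apply: cvgM; [exact: cvg_cst | exact: err_cvg].
- move=> m; apply: le_trans (ler_wpM2l (c0 m) (lim_err_le k m.+1)) _.
  have q0 : p%:R ^+ 'C(m.+1, 2) != 0 :> R by rewrite expf_neq0 // gt_eqF.
  by rewrite -/W4 /c /eps exprD exprVn invfM cancel_weight.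
- move=> m N; apply: expect_dist => A; rewrite (Phi_poly a_gt0 p_pr) // PhiE -sumrB.
  apply: le_trans (ler_norm_sum _ _ _) _; rewrite /err mulr_sumr; apply: ler_sum => d /eqP Ad.
  have [x [yx ->]] := cop_cons s Ad; rewrite yx natrX.
  rewrite (_ : U (ann d) *+ ((x == 0%N) && cop s A d) = U (ann d) *+ cop s A d * (x == 0%N)%:R); last first.
    by case: (x == 0%N); rewrite ?mulr1 ?mulr0.
  rewrite -mulrBr normrM /c -mulrA; apply: ler_pM => //; last exact: tpoly_approx (prime_gt1 p_pr) m x.
  by case: (cop s A d); [exact: UB | rewrite normr0].
Qed.
End Induction.

Lemma Phi_cvg s : all prime s -> uniq s -> all (fun p => p %| a)%N s ->
  forall k (U : {set 'cV[Zm]_k} -> R), exists l : R, forall mu, universal mu ->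
     ((fun N => expect mu (Phi (N := N) s U)) @ \oo --> l)%classic.
Proof.
elim: s => [|p s IH] /=; first by move=> _ _ _ k U; exists (limPhi U) => mu; apply.
move=> /andP[p_pr s_pr] /andP[ps us] /andP[pa sa].
exact: Phi_cvg_step (IH s_pr us sa).
Qed.
End Models.

(** * Cokernels and kernels *)

Local Open Scope quotient_scope.

Section AdditiveMaps.
Variables (A B : zmodType) (f : A -> B).
Hypothesis fD : forall x y, f (x + y) = f x + f y.

Lemma addf0 : f 0 = 0.
Proof. by apply: (addrI (f 0)); rewrite -fD !addr0. Qed.
Lemma addfN x : f (- x) = - f x.
Proof. by apply: (addrI (f x)); rewrite -fD !subrr addf0. Qed.
Lemma addfB x y : f (x - y) = f x - f y.
Proof. by rewrite fD addfN. Qed.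
Lemma addf_sum (I : Type) (s : seq I) (P : pred I) (F : I -> A) :
  f (\sum_(i <- s | P i) F i) = \sum_(i <- s | P i) f (F i).
Proof. exact: (big_morph f fD addf0). Qed.
Lemma addfMn x n : f (x *+ n) = f x *+ n.
Proof. by elim: n => [|n IH]; rewrite ?mulr0n ?addf0 // !mulrS fD IH. Qed.
Lemma addfMz x z : f (x *~ z) = f x *~ z.
Proof. by case: z => n; rewrite ?NegzE ?mulrNz ?addfN -!pmulrn addfMn. Qed.

Lemma isoZ_bij (g : B -> A) : cancel f g -> cancel g f -> isoZ A B.
Proof.
move=> fK gK; have fa : zmod_morphism f by move=> x y; apply: addfB.
pose m := GRing.isZmodMorphism.Build A B f fa.
pose F : {additive A -> B} := HB.pack f m.
by exists F, g.
Qed.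
End AdditiveMaps.

Lemma isoZ_sym (A B : zmodType) : isoZ A B -> isoZ B A.
Proof.
move=> [f [g fK gK]]; apply: (@isoZ_bij B A g _ f) => // x y.
by apply: (can_inj fK); rewrite raddfD !gK.
Qed.

Lemma isoZ_trans (A B D : zmodType) : isoZ A B -> isoZ B D -> isoZ A D.
Proof.
move=> [f [f' fK f'K]] [g [g' gK g'K]]; apply: (@isoZ_bij A D (g \o f) _ (f' \o g')).
- by move=> x y /=; rewrite !raddfD.
- by move=> x /=; rewrite gK fK.
- by move=> x /=; rewrite f'K g'K.
Qed.

Section Quotients.
Variables (V : zmodType) (I : zmodClosed V).
Local Notation Q := {ideal_quot I}.

Definition cls (x : V) : Q := \pi_Q x.

Lemma clsD x y : cls (x + y) = cls x + cls y.
Proof. exact: raddfD. Qed.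

Lemma cls_eq x y : (cls x == cls y) = (x - y \in I).
Proof. by rewrite Quotient.idealrBE. Qed.

Lemma cls_eq0 x : (cls x == 0) = (x \in I).
Proof. by rewrite -(addf0 clsD) cls_eq subr0. Qed.

Lemma cls_repr (s : Q) : cls (repr s) = s.
Proof. exact: reprK. Qed.

Section Lift.
Variables (M : zmodType) (h : V -> M).
Hypotheses (hD : forall x y, h (x + y) = h x + h y) (hI : forall x, x \in I -> h x = 0).

Definition qlift (s : Q) : M := h (repr s).

Lemma qlift_cls x : qlift (cls x) = h x.
Proof.
apply/eqP; rewrite -subr_eq0 -(addfB hD) hI //.
by rewrite -cls_eq cls_repr.
Qed.

Lemma qliftD s t : qlift (s + t) = qlift s + qlift t.
Proof. by rewrite -[s]cls_repr -[t]cls_repr -clsD !qlift_cls hD. Qed.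
End Lift.
End Quotients.

Section CokernelKernel.
Variables (a : nat) (a_gt0 : (0 < a)%N).
Local Notation Zm := (Zmod a).

(** In Z/a the multiples of [n] are those of [g = gcd(n, a)], by Bezout, and these form the kernel
    of multiplication by [a / g]. *)
Lemma mulrn_gcd_eq0 n (x : Zm) :
  x *+ (a %/ gcdn n a) = 0 <-> exists t : Zm, x = t *+ n.
Proof.
set g := gcdn n a; have g0 : (0 < g)%N by rewrite gcdn_gt0 a_gt0 orbT.
have ag : (a %/ g * g)%N = a by rewrite divnK // dvdn_gcdr.
have q0 : (0 < a %/ g)%N by move: a_gt0; rewrite -{1}ag muln_gt0 => /andP[].
split=> [/eqP|[t ->]]; last first.
  rewrite -mulrnA; apply/eqP; rewrite Zmod_mulrn_eq0 // dvdn_mull //.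
  have -> : (n * (a %/ g) = n %/ g * a)%N.
    by rewrite -{2}ag -[in LHS](divnK (dvdn_gcdl n a)) -/g -mulnA [(g * _)%N]mulnC.
  exact: dvdn_mull.
rewrite Zmod_mulrn_eq0 // -{1}ag mulnC dvdn_pmul2r // => gx.
have [u _ /dvdnP[v uv]] := Bezoutl n a_gt0.
rewrite gcdnC -/g in uv.
set x' := nat_of_ord _ in gx; have [y xy] := dvdnP gx.
exists (- (y * u)%:R); rewrite -[x](Zmod_natr_val a_gt0) -/x' xy.
apply/eqP; rewrite mulNrn -subr_eq0 opprK -mulrnA -natrD Zmod_natr_eq0 //.
by rewrite -mulnA -mulnDr uv dvdn_mull // dvdn_mull.
Qed.

Lemma mulrn_eq0_gcd n (x : Zm) :
  x *+ n = 0 <-> exists t : Zm, x = t *+ (a %/ gcdn n a).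
Proof.
set g := gcdn n a; have g0 : (0 < g)%N by rewrite gcdn_gt0 a_gt0 orbT.
have ag : (a %/ g * g)%N = a by rewrite divnK // dvdn_gcdr.
have ng : (n %/ g * g)%N = n by rewrite divnK // dvdn_gcdl.
split=> [/eqP|[t ->]].
  rewrite Zmod_mulrn_eq0 // -{1}ag -{1}ng mulnA dvdn_pmul2r // Gauss_dvdl.
    by move=> /dvdnP[y xy]; exists y%:R; rewrite -[x](Zmod_natr_val a_gt0) xy natrM mulr_natr.
  rewrite /coprime -(eqn_pmul2r g0) muln_gcdl ag ng mul1n gcdnC //.
rewrite -mulrnA; apply/eqP; rewrite Zmod_mulrn_eq0 // dvdn_mull //.
have -> : (a %/ g * n = n %/ g * a)%N by rewrite -{2}ag -{1}ng mulnCA.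
exact: dvdn_mull.
Qed.

(* For A = diag(d_i), take E = diag(a / gcd(d_i, a)). *)
Lemma dual_matrix N (A : 'M[Zm]_N) : exists E : 'M[Zm]_N,
  (forall x : 'cV[Zm]_N, E *m x = 0 <-> exists v, x = A *m v) /\
  (forall x : 'cV[Zm]_N, A *m x = 0 <-> exists v, x = E *m v).
Proof.
pose X : 'M[int]_N := \matrix_(i, l) (nat_of_ord (A i l : 'I_a.-1.+1))%:Z.
have AX : A = map_mx intr X.
  by apply/matrixP => i l; rewrite !mxE -pmulrn Zmod_natr_val.
have [L uL [V uV [s _ XE]]] := int_Smith_normal_form X.
pose phi (Y : 'M[int]_N) : 'M[Zm]_N := map_mx intr Y.
pose U := phi L; pose U' := phi (invmx L); pose V1 := phi V; pose V' := phi (invmx V).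
have UU' : U *m U' = 1%:M by rewrite -map_mxM mulmxV // map_mx1.
have U'U : U' *m U = 1%:M by rewrite -map_mxM mulVmx // map_mx1.
have VV' : V1 *m V' = 1%:M by rewrite -map_mxM mulmxV // map_mx1.
have V'V : V' *m V1 = 1%:M by rewrite -map_mxM mulVmx // map_mx1.
pose d (i : 'I_N) : nat := nat_of_ord ((s`_i)%:~R : Zm).
pose dg (f : 'I_N -> nat) : 'M[Zm]_N := diag_mx (\row_i (f i)%:R).
have dgE f (x : 'cV[Zm]_N) i : (dg f *m x) i 0 = x i 0 *+ f i.
  by rewrite mul_diag_mx !mxE mulr_natl.
pose c i := (a %/ gcdn (d i) a)%N.
have AE : A = U *m dg d *m V1.
  rewrite AX XE !map_mxM; congr (_ *m _ *m _); apply/matrixP => i l; rewrite !mxE.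
  have [->|il] := eqVneq i l; first by rewrite eqxx !mulr1n Zmod_natr_val.
  by rewrite (_ : (i == l :> nat) = false) //; apply: contraNF il => /eqP/ord_inj ->.
pose Ga := dg c.
exists (V' *m Ga *m U'); split=> x.
  split=> [h|[v ->]].
    have h' : Ga *m (U' *m x) = 0.
      by rewrite -[LHS]mul1mx -VV' -!mulmxA [V' *m _]mulmxA [V' *m _ *m _]mulmxA h mulmx0.
    have tP i : exists t : Zm, (U' *m x) i 0 = t *+ d i.
      by apply/mulrn_gcd_eq0; rewrite -/(c i) -dgE h' mxE.
    have [t tE] := fin_all_exists tP.
    exists (V' *m \col_i t i); rewrite AE -!mulmxA [V1 *m _]mulmxA VV' mul1mx.
    rewrite (_ : dg d *m \col_i t i = U' *m x) ?mulmxA ?UU' ?mul1mx //.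
    by apply/colP => i; rewrite dgE tE mxE.
  rewrite AE -!mulmxA [U' *m (U *m _)]mulmxA U'U mul1mx.
  rewrite (_ : Ga *m (dg d *m _) = 0) ?mulmx0 //; apply/colP => i; rewrite dgE [RHS]mxE.
  by apply/mulrn_gcd_eq0; exists ((V1 *m v) i 0); rewrite dgE.
split=> [h|[v ->]].
  have h' : dg d *m (V1 *m x) = 0.
    by rewrite -[LHS]mul1mx -U'U -!mulmxA mulmxA; move: h; rewrite AE -!mulmxA => ->; rewrite mulmx0.
  have tP i : exists t : Zm, (V1 *m x) i 0 = t *+ c i.
    by apply/mulrn_eq0_gcd; rewrite -dgE h' mxE.
  have [t tE] := fin_all_exists tP.
  exists (U *m \col_i t i); rewrite -!mulmxA [U' *m _]mulmxA U'U mul1mx.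
  rewrite (_ : Ga *m \col_i t i = V1 *m x) ?mulmxA ?V'V ?mul1mx //.
  by apply/colP => i; rewrite dgE tE mxE.
rewrite AE -!mulmxA [V1 *m (V' *m _)]mulmxA VV' mul1mx.
rewrite (_ : dg d *m (Ga *m _) = 0) ?mulmx0 //; apply/colP => i; rewrite dgE [RHS]mxE.
by apply/mulrn_eq0_gcd; exists ((U' *m v) i 0); rewrite dgE.
Qed.

Definition embeds_onto_ker (G : zmodType) N (A : 'M[Zm]_N) :=
  exists f : G -> 'cV[Zm]_N, [/\ forall x y, f (x + y) = f x + f y, injective f &
    forall v, (A *m v == 0) <-> exists x, v = f x].

(** The dual matrix [E] has the column space of [A] as kernel and the kernel of [A] as image, so it
    induces an isomorphism from the cokernel of [A] onto its kernel. *)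
Lemma isoZ_cok (G : zmodType) N (A : 'M[Zm]_N) : isoZ (cok A) G <-> embeds_onto_ker G A.
Proof.
have [E [E1 E2]] := dual_matrix A.
have ED (x y : 'cV[Zm]_N) : E *m (x + y) = E *m x + E *m y by exact: mulmxDr.
pose I : zmodClosed 'cV[Zm]_N := GRing.ZmodClosed.clone _ (colspace A) _.
have inI x : x \in I <-> exists v, x = A *m v by split=> /asboolP.
have EI x : x \in I -> E *m x = 0 by move/inI/E1.
have lE x : qlift (I := I) (fun x => E *m x) (cls I x) = E *m x := qlift_cls ED EI x.
have inj0 (s : {ideal_quot I}) : qlift (fun x => E *m x) s = 0 -> s = 0.
  by rewrite -[s]cls_repr lE => /E1/inI h; apply/eqP; rewrite cls_eq0.
split=> [[F [F' FK F'K]]|[f [fD fI fK]]].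
  have F'D x y : F' (x + y) = F' x + F' y by apply: (can_inj FK); rewrite raddfD !F'K.
  exists (fun g => qlift (fun x => E *m x) (F' g : {ideal_quot I})); split.
  - by move=> x y; rewrite F'D; apply: qliftD.
  - move=> x y /eqP; rewrite -subr_eq0 -(addfB (qliftD ED EI)) -(addfB F'D) => /eqP/inj0 h.
    by apply/eqP; rewrite -subr_eq0 -[x - y]F'K [F' _]h raddf0.
  - move=> v; split=> [/eqP/E2[x ->]|[x ->]].
      by exists (F (cls I x)); rewrite FK lE.
    by apply/eqP/E2; exists (repr (F' x : {ideal_quot I})).
have exF (s : {ideal_quot I}) : exists g, E *m repr s = f g.
  by apply/fK/eqP/E2; exists (repr s).
have exG g : exists x, f g = E *m x by apply/E2/eqP/fK; exists g.
pose F s := sval (cid (exF s)).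
have FE s : E *m repr s = f (F s) by rewrite /F; case: cid.
pose H g := cls I (sval (cid (exG g))).
have HE g : qlift (fun x => E *m x) (H g) = f g by rewrite /H lE; case: cid.
apply: (@isoZ_bij (cok A) G F _ H).
- by move=> s t; apply: fI; rewrite -FE fD -!FE; exact: (qliftD ED EI).
- move=> s; apply/eqP; rewrite -subr_eq0; apply/eqP/inj0.
  by rewrite (addfB (qliftD ED EI)) HE -FE subrr.
- by move=> g; apply: fI; rewrite -FE -HE.
Qed.
End CokernelKernel.

(** * The sandpile group modulo a *)

Section TensorUniversal.
Variables (A B : zmodType).
Local Notation J := (GRing.ZmodClosed.clone _ (span_sub (@bilinear_rel A B)) _ : zmodClosed _).

Definition tp (x : A) (y : B) : tensor A B := cls J (free_pair x y).

Lemma tpDl x x' y : tp (x + x') y = tp x y + tp x' y.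
Proof.
apply/eqP; rewrite -clsD cls_eq; apply/asboolP => H hH.
by rewrite opprD addrA; apply: hH; left; exists x, x', y.
Qed.

Lemma tpDr x y y' : tp x (y + y') = tp x y + tp x y'.
Proof.
apply/eqP; rewrite -clsD cls_eq; apply/asboolP => H hH.
by rewrite opprD addrA; apply: hH; right; exists x, y, y'.
Qed.

Variables (M : zmodType).

Lemma tensor_ext (h h' : tensor A B -> M) :
  (forall s t, h (s + t) = h s + h t) -> (forall s t, h' (s + t) = h' s + h' t) ->
  (forall x y, h (tp x y) = h' (tp x y)) -> h =1 h'.
Proof.
move=> hD h'D hh s; rewrite -[s]cls_repr -(freeg_sumE (repr s)).
rewrite (addf_sum (clsD _)) (addf_sum hD) (addf_sum h'D); apply: eq_bigr => -[x y] _.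
have fz z : << z *g (x, y) >> = (free_pair x y) *~ z by rewrite /free_pair freegU_mulz intz.
by rewrite fz (addfMz (clsD _)) (addfMz hD) (addfMz h'D) hh.
Qed.

Section Lift.
Variable f : A -> B -> M.
Hypotheses (fDl : forall x x' y, f (x + x') y = f x y + f x' y)
  (fDr : forall x y y', f x (y + y') = f x y + f x y').

Definition flift (z : {freeg (A * B)%type}) : M :=
  fglift (fun xy => f xy.1 xy.2 : zmodule M) z.

Lemma fliftD x y : flift (x + y) = flift x + flift y.
Proof.
have fB : forall u v, flift (u - v) = flift u - flift v.
  exact: (lift_is_additive (fun xy : A * B => f xy.1 xy.2 : zmodule M)).
by rewrite -[y in LHS]opprK fB -[- y]sub0r fB -[0]subr0 fB subrr sub0r opprK.
Qed.

Lemma flift_pair x y : flift (free_pair x y) = f x y.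
Proof. by rewrite /flift /free_pair liftU scale1r. Qed.

Lemma flift_span x : x \in J -> flift x = 0.
Proof.
(* The span is the intersection of the subgroups containing the relations; the kernel of [flift] is
   one of them. *)
pose S : pred {freeg (A * B)%type} := fun x => flift x == 0.
have SZ : zmod_closed S.
  split; first by rewrite unfold_in (addf0 fliftD).
  by move=> u v /eqP hu /eqP hv; rewrite unfold_in (addfB fliftD) hu hv subrr.
pose m := GRing.isZmodClosed.Build _ S SZ.
pose H : zmodClosed _ := HB.pack S m.
move/asboolP => /(_ H) h; apply/eqP; apply: h => _ [[u [v [w ->]]]|[u [v [w ->]]]].
  by rewrite unfold_in /= /S !(addfB fliftD) !flift_pair fDl addrAC addrK subrr.
by rewrite unfold_in /= /S !(addfB fliftD) !flift_pair fDr addrAC addrK subrr.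
Qed.

Definition tlift : tensor A B -> M := qlift (I := J) flift.

Lemma tliftD s t : tlift (s + t) = tlift s + tlift t.
Proof. exact: (qliftD fliftD flift_span). Qed.

Lemma tlift_tp x y : tlift (tp x y) = f x y.
Proof. by rewrite -flift_pair; exact: (qlift_cls fliftD flift_span). Qed.
End Lift.
End TensorUniversal.

Section LaplacianSums.
Variables (n : nat) (g : graph n).
Local Notation L := (laplacian g).

Lemma laplacian_sym i l : L i l = L l i.
Proof. by rewrite !mxE eq_sym finset.setUC; case: eqP => // ->. Qed.

Lemma laplacian_row_sum i : \sum_l L i l = 0.
Proof.
rewrite (bigD1 i) //= mxE eqxx /vdeg; apply/eqP; rewrite addrC subr_eq0; apply/eqP.
transitivity (\sum_(d in edges g | i \in d) (1 : int)); last first.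
  by rewrite sumr_const pmulrn intz; congr (Posz _); apply: eq_card => d; rewrite !inE.
have d1 d : d \in edges g -> i \in d -> \sum_(l in d | l != i) (1 : int) = 1.
  move=> dg id_; have /fintype.subsetP/(_ d dg) : edges g \subset pairs n by case: (g).
  rewrite inE (cardsD1 i) id_ add1n => /eqP[d2].
  rewrite sumr_const (_ : #|_| = 1%N) // -[RHS]d2.
  by apply: eq_card => l; rewrite !inE andbC.
under [RHS]eq_bigr => d /andP[dg id_] do rewrite -(d1 d dg id_).
rewrite (exchange_big_dep (fun l => l != i)) /=; last by move=> d l _ /andP[].
apply: eq_bigr => l li; rewrite mxE eq_sym (negPf li).
rewrite (eq_bigl (fun d => (d == [set i; l]%SET) && (d \in edges g))); last first.
  move=> d; rewrite andbT; apply/idP/idP => [/andP[/andP[dg id_] ld]|/andP[/eqP -> ->]].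
    rewrite dg andbT eq_sym eqEcard finset.subUset !finset.sub1set id_ ld /=.
    have /fintype.subsetP/(_ d dg) : edges g \subset pairs n by case: (g).
    by rewrite inE => /eqP ->; rewrite cards2 eq_sym li.
  by rewrite !inE !eqxx orbT.
by rewrite big_mkcondr big_pred1_eq.
Qed.
End LaplacianSums.

Section SandpileTensor.
Variables (a n : nat) (g : graph n.+1).
Local Notation Zm := (Zmod a).
Local Notation L := (laplacian g).
Local Notation L0 := (redlap a g).
Local Notation Z := (zero_sum_vec n.+1).
Local Notation I := (GRing.ZmodClosed.clone _ (colspace L0) _ : zmodClosed _).
Local Notation K := (GRing.ZmodClosed.clone _ (lap_image g) _ : zmodClosed _).
Implicit Types (z : Z) (r : Zm).

(** Forgetting the coordinate at the deleted vertex identifies zero-sum vectors with [Z^n], since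
    the sum condition restores it. *)
Definition redcol z r : 'cV[Zm]_n := \col_i (r *~ zs_val z (fintype.lift ord0 i) 0).

Lemma zs_valD z z' : zs_val (z + z') = zs_val z + zs_val z'.
Proof. exact: (raddfD val z z'). Qed.

Lemma redcolE z r i : redcol z r i 0 = r *~ zs_val z (fintype.lift ord0 i) 0.
Proof. by rewrite mxE. Qed.

Lemma redcolDl r z z' : redcol (z + z') r = redcol z r + redcol z' r.
Proof. by apply/colP => i; rewrite redcolE zs_valD [X in r *~ X]mxE mulrzDr [RHS]mxE !redcolE. Qed.

Lemma redcolDr z r r' : redcol z (r + r') = redcol z r + redcol z r'.
Proof. by apply/colP => i; rewrite [RHS]mxE !redcolE mulrzDl. Qed.

Definition redcls z r : cok L0 := cls I (redcol z r).

Lemma redclsDl r z z' : redcls (z + z') r = redcls z r + redcls z' r.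
Proof. by rewrite /redcls redcolDl; exact: clsD. Qed.

Lemma redclsDr z r r' : redcls z (r + r') = redcls z r + redcls z r'.
Proof. by rewrite /redcls redcolDr; exact: clsD. Qed.

Lemma redcls_lap r z : z \in K -> redcls z r = 0.
Proof.
move=> /asboolP[v zE]; apply/eqP; rewrite cls_eq0; apply/asboolP.
(* The rows of the Laplacian sum to 0, so subtracting the constant [v ord0 0] from [v] leaves the
   image unchanged and removes the column of the deleted vertex. *)
exists (\col_l (r *~ (v (fintype.lift ord0 l) 0 - v ord0 0))); apply/colP => i; rewrite redcolE zE !mxE.
have -> : \sum_m L (fintype.lift ord0 i) m * v m 0 =
    \sum_l L (fintype.lift ord0 i) (fintype.lift ord0 l) * (v (fintype.lift ord0 l) 0 - v ord0 0).
  under [RHS]eq_bigr do rewrite mulrBr; rewrite sumrB -mulr_suml.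
  have := laplacian_row_sum g (fintype.lift ord0 i); rewrite big_ord_recl => /eqP.
  by rewrite addr_eq0 big_ord_recl => /eqP ->; rewrite mulNr addrC.
rewrite mulrz_sumr; apply: eq_bigr => l _.
by rewrite !mxE mulrzl -mulrzA mulrC.
Qed.

Definition sand_cok (s : sandpile g) r : cok L0 := qlift (I := K) (redcls^~ r) s.

Lemma sand_cokDl s s' r : sand_cok (s + s') r = sand_cok s r + sand_cok s' r.
Proof. exact: (qliftD (redclsDl r) (@redcls_lap r)). Qed.

Lemma sand_cokDr s r r' : sand_cok s (r + r') = sand_cok s r + sand_cok s r'.
Proof. exact: redclsDr. Qed.

Lemma sand_cok_cls z r : sand_cok (cls K z) r = redcls z r.
Proof. exact: (qlift_cls (redclsDl r) (@redcls_lap r)). Qed.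

Lemma sum_pred1 m (j : 'I_m) : \sum_i (i == j)%:R = 1 :> int.
Proof. by rewrite (bigD1 j) //= eqxx big1 ?addr0 // => l /negPf ->. Qed.

Lemma zeps_sum (i : 'I_n) :
  zero_sum (delta_mx (fintype.lift ord0 i) 0 - delta_mx ord0 0 : 'cV[int]_n.+1).
Proof.
apply/eqP; under eq_bigr do rewrite !mxE !andbT.
by rewrite sumrB !sum_pred1 subrr.
Qed.

Definition zeps i : Z := ZeroSum (zeps_sum i).

Definition zcoord (j : 'I_n.+1) z : int := zs_val z j 0.

Lemma zcoordD j z z' : zcoord j (z + z') = zcoord j z + zcoord j z'.
Proof. by rewrite /zcoord zs_valD mxE. Qed.

Lemma zcoord_eps j i : zcoord j (zeps i) = (j == fintype.lift ord0 i)%:R - (j == ord0)%:R.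
Proof. by rewrite /zcoord !mxE !andbT. Qed.

Lemma zeps_decomp z : z = \sum_i zeps i *~ zcoord (fintype.lift ord0 i) z.
Proof.
apply: val_inj; apply/colP => j; rewrite -!/(zcoord j _).
rewrite (addf_sum (zcoordD j)).
under eq_bigr do rewrite (addfMz (zcoordD j)) zcoord_eps -mulrzl intz.
case: (unliftP ord0 j) => [l ->|->].
  rewrite (bigD1 l) //= eqxx subr0 mulr1 big1 ?addr0 // => i il.
  by rewrite (inj_eq lift_inj) eq_sym (negPf il) subrr mulr0.
have : \sum_i zs_val z i 0 == 0 by case: (z).
rewrite big_ord_recl addr_eq0 => /eqP h; rewrite /zcoord h -sumrN.
by apply: eq_bigr => i _; rewrite eqxx /= sub0r mulrN1.
Qed.

(** The inverse map, read off from the basis [zeps] of the zero-sum vectors. *)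
Definition cok_tensor0 (x : 'cV[Zm]_n) : tensor (sandpile g) Zm :=
  \sum_i tp (cls K (zeps i) : sandpile g) (x i 0).

Lemma cok_tensor0D x y : cok_tensor0 (x + y) = cok_tensor0 x + cok_tensor0 y.
Proof. by rewrite -big_split; apply: eq_bigr => i _; rewrite mxE tpDr. Qed.

Lemma tpMz (s : sandpile g) r m : tp s (r *~ m) = tp (s *~ m) r.
Proof. by rewrite (addfMz (tpDr s)) (addfMz (fun s t => tpDl s t r)). Qed.

Lemma tp_sum (I0 : finType) (F : I0 -> sandpile g) r : \sum_i tp (F i) r = tp (\sum_i F i) r.
Proof. by rewrite (addf_sum (fun s t => tpDl s t r)). Qed.

Lemma cok_tensor0_redcol z r : cok_tensor0 (redcol z r) = tp (cls K z : sandpile g) r.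
Proof.
rewrite [in RHS](zeps_decomp z) (addf_sum (clsD K)) -tp_sum; apply: eq_bigr => i _.
by rewrite redcolE tpMz (addfMz (clsD K)).
Qed.

Lemma lap_col_sum (l : 'I_n) : zero_sum (L *m delta_mx (fintype.lift ord0 l) 0 : 'cV[int]_n.+1).
Proof.
apply/eqP; under eq_bigr do rewrite -colE mxE laplacian_sym.
exact: laplacian_row_sum.
Qed.

(** By symmetry the columns of the Laplacian are zero-sum vectors, so an element of the column space
    is a sum of vectors [redcol z r] with [z] in the image of the Laplacian; such [z] vanish in the
    sandpile group. *)
Lemma cok_tensor0_colspace x : x \in I -> cok_tensor0 x = 0.
Proof.
move=> /asboolP[v ->].
have -> : L0 *m v = \sum_l redcol (ZeroSum (lap_col_sum l)) (v l 0).
  apply/colP => i; rewrite summxE mxE; apply: eq_bigr => l _.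
  by rewrite redcolE /= -colE !mxE mulrzl.
rewrite (addf_sum cok_tensor0D) big1 // => l _; rewrite cok_tensor0_redcol.
rewrite (_ : cls K _ = 0) ?(addf0 (fun s t => tpDl s t (v l 0))) //.
by apply/eqP; rewrite cls_eq0; apply/asboolP; exists (delta_mx (fintype.lift ord0 l) 0).
Qed.

Lemma tensor_sandpile : isoZ (tensor (sandpile g) Zm) (cok L0).
Proof.
have hD := tliftD sand_cokDl sand_cokDr; have hE := tlift_tp sand_cokDl sand_cokDr.
have kD := qliftD cok_tensor0D cok_tensor0_colspace.
have kE := qlift_cls cok_tensor0D cok_tensor0_colspace.
apply: (isoZ_bij hD (g := qlift (I := I) cok_tensor0)).
  apply: (@tensor_ext _ _ _ (_ \o _) id) => //= [s t|s r]; first by rewrite hD; exact: kD.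
  rewrite hE -[s]cls_repr sand_cok_cls -cok_tensor0_redcol; exact: kE.
move=> s; have [x ->] : exists x, s = cls I x by exists (repr s); rewrite cls_repr.
rewrite (_ : qlift _ _ = cok_tensor0 x); last exact: kE.
rewrite (addf_sum hD).
under eq_bigr do rewrite hE sand_cok_cls.
rewrite -(addf_sum (clsD I)); congr (cls I _); apply/colP => l; rewrite summxE.
rewrite (bigD1 l) //= redcolE -/(zcoord _ _) zcoord_eps eqxx subr0 big1 ?addr0 // => i il.
by rewrite redcolE -/(zcoord _ _) zcoord_eps (inj_eq lift_inj) eq_sym (negPf il) subrr.
Qed.
End SandpileTensor.

(** * Counting presentations *)

Section Presentation.
Variables (a : nat) (a_gt0 : (0 < a)%N) (G : finZmodType).
Hypothesis expG : (exponent [set: G] %| a)%N.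
Local Notation Zm := (Zmod a).
Implicit Types (x y : G) (r : Zm).

Lemma mulrn_exp x : x *+ a = 0.
Proof.
have := expg_exponent (finset.in_setT x); case/dvdnP: expG => b -> h.
by rewrite mulnC mulrnA -[x *+ exponent _]FinRing.zmodXgE h mul0rn.
Qed.

Lemma mulrn_mod x n : x *+ (n %% a) = x *+ n.
Proof. by rewrite [in RHS](divn_eq n a) mulrnDr mulnC mulrnA mulrn_exp mul0rn add0r. Qed.

Definition zsmul x r : G := x *+ nat_of_ord (r : 'I_a.-1.+1).

Lemma zsmul_nat x n : zsmul x n%:R = x *+ n.
Proof. by rewrite /zsmul val_Zmod_natr // mulrn_mod. Qed.

Lemma zsmulDr x r r' : zsmul x (r + r') = zsmul x r + zsmul x r'.
Proof.
by rewrite -{1}[r](Zmod_natr_val a_gt0) -{1}[r'](Zmod_natr_val a_gt0) -natrD zsmul_nat mulrnDr.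
Qed.

Section Combination.
Variables (k : nat) (u : 'I_k -> G).

Definition lincomb (l : 'cV[Zm]_k) : G := \sum_t zsmul (u t) (l t 0).

Lemma lincombD l l' : lincomb (l + l') = lincomb l + lincomb l'.
Proof. by rewrite -big_split; apply: eq_bigr => t _; rewrite mxE zsmulDr. Qed.

Lemma lincomb_delta t : lincomb (delta_mx t 0) = u t.
Proof.
rewrite /lincomb (bigD1 t) //= big1 => [|i it].
  by rewrite mxE !eqxx addr0 zsmul_nat.
by rewrite mxE (negPf it) zsmul_nat.
Qed.

Definition relset : {set 'cV[Zm]_k} := [set l | lincomb l == 0]%SET.
End Combination.

(** The relations among all elements of [G], listed once each; they present [G] as a quotient of the
    free module of rank [#|G|] over Z/a. *)
Definition relG : {set 'cV[Zm]_#|G|} := relset (@enum_val G G).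

Section Kernel.
Variables (N : nat) (A : 'M[Zm]_N).
Local Notation k := #|G|.
Implicit Types c : 'M[Zm]_(N, k).

Lemma embeds_of_tuple c : A *m c = 0 -> ann c = relG -> cs c = kerset A -> embeds_onto_ker G A.
Proof.
move=> Ac cG cK.
have cE l l' : (c *m l == c *m l') = (lincomb (@enum_val G G) l == lincomb (@enum_val G G) l').
  rewrite -[LHS]subr_eq0 -[RHS]subr_eq0 -mulmxBr -(addfB (lincombD _)).
  by have /setP/(_ (l - l')) := cG; rewrite !inE.
pose dl x : 'cV[Zm]_k := delta_mx (enum_rank x) 0.
have dlE x : lincomb (@enum_val G G) (dl x) = x by rewrite lincomb_delta enum_rankK.
exists (fun x => c *m dl x); split.
- by move=> x y; apply/eqP; rewrite -mulmxDr cE lincombD !dlE.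
- by move=> x y /eqP; rewrite cE !dlE => /eqP.
move=> v; split=> [Av|[x ->]]; last by rewrite mulmxA Ac mul0mx.
have : v \in kerset A by rewrite inE.
rewrite -cK => /imsetP[l _ ->]; exists (lincomb (@enum_val G G) l).
by apply/eqP; rewrite cE dlE.
Qed.

Definition nrel : nat := #|[set u : {ffun 'I_k -> G} | relset u == relG]%SET|.

Lemma nrel_gt0 : (0 < nrel)%N.
Proof.
apply/card_gt0P; exists [ffun t => enum_val t]; rewrite inE; apply/eqP/setP => l.
by rewrite !inE /lincomb; under eq_bigr do rewrite ffunE.
Qed.

(** The order of the kernel divides [a ^ N], so every prime factor of the index of [cs c] is a prime
    factor of [a]. *)
Lemma cop_primes c : A *m c = 0 -> cop (primes a) A c = (cs c == kerset A).
Proof.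
move=> Ac; have CK : cs c \subset kerset A by rewrite cs_sub Ac eqxx.
apply/allP/eqP => [h|-> p pa]; last first.
  by rewrite divnn cardG_gt0 dvdn1 neq_ltn prime_gt1 ?orbT // (allP (all_prime_primes a)).
apply/eqP; rewrite eqEcard CK /= leqNgt; apply/negP => lt.
have Cd : (#|cs c| %| #|kerset A|)%N by apply: cardSg.
have i1 : (1 < #|kerset A| %/ #|cs c|)%N by rewrite ltn_divRL // mul1n.
have := h (pdiv (#|kerset A| %/ #|cs c|)); rewrite pdiv_dvd => /(_ _)/negP[] //.
rewrite mem_primes pdiv_prime // a_gt0 /=.
have : (pdiv (#|kerset A| %/ #|cs c|) %| a ^ N)%N.
  apply: dvdn_trans (pdiv_dvd _) _; apply: dvdn_trans (dvdn_div Cd) _.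
  have -> : (a ^ N)%N = #|[set: 'cV[Zm]_N]%SET| by rewrite cardsT card_mx card_Zmod // muln1.
  by apply: cardSg; apply: finset.subsetT.
by rewrite Euclid_dvdX ?pdiv_prime // => /andP[].
Qed.

Section Embedding.
Variable f : G -> 'cV[Zm]_N.
Hypotheses (fD : forall x y, f (x + y) = f x + f y) (fI : injective f)
  (fK : forall v, (A *m v == 0) <-> exists x, v = f x).

Definition tuple_of (u : {ffun 'I_k -> G}) : 'M[Zm]_(N, k) := \matrix_(i, t) f (u t) i 0.

Lemma tuple_of_mul u l : tuple_of u *m l = f (lincomb u l).
Proof.
rewrite (addf_sum fD); apply/colP => i; rewrite mxE summxE; apply: eq_bigr => t _.
by rewrite mxE (addfMn fD) mulmxnE -mulr_natr Zmod_natr_val.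
Qed.

Lemma ann_tuple_of u : ann (tuple_of u) = relset u.
Proof. by apply/setP => l; rewrite !inE tuple_of_mul -(addf0 fD) (inj_eq fI). Qed.

Lemma tuple_of_ker u : A *m tuple_of u = 0.
Proof.
apply: col_eq0 => t; rewrite colE -mulmxA tuple_of_mul; apply/eqP/fK.
by exists (lincomb u (delta_mx t 0)).
Qed.

Lemma tuple_of_bij : {on [pred c | A *m c == 0], bijective tuple_of}.
Proof.
have ex c t : exists x, A *m c == 0 -> col t c = f x.
  have [/eqP Ac|_] := boolP (A *m c == 0); last by exists 0.
  have /fK[x ->] : A *m col t c == 0 by rewrite colE mulmxA Ac mul0mx.
  by exists x.
exists (fun c => [ffun t => sval (cid (ex c t))]) => [u _|c].
  apply/ffunP => t; rewrite ffunE; case: cid => x /= /(_ _) h.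
  apply: fI; rewrite -h ?tuple_of_ker //; apply/colP => i; by rewrite !mxE.
rewrite inE => Ac; apply/matrixP => i t; rewrite mxE ffunE; case: cid => x /= /(_ Ac) <-.
by rewrite mxE.
Qed.

(** By [card_cs] the relations determine the order of the span, and the listing of all elements of
    [G], which has the same relations, spans the kernel. *)
Lemma cs_tuple_of (u : {ffun 'I_k -> G}) : relset u = relG -> cs (tuple_of u) = kerset A.
Proof.
move=> uG; pose u0 : {ffun 'I_k -> G} := [ffun t => enum_val t].
have u0G : relset u0 = relG.
  by apply/setP => l; rewrite !inE /lincomb; under eq_bigr do rewrite ffunE.
have C0 : cs (tuple_of u0) = kerset A.
  apply/setP => v; rewrite [RHS]inE; apply/imsetP/idP => [[l _ ->]|/fK[x ->]].
    by apply/fK; exists (lincomb u0 l); rewrite tuple_of_mul.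
  exists (delta_mx (enum_rank x) 0) => //.
  by rewrite tuple_of_mul lincomb_delta ffunE enum_rankK.
apply/eqP; rewrite eqEcard cs_sub tuple_of_ker eqxx -C0 /=.
have := card_cs a_gt0 (tuple_of u0); rewrite -(card_cs a_gt0 (tuple_of u)).
rewrite !ann_tuple_of uG u0G => /eqP; rewrite eqn_pmul2r => [/eqP ->//|].
by rewrite -u0G -ann_tuple_of cardG_gt0.
Qed.
End Embedding.

Definition indG (R : realType) (B : {set 'cV[Zm]_k}) : R := (B == relG)%:R.

(** If the kernel is a copy of [G], its tuples with relations [relG] are the images of the [nrel]
    such tuples of [G], and all of them generate. Conversely a single generating tuple with these
    relations identifies the kernel with [G]. *)
Lemma Phi_embeds (R : realType) :
  Phi (primes a) (@indG R) A = nrel%:R * (`[< embeds_onto_ker G A >])%:R.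
Proof.
rewrite PhiE; have [[f [fD fI fK]]|nE] := asboolP; last first.
  rewrite mulr0 big1 // => c /eqP Ac; rewrite cop_primes // /indG.
  case: eqP => cG; rewrite ?mul0rn //; case: eqP => // cK.
  by case: nE; apply: embeds_of_tuple Ac cG cK.
rewrite mulr1 (reindex (tuple_of f)); last exact: tuple_of_bij fD fI fK.
rewrite /nrel -sum1dep_card natr_sum big_mkcond [RHS]big_mkcond; apply: eq_bigr => u _.
rewrite (tuple_of_ker fD fK) eqxx cop_primes ?(tuple_of_ker fD fK) // /indG (ann_tuple_of fD fI).
by case: eqP => [uG|_]; rewrite ?mul0rn // (cs_tuple_of fD fI fK uG) eqxx.
Qed.
End Kernel.
End Presentation.

(** * The two probabilities as normalised moments *)

Section Assembly.
Variables (a : nat) (a_gt0 : (0 < a)%N) (R : realType).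
Local Notation Zm := (Zmod a).

Section Laplacians.
Variables (q : R) (q_gt0 : 0 < q) (q_lt1 : q < 1).

Lemma er_weight_ge0 n (g : graph n) : 0 <= er_weight q g.
Proof. by apply: prodr_ge0 => d _; case: ifP => _; rewrite ?subr_ge0 ltW. Qed.

Definition lap_model : matrix_model a R :=
  @MatrixModel a R (fun N => graph N.+1) (fun N => er_weight q (n := N.+1)) (redlap a)
    (fun N => er_weight_ge0 (n := N.+1)).

Lemma lap_universal : universal lap_model.
Proof.
move=> k U; have [e [eD en e1]] := faithful_char_ex a_gt0 R[i].
exact: redlap_base eD en e1 U.
Qed.
End Laplacians.

Variables (G : finZmodType) (expG : (exponent [set: G]%SET %| a)%N).
Local Notation nr := ((nrel a G)%:R : R).

Lemma nrel_neq0 : nr != 0.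
Proof. by rewrite pnatr_eq0 -lt0n nrel_gt0. Qed.

Lemma erdos_renyi_expect (q : R) (q_gt0 : 0 < q) (q_lt1 : q < 1) N :
  erdos_renyi q [set g : graph N.+1 | isoZ (tensor (sandpile g) Zm) G]%classic =
  expect (lap_model q_gt0 q_lt1) (Phi (N := N) (primes a) (@indG a G R)) / nr.
Proof.
apply: canRL (mulfK nrel_neq0) _; rewrite /erdos_renyi big_mkcond mulr_suml.
apply: eq_bigr => g _ /=; rewrite Phi_embeds //.
have gE : isoZ (tensor (sandpile g) Zm) G <-> embeds_onto_ker G (redlap a g).
  rewrite -isoZ_cok //; have h := tensor_sandpile a g.
  by split; apply: isoZ_trans => //; apply: isoZ_sym.
rewrite (asbool_equiv_eq gE) /=; case: asboolP => _; last by rewrite mul0r !mulr0.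
by rewrite mulr1.
Qed.

Lemma unif_proba_expect N :
  unif_proba R [set H : symmx a N | isoZ (cok (val H)) G]%classic =
  expect (unif_model a R) (Phi (N := N) (primes a) (@indG a G R)) / nr.
Proof.
apply: canRL (mulfK nrel_neq0) _; rewrite /unif_proba -mulrA mulrC -sum1dep_card natr_sum.
rewrite big_mkcond mulr_sumr; apply: eq_bigr => H _ /=; rewrite Phi_embeds //.
rewrite (asbool_equiv_eq (isoZ_cok a_gt0 G (val H))) /=.
by case: asboolP => _; rewrite ?mulr0 // !mulr1 mulrC.
Qed.
End Assembly.

Local Open Scope classical_set_scope.

Theorem corollary9p1 (R : realType) (q : R) (q_gt0 : 0 < q) (q_lt1 : q < 1)
    (a : nat) (a_gt0 : (0 < a)%N) (G : finZmodType)
    (expG : (exponent [set: G]%SET %| a)%N) :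
  let PS := fun n : nat => erdos_renyi q
    [set Gamma : graph n | isoZ (tensor (sandpile Gamma) (Zmod a)) G] in
  let PH := fun n : nat => unif_proba R
    [set H : symmx a n | isoZ (cok (val H)) G] in
  [/\ cvgn PS, cvgn PH & limn PS = limn PH].
Proof.
move=> PS PH.
have pr : all prime (primes a) by apply: all_prime_primes.
have pa : all (fun p => p %| a)%N (primes a).
  by apply/allP => p; rewrite mem_primes => /and3P[].
have [l hl] := Phi_cvg a_gt0 pr (primes_uniq a) pa (@indG a G R).
have PSl : PS @ \oo --> l / (nrel a G)%:R.
  (* A graph on N+1 vertices has a reduced Laplacian of size N, so the sequence is shifted by one to
     match the model. *)
  rewrite -cvg_shiftS /=.
  rewrite (_ : (fun n => _) = fun N => expect (lap_model a q_gt0 q_lt1)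
    (Phi (N := N) (primes a) (@indG a G R)) / (nrel a G)%:R); last first.
    by apply/funext => N; rewrite /PS erdos_renyi_expect.
  by apply: cvgMl; apply: hl; apply: lap_universal.
have PHl : PH @ \oo --> l / (nrel a G)%:R.
  rewrite (_ : PH = fun N => expect (unif_model a R)
    (Phi (N := N) (primes a) (@indG a G R)) / (nrel a G)%:R); last first.
    by apply/funext => N; rewrite /PH unif_proba_expect.
  by apply: cvgMl; apply: hl; apply: unif_universal.
split; first exact: cvgP PSl.
  exact: cvgP PHl.
by rewrite (cvg_lim _ PSl) // (cvg_lim _ PHl).
Qed.
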